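(* Let $\alpha\ge 2$, $1<\beta<\infty$, and let $\mu$ be a positive Borel measure on $[0,1)$. Then: (i) $\mathcal{H}_{\mu,\alpha}$ is a bounded operator from $\mathscr{B}_{\beta}$ into $\mathscr{B}_{\alpha-1}$ if and only if $\mu$ is a $(\beta+1)$-Carleson measure. (ii) $\mathcal{H}_{\mu,\alpha}$ is a compact operator from $\mathscr{B}_{\beta}$ into $\mathscr{B}_{\alpha-1}$ if and only if $\mu$ is a vanishing $(\beta+1)$-Carleson measure.
   Context: $\mathbb{D}$ is the open unit disc, $H(\mathbb{D})$ the analytic functions on $\mathbb{D}$. For $\alpha>0$, the Bloch type space $\mathscr{B}_{\alpha}$ is the set of $f\in H(\mathbb{D})$ with $\|f\|_{\mathscr{B}_\alpha}=\sup_{z\in\mathbb{D}}(1-|z|^2)^{\alpha}|f'(z)|<\infty$; it is a Banach space with norm $|f(0)|+\|f\|_{\mathscr{B}_\alpha}$. For a positive Borel measure $\mu$ on $[0,1)$ and $\alpha>0$ put $\mu_{n,k,\alpha}=\int_{[0,1)}\frac{\Gamma(n+\alpha)}{n!\,\Gamma(\alpha)}t^{n+k}\,d\mu(t)$ for $n,k\ge 0$, and for $f(z)=\sum_{k\ge0}a_kz^k\in H(\mathbb{D})$ define $\mathcal{H}_{\mu,\alpha}(f)(z)=\sum_{n=0}^\infty\big(\sum_{k=0}^\infty\mu_{n,k,\alpha}a_k\big)z^n$ whenever the right-hand side makes sense (the numbers $\mu_{n,k,\alpha}$ are finite and the inner series converge) and defines an analytic function in $\mathbb{D}$. Saying that $\mathcal{H}_{\mu,\alpha}$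 is a bounded (or compact) operator from $X$ into $Y$ includes that it is well defined in this sense on every $f\in X$. For $s>0$, a positive Borel measure $\mu$ on $[0,1)$ is an $s$-Carleson measure if there is $C>0$ with $\mu([t,1))\le C(1-t)^s$ for all $0\le t<1$; it is a vanishing $s$-Carleson measure if in addition $\lim_{t\to1^-}\mu([t,1))/(1-t)^s=0$. *)

(* Defs.v *)
From HB Require Import structures.
From mathcomp Require Import all_boot all_order all_algebra.
From mathcomp Require Import all_classical all_reals all_analysis.
From mathcomp Require Import complex.

Set Implicit Arguments.
Unset Strict Implicit.
Unset Printing Implicit Defensive.

Import Order.TTheory GRing.Theory Num.Theory.
Import numFieldNormedType.Exports.

Local Open Scope ring_scope.
Local Open Scope classical_set_scope.
Local Open Scope complex_scope.

(* The complex numbers, as a numClosedFieldType: this is what gives them the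
   topology and the normed space structure of numFieldNormedType. *)
Definition cplx (R : realType) : numClosedFieldType := R[i].

Section defs.
Context {R : realType}.
Local Notation C := (cplx R).
Implicit Types (f g : C -> C) (a : nat -> C) (z : C).

(* Modulus with values in R (the library's `|z| is (cabs z)%:C). *)
Definition cabs z : R := ComplexField.Normc.normc z.

Definition disc : set C := [set z | cabs z < 1].

Definition power_series a z : nat -> C := series (fun k => a k * z ^+ k).

(* A function on the disc is represented by a total function C -> C; nothing
   below depends on its values outside the (open) disc. *)
Definition analytic_on_disc f : Prop :=
  forall z0, disc z0 ->
    exists a, \forall z \near z0, power_series a (z - z0) @ \oo --> f z.

(* For f analytic on the disc, the sequence a with f(z) = sum_k a_k z^k on the
   disc exists and is unique; the default value of xget is never used. *)
Definition coefs f : nat -> C :=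
  xget (fun=> 0) [set a | forall z, disc z -> power_series a z @ \oo --> f z].

Definition bloch_seminorm (alpha : R) f : \bar R :=
  ereal_sup [set ((1 - cabs z ^+ 2) `^ alpha * cabs (derive1 f z))%:E
            | z in disc].

Definition bloch_norm (alpha : R) f : \bar R :=
  ((cabs (f 0))%:E + bloch_seminorm alpha f)%E.

Definition bloch (alpha : R) : set (C -> C) :=
  [set f | analytic_on_disc f /\ (bloch_seminorm alpha f < +oo)%E].

Definition Gamma (x : R) : R :=
  \int[lebesgue_measure]_(t in `]0, +oo[) (t `^ (x - 1) * expR (- t)).

(* A Borel measure on [0, 1) is represented by a Borel measure on the line;
   the definitions below only use its restriction to [0, 1). *)
Implicit Types mu : {measure set (measurableTypeR R) -> \bar R}.

Definition hankel_moment mu (alpha : R) (n k : nat) : \bar R :=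
  (\int[mu]_(t in `[0%R, 1%R[)
    (Gamma (n%:R + alpha) / (n`!%:R * Gamma alpha) * t ^+ (n + k))%:E)%E.

Definition hankel_row mu (alpha : R) f (n : nat) : nat -> C :=
  fun k => (fine (hankel_moment mu alpha n k))%:C * coefs f k.

Definition hankel_coef mu (alpha : R) f (n : nat) : C :=
  limn (series (hankel_row mu alpha f n)).

Definition hankel mu (alpha : R) f : C -> C :=
  fun z => limn (power_series (hankel_coef mu alpha f) z).

Definition hankel_defined mu (alpha : R) f : Prop :=
  [/\ forall n k, hankel_moment mu alpha n k \is a fin_num,
      forall n, cvgn (series (hankel_row mu alpha f n)),
      forall z, disc z -> cvgn (power_series (hankel_coef mu alpha f) z)
    & analytic_on_disc (hankel mu alpha f)].

Definition hankel_maps mu (alpha beta gamma : R) : Prop :=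
  forall f, bloch beta f ->
    hankel_defined mu alpha f /\ bloch gamma (hankel mu alpha f).

Definition hankel_bounded mu (alpha beta gamma : R) : Prop :=
  hankel_maps mu alpha beta gamma /\
  exists M : R, forall f, bloch beta f ->
    (bloch_norm gamma (hankel mu alpha f) <= M%:E * bloch_norm beta f)%E.

(* Compactness of an operator between Banach spaces: the images of a bounded
   sequence have a subsequence converging in the norm of the target. *)
Definition hankel_compact mu (alpha beta gamma : R) : Prop :=
  hankel_maps mu alpha beta gamma /\
  forall (f_ : nat -> C -> C) (M : R),
    (forall n, bloch beta (f_ n) /\ (bloch_norm beta (f_ n) <= M%:E)%E) ->
    exists (phi : nat -> nat) g,
      [/\ increasing_seq phi, bloch gamma g &
          bloch_norm gamma (fun z => hankel mu alpha (f_ (phi n)) z - g z)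
            @[n --> \oo] --> 0%E].

Definition carleson mu (s : R) : Prop :=
  exists2 M : R, 0 < M & forall t : R, 0 <= t < 1 ->
    (mu `[t, 1%R[ <= (M * (1 - t) `^ s)%:E)%E.

Definition vanishing_carleson mu (s : R) : Prop :=
  carleson mu s /\
  (mu `[t, 1%R[ * ((1 - t) `^ s)^-1%:E)%E @[t --> 1^'-] --> 0%E.

End defs.

(* Main.v *)
(* Write c_n = Gamma(n + alpha) / (n! Gamma(alpha)), so that mu_{n,k} = c_n m_{n+k}
   with m_j the moments of mu, and the n-th coefficient of H f is
   c_n int t^n f(t) dmu(t). A Bloch function satisfies |f(t)| <= D (1 - t)^(1-beta),
   and cutting [0,1) dyadically the Carleson condition gives
   int t^n (1 - t)^(1-beta) dmu <= K / ((n+1)(n+2)). Comparing H f with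
   sum_n c_n z^n = (1 - z)^(-alpha) bounds its (alpha-1)-Bloch norm.

   Conversely, test on f_a = (1 - a^2) (1 - a z)^(-beta): all coefficients of H f_a
   are nonnegative and (H f_a)'(a) is at least a constant times
   mu([a,1)) (1 - a^2)^(-beta-alpha).

   If mu is vanishing Carleson and f_n is bounded, extract a coefficientwise limit
   f along an ultrafilter; f_n - f is small on [0,t0], where mu is only Carleson,
   while the constant of mu is small on [t0,1). If H is compact, a limit point of
   H f_a as a -> 1 has zero derivative, since f_a -> 0 coefficientwise; so the lower
   bound on (H f_a)'(a) makes mu vanishing Carleson.

   The Cauchy estimates and the convergence of Taylor series on the whole disc come
   from a maximum principle, which needs no integration. *)
Require Import Defs.
From HB Require Import structures.
From mathcomp Require Import all_boot all_order all_algebra.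
From mathcomp Require Import all_classical all_reals all_analysis.
From mathcomp Require Import measurable_realfun complex.
From mathcomp Require Import zify ring lra.
From mathcomp Require cyclic separable cyclotomic.

Set Implicit Arguments.
Unset Strict Implicit.
Unset Printing Implicit Defensive.

Import Order.TTheory GRing.Theory Num.Theory.
Import numFieldNormedType.Exports.

Local Open Scope ring_scope.
Local Open Scope classical_set_scope.
Local Open Scope complex_scope.

(** * Complex modulus and power series *)

Section complex_modulus.
Context {R : realType}.
Local Notation C := (cplx R).
Implicit Types (z w : C) (x y : R).

(** The definitions force two detours. Analyticity is given by local expansions, whereas the
    operator acts on the Taylor coefficients at 0, so a function must be shown to be the sum of a
    single series on the whole disc. And a coefficient of H f is a sum over k of moments, whereas
    its decay is visible only on the integral of t^n f(t). The exchange rests on sum_k |a_k| m_k <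
    oo: Cauchy's estimate bounds sum_k |a_k| t^k by a multiple of (1 - t)^(-beta), one power worse
    than f(t), which a (beta + 1)-Carleson measure still integrates.

    The exponents fit as follows. The weight (1 - t)^(1-beta) against a (beta + 1)-Carleson measure
    behaves like (1 - t) dt, and int_0^1 t^n (1 - t) dt = 1/((n+1)(n+2)). Two powers of n are gained
    and differentiation loses one, so the coefficients of (H f)' are at most of size n^(alpha-2),
    like those of (1 - z)^(1-alpha), which is exactly the growth that the (alpha-1)-Bloch norm
    measures. *)

Lemma normC_cabs z : `|z| = (cabs z)%:C.
Proof. by []. Qed.

Lemma cabs_ge0 z : 0 <= cabs z.
Proof. by rewrite -ler0c -normC_cabs normr_ge0. Qed.

Lemma cabs0 : cabs (0 : C) = 0.
Proof. exact: ComplexField.Normc.normc0. Qed.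

Lemma cabs0_eq0 z : cabs z = 0 -> z = 0.
Proof. exact: ComplexField.Normc.eq0_normc. Qed.

Lemma cabs_gt0 z : z != 0 -> 0 < cabs z.
Proof.
move=> z0; rewrite lt_neqAle cabs_ge0 andbT eq_sym.
by apply: contra z0 => /eqP/cabs0_eq0 ->.
Qed.

Lemma cabsM z w : cabs (z * w) = cabs z * cabs w.
Proof. exact: ComplexField.Normc.normcM. Qed.

Lemma cabsV z : cabs z^-1 = (cabs z)^-1.
Proof. exact: ComplexField.Normc.normcV. Qed.

Lemma cabsN z : cabs (- z) = cabs z.
Proof. exact: normcN. Qed.

Lemma ler_cabsD z w : cabs (z + w) <= cabs z + cabs w.
Proof. exact: le_normcD. Qed.

Lemma cabs_distC z w : cabs (z - w) = cabs (w - z).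
Proof. by rewrite -cabsN opprB. Qed.

Lemma ler_cabsB z w : cabs (z - w) <= cabs z + cabs w.
Proof. by rewrite -(cabsN w) ler_cabsD. Qed.

Lemma ler_cabs_dist z w : cabs z - cabs w <= cabs (z - w).
Proof. by rewrite lerBlDr -{1}(subrK w z) ler_cabsD. Qed.

Lemma cabsR x : cabs (x%:C : C) = `|x|.
Proof. by rewrite /cabs /= expr0n /= addr0 sqrtr_sqr. Qed.

Lemma cabs1 : cabs (1 : C) = 1.
Proof. exact: ComplexField.Normc.normc1. Qed.

Lemma cabsX z n : cabs (z ^+ n) = cabs z ^+ n.
Proof. by elim: n => [|n IH]; rewrite ?expr0 ?cabs1// !exprS cabsM IH. Qed.

Lemma real_complexR n : ((n%:R : R)%:C : C) = n%:R.
Proof. exact: (rmorph_nat (real_complex R) n). Qed.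

Lemma real_complexM x y : (x * y)%:C = x%:C * y%:C :> C.
Proof. exact: (rmorphM (real_complex R)). Qed.

Lemma real_complexX x n : (x ^+ n)%:C = x%:C ^+ n :> C.
Proof. exact: (rmorphXn (real_complex R)). Qed.

Lemma Re_realM x z : complex.Re (x%:C * z) = x * complex.Re z.
Proof. by case: z => a b /=; rewrite mul0r subr0. Qed.

Lemma cabs_nat n : cabs (n%:R : C) = n%:R.
Proof. by rewrite -real_complexR cabsR ger0_norm// ler0n. Qed.

Lemma ler_cabs_sum (I : Type) (r : seq I) (P : pred I) (F : I -> C) :
  cabs (\sum_(i <- r | P i) F i) <= \sum_(i <- r | P i) cabs (F i).
Proof.
elim/big_ind2 : _ => [|x1 x2 y1 y2 h1 h2|//]; first by rewrite cabs0.
exact: le_trans (ler_cabsD _ _) (lerD h1 h2).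
Qed.

Lemma ler_Re_cabs z : `|complex.Re z| <= cabs z.
Proof.
case: z => a b; rewrite /cabs /= -sqrtr_sqr ler_wsqrtr//.
by rewrite lerDl sqr_ge0.
Qed.

Lemma ler_Im_cabs z : `|complex.Im z| <= cabs z.
Proof.
case: z => a b; rewrite /cabs /= -sqrtr_sqr ler_wsqrtr//.
by rewrite lerDr sqr_ge0.
Qed.

Lemma ler_cabs_ReIm z : cabs z <= `|complex.Re z| + `|complex.Im z|.
Proof.
have {1}-> : z = (complex.Re z)%:C + 'i * (complex.Im z)%:C by exact: complexE.
apply: le_trans (ler_cabsD _ _) _.
rewrite cabsM !cabsR.
by rewrite /cabs /= expr0n expr1n add0r sqrtr1 mul1r.
Qed.

Lemma sqr_cabs z : cabs z ^+ 2 = complex.Re z ^+ 2 + complex.Im z ^+ 2.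
Proof.
by case: z => a b; rewrite /cabs /= sqr_sqrtr// addr_ge0// sqr_ge0.
Qed.

(** Turns a modulus into a real part, so that growth along a ray and sums of moments can be
    estimated by real-variable means. *)
Lemma cabs_Re_phase z : exists2 w, cabs w = 1 & complex.Re (w * z) = cabs z.
Proof.
have [->|z0] := eqVneq z 0; first by exists 1; rewrite ?cabs1 ?mulr0 ?cabs0.
have c0 := cabs_gt0 z0.
exists ((cabs z)^-1%:C * z^*).
  rewrite cabsM cabsR ger0_norm ?invr_ge0 ?cabs_ge0//.
  have -> : cabs (z^* : C) = cabs z.
    by case: (z) => a b; rewrite /cabs /= sqrrN.
  by rewrite mulVf// gt_eqF.
have -> : (cabs z)^-1%:C * z^* * z = (cabs z)%:C :> C.
  have e : z^* * z = (cabs z ^+ 2)%:C :> C.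
    case: (z) => a b; rewrite sqr_cabs /=; apply/eqP.
    by rewrite eq_complex /=; apply/andP; split; apply/eqP; ring.
  rewrite -mulrA e -(rmorphM (real_complex R)) /= expr2 mulrA mulVf ?gt_eqF//.
  by rewrite mul1r.
by [].
Qed.

(** A ball of [C] has its radius in [C], where positivity forces a zero imaginary part; here that
    radius becomes a real number. *)
Lemma nbhs_cabsP (P : C -> Prop) z0 :
  (\forall z \near z0, P z) <->
  exists2 d : R, 0 < d & forall z, cabs (z - z0) < d -> P z.
Proof.
split=> [/nbhs_ballP[e /= e0 he]|[d d0 hd]].
  exists (complex.Re e); first by move: e0; rewrite ltcE => /andP[].
  move=> z zd; apply: he; rewrite /ball /= distrC normC_cabs.
  move: e0; rewrite ltcE /= => /andP[/eqP i0 _].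
  by rewrite ltcE /= i0 eqxx.
apply/nbhs_ballP; exists (d%:C); first by rewrite /= ltcR.
move=> z; rewrite /ball /= distrC normC_cabs ltcR; exact: hd.
Qed.

Lemma cvg_cabsP (u : nat -> C) (l : C) :
  (u @ \oo --> l) <-> (cabs (u n - l) @[n --> \oo] --> (0 : R)).
Proof.
split=> [ul|ul].
  apply/cvgrPdist_lt => e e0.
  have ne : nbhs l [set z | cabs (z - l) < e] by apply/nbhs_cabsP; exists e.
  have [N _ hN] := ul _ ne; exists N => // n /hN /=.
  by rewrite sub0r normrN ger0_norm ?cabs_ge0.
move=> A /nbhs_cabsP[d d0 hd].
move/cvgrPdist_lt : ul => /(_ _ d0)[N _ hN]; exists N => // n /hN /=.
by rewrite sub0r normrN ger0_norm ?cabs_ge0// => /hd.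
Qed.

End complex_modulus.

Section power_series.
Context {R : realType}.
Local Notation C := (cplx R).
Implicit Types (z w u l : C) (x y r d : R) (a : nat -> C).

Lemma cabs_cvg_le (u : nat -> C) (l : C) (M : R) :
  u @ \oo --> l -> (\forall n \near \oo, cabs (u n) <= M) -> cabs l <= M.
Proof.
move=> /cvg_cabsP ul uM; apply/ler_addgt0Pr => e e0.
move/cvgrPdist_lt : ul => /(_ _ e0) ule.
near \oo => n.
rewrite -(subrK (u n) l) addrC (le_trans (ler_cabsD _ _))// lerD//.
  by near: n.
rewrite cabs_distC ltW// -[ltLHS]ger0_norm ?cabs_ge0// -normrN -sub0r.
by near: n.
Unshelve. all: by end_near. Qed.

Lemma cvgC_lim (u : nat -> C) (l : C) : u @ \oo --> l -> limn u = l.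
Proof. by move=> ul; apply: (cvg_lim (@norm_hausdorff _ C)). Qed.

Lemma cvgC_sum (I : Type) (s : seq I) (F : I -> nat -> C) (l : I -> C) :
  (forall i, F i @ \oo --> l i) ->
  (fun n => \sum_(i <- s) F i n) @ \oo --> \sum_(i <- s) l i.
Proof.
move=> Fl; elim: s => [|i s IH].
  rewrite big_nil (_ : (fun n => _) = fun=> 0); first exact: cvg_cst.
  by apply/funext => n; rewrite big_nil.
rewrite big_cons (_ : (fun n => _) = F i \+ fun n => \sum_(i <- s) F i n).
  exact: cvgD (Fl i) IH.
by apply/funext => n; rewrite big_cons.
Qed.

Lemma Re_sum (I : Type) (s : seq I) (P : pred I) (F : I -> C) :
  complex.Re (\sum_(i <- s | P i) F i) = \sum_(i <- s | P i) complex.Re (F i).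
Proof. by apply: (big_morph (@complex.Re R)) => [[? ?] [? ?]|]. Qed.

Lemma Im_sum (I : Type) (s : seq I) (P : pred I) (F : I -> C) :
  complex.Im (\sum_(i <- s | P i) F i) = \sum_(i <- s | P i) complex.Im (F i).
Proof. by apply: (big_morph (@complex.Im R)) => [[? ?] [? ?]|]. Qed.

Lemma cvg_ReIm (u : nat -> C) x y :
  complex.Re (u n) @[n --> \oo] --> x -> complex.Im (u n) @[n --> \oo] --> y ->
  u @ \oo --> (x +i* y : C).
Proof.
move=> ux uy; apply/cvg_cabsP.
apply: (@squeeze_cvgr _ _ _ _ (fun=> 0)
  (fun n => `|complex.Re (u n) - x| + `|complex.Im (u n) - y|)).
- near=> n; rewrite cabs_ge0 /=.
  by apply: le_trans (ler_cabs_ReIm _) _; case: (u n).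
- exact: cvg_cst.
- have aux (v : nat -> R) t : v @ \oo --> t -> `|v n - t| @[n --> \oo] --> 0.
    move=> /cvgrPdist_lt vt; apply/cvgrPdist_lt => e /vt; apply: filterS => n.
    by rewrite sub0r normrN normr_id distrC.
  rewrite -[X in _ --> X](addr0 (0 : R)).
  by apply: cvgD; exact: aux.
Unshelve. all: by end_near. Qed.

Lemma cvg_ReP (u : nat -> C) (l : C) :
  u @ \oo --> l -> complex.Re (u n) @[n --> \oo] --> complex.Re l.
Proof.
move=> /cvg_cabsP ul; apply/cvgrPdist_lt => e e0.
move/cvgrPdist_lt : ul => /(_ _ e0)[N _ hN]; exists N => // n /hN /=.
rewrite sub0r normrN ger0_norm ?cabs_ge0//; apply: le_lt_trans.
rewrite distrC; apply: le_trans (ler_Re_cabs _).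
by case: (u n) => ? ?; case: (l).
Qed.

(** Absolute convergence is used for the real and the imaginary parts separately, each being
    dominated by [m]. *)
Lemma series_dominated (w : nat -> C) (m : nat -> R) :
  (forall n, cabs (w n) <= m n) -> cvgn (series m) ->
  exists2 l : C, series w @ \oo --> l & cabs l <= limn (series m).
Proof.
move=> wm cm.
have m0 n : 0 <= m n by exact: le_trans (cabs_ge0 _) (wm n).
have part (p : C -> R) : (forall z, `|p z| <= cabs z) ->
    cvgn (series (fun n => p (w n))).
  move=> pz; apply: normed_cvg; apply: series_le_cvg cm => n //=.
  exact: le_trans (pz _) (wm _).
have [/part cRe /part cIm] := (@ler_Re_cabs R, @ler_Im_cabs R).
exists (limn (series (fun n => complex.Re (w n))) +i*
        limn (series (fun n => complex.Im (w n)))).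
  apply: cvg_ReIm.
    rewrite (_ : (fun n => _) = series (fun n => complex.Re (w n)))//.
    by apply/funext => n; rewrite /series /= Re_sum.
  rewrite (_ : (fun n => _) = series (fun n => complex.Im (w n)))//.
  by apply/funext => n; rewrite /series /= Im_sum.
apply: (@cabs_cvg_le (series w)).
  apply: cvg_ReIm.
    rewrite (_ : (fun n => _) = series (fun n => complex.Re (w n)))//.
    by apply/funext => n; rewrite /series /= Re_sum.
  rewrite (_ : (fun n => _) = series (fun n => complex.Im (w n)))//.
  by apply/funext => n; rewrite /series /= Im_sum.
near=> n; apply: le_trans (ler_cabs_sum _ _ _) _.
apply: (@le_trans _ _ (series m n)); first by apply: ler_sum.
apply: nondecreasing_cvgn_le => //; apply/nondecreasing_seqP => k.
by rewrite /series /= big_nat_recr //= lerDl.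
Unshelve. all: by end_near. Qed.

Definition majorant a r : nat -> R := series (fun n => cabs (a n) * r ^+ n).

Definition PS a z : C := limn (power_series a z).

Lemma PS_dominated a z r : cabs z <= r -> cvgn (majorant a r) ->
  power_series a z @ \oo --> PS a z /\ cabs (PS a z) <= limn (majorant a r).
Proof.
move=> zr cm.
have [|l wl lm] := @series_dominated (fun k => a k * z ^+ k)
    (fun n => cabs (a n) * r ^+ n) _ cm.
  move=> n; rewrite cabsM cabsX ler_wpM2l ?cabs_ge0//.
  by rewrite lerXn2r ?nnegrE ?cabs_ge0// (le_trans (cabs_ge0 z)).
by rewrite /PS (cvgC_lim wl).
Qed.

Lemma bounded_terms a z : cvgn (power_series a z) ->
  exists B, forall n, cabs (a n) * cabs z ^+ n <= B.
Proof.
move=> /cvg_series_cvg_0/cvg_cabsP.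
rewrite (_ : (fun n => _) = (fun n => cabs (a n) * cabs z ^+ n)); last first.
  by apply/funext => n; rewrite subr0 cabsM cabsX.
move=> /cvgP/cvg_seq_bounded[M [_ /(_ (M + 1))]].
rewrite ltrDl ltr01 => /(_ isT) hM; exists (M + 1) => n.
by apply: le_trans (ler_norm _) _; exact: hM.
Qed.

(** Abel's lemma: terms bounded at radius s are dominated at radius r by a geometric sequence of
    ratio r/s. *)
Lemma cvgn_majorant a r s B : 0 <= r -> r < s ->
  (forall n, cabs (a n) * s ^+ n <= B) -> cvgn (majorant a r).
Proof.
move=> r0 rs aB; have s0 := le_lt_trans r0 rs.
apply: (@series_le_cvg _ _ (fun n => B * (r / s) ^+ n)) => [n|n|n|].
- by rewrite mulr_ge0 ?cabs_ge0 ?exprn_ge0.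
- rewrite mulr_ge0 ?exprn_ge0 ?divr_ge0 ?(ltW s0)//.
  by apply: le_trans (aB 0%N); rewrite mulr_ge0 ?cabs_ge0.
- rewrite expr_div_n mulrA ler_pdivlMr ?exprn_gt0//.
  by rewrite mulrAC ler_wpM2r ?exprn_ge0.
- rewrite (_ : (fun n => _) = geometric B (r / s))//.
  apply: is_cvg_geometric_series.
  by rewrite ger0_norm ?divr_ge0 ?(ltW s0)// ltr_pdivrMr// mul1r.
Qed.

(** For k >= K one has |u|^k <= (|u|/d)^K d^k, so the tail is at most (|u|/d)^K times the full
    expansion of (|z| + d)^n. The first factor does not depend on n, which lets the bound be summed
    against the coefficients of a power series. *)
Lemma binomial_tail n K z u d : cabs u <= d -> 0 < d ->
  cabs ((z + u) ^+ n - \sum_(k < K) (z ^+ (n - k) *+ 'C(n, k)) * u ^+ k)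
  <= (cabs u / d) ^+ K * (cabs z + d) ^+ n.
Proof.
move=> ud d0.
pose T k := (z ^+ (n - k) *+ 'C(n, k)) * u ^+ k.
pose T' k := (cabs z ^+ (n - k) * d ^+ k) *+ 'C(n, k).
have T0 k : (n < k)%N -> T k = 0.
  by move=> nk; rewrite /T bin_small// mulr0n mul0r.
have T'0 k : 0 <= T' k.
  by rewrite mulrn_wge0// mulr_ge0// exprn_ge0 ?cabs_ge0// (ltW d0).
(* The range is extended to n + 1 + K, where the binomial coefficients vanish, so that it can be cut
   at K whether or not K <= n. *)
have -> : (z + u) ^+ n = \sum_(0 <= k < n.+1 + K) T k.
  rewrite (big_cat_nat _ (leq_addr K n.+1))//=.
  rewrite [X in _ = _ + X]big_nat_cond [X in _ = _ + X]big1 ?addr0; last first.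
    by move=> k; rewrite andbT => /andP[/T0].
  rewrite big_mkord exprDn; apply: eq_bigr => k _.
  by rewrite /T mulrnAl.
have -> : (cabs z + d) ^+ n = \sum_(0 <= k < n.+1 + K) T' k.
  rewrite (big_cat_nat _ (leq_addr K n.+1))//=.
  rewrite [X in _ = _ + X]big_nat_cond [X in _ = _ + X]big1 ?addr0; last first.
    by move=> k; rewrite andbT => /andP[nk _]; rewrite /T' bin_small.
  by rewrite big_mkord exprDn.
rewrite -(big_mkord xpredT T) (big_cat_nat (leq0n K) (leq_addl n.+1 K))//=.
rewrite addrAC subrr add0r mulr_sumr.
rewrite [leRHS](big_cat_nat (leq0n K) (leq_addl n.+1 K)) /=.
apply: le_trans (ler_cabs_sum _ _ _) _.
apply: (@le_trans _ _ (\sum_(K <= i < n.+1 + K) (cabs u / d) ^+ K * T' i)); last first.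
  rewrite lerDr sumr_ge0// => i _; rewrite mulr_ge0// exprn_ge0// divr_ge0 ?(ltW d0)//.
  exact: cabs_ge0.
apply: ler_sum_nat => k /andP[Kk _].
rewrite /T /T' cabsM cabsX -mulr_natr cabsM cabs_nat cabsX.
rewrite -mulr_natr.
rewrite [leRHS](_ : _ = (cabs z ^+ (n - k) * 'C(n, k)%:R) *
   ((cabs u / d) ^+ K * d ^+ k)); last by ring.
rewrite mul1r ler_wpM2l ?mulr_ge0 ?exprn_ge0 ?cabs_ge0//.
rewrite -(subnK Kk) addnC !exprD mulrA -exprMn divfK ?gt_eqF//.
rewrite ler_wpM2l ?exprn_ge0 ?cabs_ge0//.
by rewrite lerXn2r ?nnegrE ?cabs_ge0 ?(ltW d0).
Qed.

(** The k-th Taylor coefficient at z of the sum of the series. For n < k the truncated difference n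
    - k is harmless, since the binomial coefficient is 0. *)
Definition recentered_coef a z k : C :=
  limn (series (fun n => a n * (z ^+ (n - k) *+ 'C(n, k)))).

Lemma cvg_recentered_coef a z d k : 0 < d -> cvgn (majorant a (cabs z + d)) ->
  series (fun n => a n * (z ^+ (n - k) *+ 'C(n, k))) @ \oo -->
    recentered_coef a z k.
Proof.
move=> d0 cm.
have [||l wl _] := @series_dominated
    (fun n => a n * (z ^+ (n - k) *+ 'C(n, k)))
    (fun n => (d ^+ k)^-1 * (cabs (a n) * (cabs z + d) ^+ n)).
- move=> n; rewrite mulrCA cabsM ler_wpM2l ?cabs_ge0//.
  rewrite mulrC ler_pdivlMr ?exprn_gt0//.
  rewrite -mulr_natr cabsM cabs_nat cabsX.
  have [kn|nk] := leqP k n; last first.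
    by rewrite bin_small// mulr0 mul0r exprn_ge0// addr_ge0 ?cabs_ge0 ?(ltW d0).
  rewrite exprDn (bigD1 (Ordinal (_ : (k < n.+1)%N)))//=.
  rewrite mulrAC mulr_natr lerDl sumr_ge0// => i _.
  by rewrite mulrn_wge0// mulr_ge0// exprn_ge0 ?cabs_ge0// (ltW d0).
- rewrite (_ : series _ = (d ^+ k)^-1 \*: majorant a (cabs z + d)).
    exact: is_cvgZr.
  by apply/funext => n; rewrite /majorant /series /= -mulr_sumr.
by rewrite /recentered_coef (cvgC_lim wl).
Qed.

(** One remainder estimate with several uses: K tending to infinity gives analyticity, K = 2 the
    derivative, and z = 0 the expansions to finite order behind the jets. *)
Lemma PS_recenter a z d u K : 0 < d -> cabs u <= d ->
  cvgn (majorant a (cabs z + d)) ->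
  cabs (PS a (z + u) - \sum_(k < K) recentered_coef a z k * u ^+ k)
  <= (cabs u / d) ^+ K * limn (majorant a (cabs z + d)).
Proof.
move=> d0 ud cm.
have zu : cabs (z + u) <= cabs z + d.
  by rewrite (le_trans (ler_cabsD _ _))// lerD2l.
have [cP _] := PS_dominated zu cm.
have cS : (fun N => \sum_(k < K)
    series (fun n => a n * (z ^+ (n - k) *+ 'C(n, k))) N * u ^+ k) @ \oo -->
    \sum_(k < K) recentered_coef a z k * u ^+ k.
  apply: (@cvgC_sum _ _ (fun (k : 'I_K) N =>
    series (fun n => a n * (z ^+ (n - k) *+ 'C(n, k))) N * u ^+ k)) => k.
  by apply: cvgMl; exact: cvg_recentered_coef d0 cm.
apply: (cabs_cvg_le (cvgB cP cS)); near=> N.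
rewrite [X in cabs X](_ : _ = \sum_(0 <= n < N) a n *
    ((z + u) ^+ n - \sum_(k < K) (z ^+ (n - k) *+ 'C(n, k)) * u ^+ k)); last first.
  under [RHS]eq_bigr do rewrite mulrBr mulr_sumr.
  rewrite sumrB; congr (_ - _); rewrite exchange_big /=.
  apply: eq_bigr => k _; rewrite /series /= mulr_suml.
  by apply: eq_bigr => n _; rewrite mulrA.
apply: le_trans (ler_cabs_sum _ _ _) _.
apply: (@le_trans _ _ ((cabs u / d) ^+ K * majorant a (cabs z + d) N)).
  rewrite /majorant /series /= mulr_sumr; apply: ler_sum => n _.
  rewrite cabsM mulrCA ler_wpM2l ?cabs_ge0//.
  exact: binomial_tail.
rewrite ler_wpM2l ?exprn_ge0 ?divr_ge0 ?cabs_ge0 ?(ltW d0)//.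
apply: nondecreasing_cvgn_le => //; apply/nondecreasing_seqP => k.
rewrite /majorant /series /= big_nat_recr //= lerDl mulr_ge0 ?cabs_ge0//.
by rewrite exprn_ge0// addr_ge0 ?cabs_ge0// (ltW d0).
Unshelve. all: by end_near. Qed.

End power_series.

(** * Maximum principle and Cauchy estimates *)

Section jets.
Context {R : realType}.
Local Notation C := (cplx R).
Implicit Types (z w u : C) (x y r d : R) (a : nat -> C) (f h k : C -> C).

(* The regularity that the maximum principle uses; unlike analyticity, its closure
   under products and inverses is elementary. *)
Definition jet2 h z := exists c0 c1 c2 (g : C -> C) (d L : R),
  [/\ 0 < d, forall u, cabs u < d -> cabs (g u) <= L &
    forall u, cabs u < d ->
      h (z + u) = c0 + c1 * u + c2 * u ^+ 2 + u ^+ 3 * g u].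

Lemma jet2_near h k z d : 0 < d ->
  (forall u, cabs u < d -> h (z + u) = k (z + u)) -> jet2 k z -> jet2 h z.
Proof.
move=> d0 hk [c0 [c1 [c2 [g [e [L [e0 gL kE]]]]]]].
exists c0, c1, c2, g, (Num.min d e), L; split.
- by rewrite lt_min d0.
- by move=> u; rewrite lt_min => /andP[_ /gL].
- by move=> u; rewrite lt_min => /andP[ud ue]; rewrite hk// kE.
Qed.

Lemma jet2_cst (c : C) z : jet2 (fun=> c) z.
Proof.
exists c, 0, 0, (fun=> 0), 1, 0; split=> // u _; first by rewrite cabs0.
by rewrite mul0r mulr0 !addr0 mul0r addr0.
Qed.

Lemma jet2_id z : jet2 id z.
Proof.
exists z, 1, 0, (fun=> 0), 1, 0; split=> // u _; first by rewrite cabs0.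
by rewrite mul1r mulr0 !addr0 mul0r addr0.
Qed.

Lemma jet2D h k z : jet2 h z -> jet2 k z -> jet2 (fun w => h w + k w) z.
Proof.
move=> [c0 [c1 [c2 [g [e [L [e0 gL kE]]]]]]].
move=> [c0' [c1' [c2' [g' [e' [L' [e0' gL' kE']]]]]]].
exists (c0 + c0'), (c1 + c1'), (c2 + c2'), (fun u => g u + g' u), (Num.min e e'),
  (L + L'); split.
- by rewrite lt_min e0.
- move=> u; rewrite lt_min => /andP[/gL ? /gL' ?].
  by apply: le_trans (ler_cabsD _ _) _; rewrite lerD.
- by move=> u; rewrite lt_min => /andP[ud ue]; rewrite kE// kE'//; ring.
Qed.

Lemma jet2M h k z : jet2 h z -> jet2 k z -> jet2 (fun w => h w * k w) z.
Proof.
move=> [c0 [c1 [c2 [g [e [L [e0 gL kE]]]]]]].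
move=> [c0' [c1' [c2' [g' [e' [L' [e0' gL' kE']]]]]]].
(* The remainder is what is left of the product after the terms of degree at most 2, divided by u^3.
   The radius is cut at 1 so that every power of u in it is at most 1 in modulus. *)
exists (c0 * c0'), (c0 * c1' + c1 * c0'), (c0 * c2' + c1 * c1' + c2 * c0'),
  (fun u => (c1 * c2' + c2 * c1') + c2 * c2' * u +
    g u * (c0' + c1' * u + c2' * u ^+ 2) + g' u * (c0 + c1 * u + c2 * u ^+ 2)
    + u ^+ 3 * (g u * g' u)), (Num.min 1 (Num.min e e')),
  (cabs (c1 * c2' + c2 * c1') + cabs (c2 * c2') +
   L * (cabs c0' + cabs c1' + cabs c2') + L' * (cabs c0 + cabs c1 + cabs c2)
   + L * L').
split.
- by rewrite !lt_min ltr01 e0.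
- move=> u; rewrite !lt_min => /andP[u1 /andP[/gL gl /gL' gl']].
  have L0 : 0 <= L by exact: le_trans (cabs_ge0 _) gl.
  have L'0 : 0 <= L' by exact: le_trans (cabs_ge0 _) gl'.
  have un n : cabs (u ^+ n) <= 1.
    by rewrite cabsX exprn_ile1// ?cabs_ge0// ltW.
  have aux (x c : C) : cabs c <= 1 -> cabs (x * c) <= cabs x.
    by move=> c1'1; rewrite cabsM ler_piMr// cabs_ge0.
  have poly (x1 x2 x3 : C) : cabs (x1 + x2 * u + x3 * u ^+ 2) <=
      cabs x1 + cabs x2 + cabs x3.
    apply: le_trans (ler_cabsD _ _) _; apply: lerD.
      apply: le_trans (ler_cabsD _ _) _; rewrite lerD2l.
      by apply: aux; rewrite ltW.
    by rewrite aux.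
  apply: le_trans (ler_cabsD _ _) _; apply: lerD; last first.
    rewrite mulrC; apply: le_trans (aux _ _ (un 3)) _.
    by rewrite cabsM ler_pM ?cabs_ge0.
  apply: le_trans (ler_cabsD _ _) _; apply: lerD; last first.
    by rewrite cabsM ler_pM ?cabs_ge0.
  apply: le_trans (ler_cabsD _ _) _; apply: lerD; last first.
    by rewrite cabsM ler_pM ?cabs_ge0.
  apply: le_trans (ler_cabsD _ _) _; rewrite lerD2l.
  by apply: aux; rewrite ltW.
- by move=> u; rewrite !lt_min => /andP[_ /andP[ud ue]]; rewrite kE// kE'//; ring.
Qed.

Lemma jet2V z : z != 0 -> jet2 (fun w => w^-1) z.
Proof.
move=> z0; have cz := cabs_gt0 z0.
(* Three terms of the geometric series of 1/(z + u) with the exact remainder; |u| < |z|/2 keeps |z +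
   u| >= |z|/2. *)
exists z^-1, (- z ^- 2), (z ^- 3), (fun u => - (z ^- 3 * (z + u)^-1)), (cabs z / 2),
  ((cabs z ^+ 3)^-1 * (cabs z / 2)^-1).
have zu u : cabs u < cabs z / 2 -> cabs z / 2 <= cabs (z + u).
  move=> uz; have := ler_cabs_dist z (- u); rewrite opprK cabsN.
  by apply: le_trans; lra.
split; first by rewrite divr_gt0.
- move=> u /zu h; rewrite cabsN cabsM !cabsV cabsX ler_wpM2l//.
    by rewrite invr_ge0 exprn_ge0// cabs_ge0.
  by rewrite lef_pV2// posrE ?divr_gt0// (lt_le_trans _ h)// divr_gt0.
- move=> u /zu h; have zu0 : z + u != 0.
    apply/eqP => zu0; move: h; rewrite zu0 cabs0 leNgt divr_gt0//.
  by field; rewrite z0 zu0.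
Qed.

Lemma jet2X h z n : jet2 h z -> jet2 (fun w => h w ^+ n) z.
Proof.
move=> hz; elim: n => [|n IH].
  rewrite (_ : (fun _ => _) = fun=> 1); first exact: jet2_cst.
  by apply/funext => w; rewrite expr0.
rewrite (_ : (fun _ => _) = fun w => h w * h w ^+ n); first exact: jet2M.
by apply/funext => w; rewrite exprS.
Qed.

Lemma jet2_sum (I : Type) (s : seq I) (h : I -> C -> C) z :
  (forall i, jet2 (h i) z) -> jet2 (fun w => \sum_(i <- s) h i w) z.
Proof.
move=> hz; elim: s => [|i s IH].
  rewrite (_ : (fun _ => _) = fun=> 0); first exact: jet2_cst.
  by apply/funext => w; rewrite big_nil.
rewrite (_ : (fun _ => _) = fun w => h i w + \sum_(i <- s) h i w).
  exact: jet2D.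
by apply/funext => w; rewrite big_cons.
Qed.

Lemma jet2_rot h w z : cabs w = 1 -> jet2 h (w * z) -> jet2 (fun u => h (w * u)) z.
Proof.
move=> w1 [c0 [c1 [c2 [g [e [L [e0 gL kE]]]]]]].
exists c0, (c1 * w), (c2 * w ^+ 2), (fun u => w ^+ 3 * g (w * u)), e, L; split=> //.
  by move=> u ue; rewrite cabsM cabsX w1 expr1n mul1r gL// cabsM w1 mul1r.
by move=> u ue; rewrite mulrDr kE ?cabsM ?w1 ?mul1r//; ring.
Qed.

Lemma jet2_continuous h z : jet2 h z -> h w @[w --> z] --> h z.
Proof.
move=> [c0 [c1 [c2 [g [e [L [e0 gL kE]]]]]]].
have -> : h z = c0.
  have := kE 0; rewrite cabs0 => /(_ e0); rewrite addr0 => ->.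
  by rewrite !mulr0 !expr0n /= mulr0 mul0r !addr0.
have L0 : 0 <= L by apply: le_trans (cabs_ge0 _) (gL 0 _); rewrite cabs0.
move=> A /nbhs_cabsP[d d0 dA].
apply/nbhs_cabsP.
pose B := cabs c1 + cabs c2 + L.
have B0 : 0 <= B by rewrite !addr_ge0 ?cabs_ge0.
exists (Num.min 1 (Num.min e (d / (B + 1)))).
  by rewrite !lt_min ltr01 e0 divr_gt0// ltr_wpDl.
move=> w; rewrite !lt_min => /andP[w1 /andP[we wd]]; apply: dA.
have := kE _ we; rewrite subrKC => ->.
rewrite [X in cabs X]addrC !addrA addNr add0r.
move: (w - z) w1 we wd => u u1 ue ud.
apply: (@le_lt_trans _ _ (B * cabs u)); last first.
  rewrite ltr_pdivlMr in ud; last by rewrite ltr_wpDl.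
  apply: le_lt_trans ud; rewrite mulrC ler_wpM2l ?cabs_ge0// lerDl//.
rewrite !mulrDl.
have u2 : cabs u ^+ 2 <= cabs u by rewrite ler_iXnr// ?cabs_ge0// ltW.
have u3 : cabs u ^+ 3 <= cabs u by rewrite ler_iXnr// ?cabs_ge0// ltW.
apply: le_trans (ler_cabsD _ _) _; apply: lerD; last first.
  by rewrite cabsM cabsX mulrC ler_pM ?cabs_ge0 ?exprn_ge0 ?cabs_ge0// gL.
apply: le_trans (ler_cabsD _ _) _; apply: lerD; first by rewrite cabsM.
by rewrite cabsM cabsX ler_wpM2l// cabs_ge0.
Qed.

Lemma power_series_remainder a h z d K : 0 < d ->
  (forall u, cabs u < d -> power_series a u @ \oo --> h (z + u)) ->
  exists (g : C -> C) e L, [/\ 0 < e, forall u, cabs u < e -> cabs (g u) <= L &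
    forall u, cabs u < e ->
      h (z + u) = \sum_(k < K) a k * u ^+ k + u ^+ K * g u].
Proof.
move=> d0 ah.
(* Two nested radii: the terms are bounded at r, hence the majorant converges at s < r. *)
pose r := d / 2; have r0 : 0 < r by rewrite divr_gt0.
have rd : cabs (r%:C : C) < d.
  by rewrite cabsR gtr0_norm// /r; lra.
have [B aB] : exists B, forall n, cabs (a n) * cabs (r%:C : C) ^+ n <= B.
  by apply: bounded_terms; apply/cvg_ex; eexists; exact: ah rd.
rewrite cabsR gtr0_norm// in aB.
pose s := r / 2; have s0 : 0 < s by rewrite divr_gt0.
have cm : cvgn (majorant a (cabs (0 : C) + s)).
  apply: cvgn_majorant aB; first by rewrite addr_ge0 ?cabs_ge0// ltW.
  by rewrite cabs0 add0r /s; lra.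
have rc (k : nat) : recentered_coef a 0 k = a k.
  rewrite /recentered_coef; apply: cvgC_lim.
  apply: cvg_near_cst; near=> n.
  rewrite /series /= (bigD1_seq k)//= ?iota_uniq//; last first.
    by rewrite mem_index_iota /=; near: n; exact: nbhs_infty_gt.
  rewrite subnn expr0 binn mulr1 big1 ?addr0// => i ik.
  have [ik'|ki] := ltnP i k; first by rewrite bin_small// mulr0n mulr0.
  rewrite expr0n subn_eq0 leqNgt ltn_neqAle eq_sym ik ki /=.
  by rewrite mul0rn mulr0.
pose A := limn (majorant a (cabs (0 : C) + s)).
have A0 : 0 <= A.
  have c0s : cabs (0 : C) <= cabs (0 : C) + s by rewrite lerDl ltW.
  have [_ ] := PS_dominated c0s cm.
  exact: le_trans (cabs_ge0 _).
have main u : cabs u < s ->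
    cabs (h (z + u) - \sum_(k < K) a k * u ^+ k) <= (cabs u / s) ^+ K * A.
  move=> us.
  have := @PS_recenter _ a 0 s u K s0 (ltW us) cm; rewrite add0r.
  have -> : PS a u = h (z + u).
    by apply: cvgC_lim; apply: ah; rewrite /s /r in us; lra.
  by under eq_bigr do rewrite rc.
(* At u = 0 with K > 0 this quotient is 0 by the convention on inverses, and the expansion at that
   point is recovered from [main 0]. *)
exists (fun u => (h (z + u) - \sum_(k < K) a k * u ^+ k) / u ^+ K), s, (A / s ^+ K).
split=> // u us.
  have [->|u0] := eqVneq u 0.
    case: K main => [|K] main.
      by have := main u us; rewrite !expr0 !invr1 !mulr1 mul1r addr0 big_ord0 subr0;
        have := main 0; rewrite cabs0 s0 addr0 big_ord0 subr0 expr0 mul1r => /(_ isT).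
    by rewrite expr0n invr0 mulr0 cabs0 divr_ge0// exprn_ge0// ltW.
  rewrite cabsM cabsV cabsX ler_pdivrMr ?exprn_gt0 ?cabs_gt0//.
  by apply: le_trans (main u us) _; rewrite expr_div_n mulrC mulrA mulrAC.
have [->|u0] := eqVneq u 0; last first.
  by rewrite mulrCA divff ?expf_neq0// mulr1 subrKC.
case: K main => [|K] main; first by rewrite expr0 invr1 mul1r mulr1 subrKC.
have := main 0; rewrite cabs0 mul0r expr0n /= mul0r => /(_ s0) h0.
apply/eqP; rewrite expr0n /= mul0r addr0 -subr_eq0; apply/eqP/cabs0_eq0/eqP.
by rewrite eq_le cabs_ge0 andbT addr0; rewrite addr0 in h0.
Unshelve. all: by end_near. Qed.

Lemma jet2_power_series a h z d : 0 < d ->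
  (forall u, cabs u < d -> power_series a u @ \oo --> h (z + u)) -> jet2 h z.
Proof.
move=> d0 /(power_series_remainder 3 d0)[g [e [L [e0 gL hE]]]].
exists (a 0%N), (a 1%N), (a 2%N), g, e, L; split=> // u ue.
by rewrite hE// !big_ord_recl big_ord0 /= expr0 mulr1 expr1 addr0 !addrA.
Qed.

End jets.

Section maximum_principle.
Context {R : realType}.
Local Notation C := (cplx R).
Implicit Types (z w u : C) (x y r d : R) (a : nat -> C) (f h : C -> C).

Lemma ler_dist_cabs z w : `|cabs z - cabs w| <= cabs (w - z).
Proof.
rewrite ler_norml; have := ler_cabs_dist w z; have := ler_cabs_dist z w.
by rewrite (cabs_distC z w) => ? ?; apply/andP; split; lra.
Qed.

Lemma cabs_continuous (T : Type) (F : set_system T) {FF : Filter F} (k : T -> C)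
    (z : C) : k w @[w --> F] --> z -> cabs (k w) @[w --> F] --> cabs z.
Proof.
move=> hz; apply/cvgrPdist_lt => e e0.
have : nbhs z [set w | cabs (w - z) < e] by apply/nbhs_cabsP; exists e.
move=> /hz; rewrite /nbhs /=; apply: filterS => w /= we.
exact: le_lt_trans (ler_dist_cabs _ _) we.
Qed.

(** Compactness of the closed disc is obtained inside the square [-r, r]^2 of [R * R], through the
    map (x, y) to x + i y. *)
Lemma EVT_max_disc (v : C -> R) r : 0 <= r ->
  (forall z, cabs z <= r -> v w @[w --> z] --> v z) ->
  exists2 z0, cabs z0 <= r & forall z, cabs z <= r -> v z <= v z0.
Proof.
move=> r0 cv.
pose phi (p : R * R) : C := p.1 +i* p.2.
have cphi : continuous phi.
  move=> p A /nbhs_cabsP[d d0 dA].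
  apply/nbhs_ballP; exists (d / 2); first by rewrite /= divr_gt0.
  move=> q [/= b1 b2]; apply: dA.
  apply: le_lt_trans (ler_cabs_ReIm _) _.
  rewrite /ball /= in b1 b2; rewrite /phi /=.
  by rewrite distrC [X in _ + X]distrC; lra.
pose A := phi @^-1` [set z | cabs z <= r].
have cA : compact A.
  apply: (@subclosed_compact _ _ (`[- r, r] `*` `[- r, r])).
  - apply: (@closed_comp _ _ (cabs \o phi) [set x | x <= r]).
      move=> p _; apply: cabs_continuous; exact: cphi.
    exact: closed_le.
  - by apply: compact_setX; exact: segment_compact.
  - move=> p /= pr; split; rewrite /= in_itv /= -ler_norml.
      by apply: le_trans pr; exact: (ler_Re_cabs (phi p)).
    by apply: le_trans pr; exact: (ler_Im_cabs (phi p)).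
have [||c cA' cmax] := @compact_EVT_max _ _ (v \o phi) A _ cA.
- by exists (0, 0); apply: le_trans r0; rewrite [X in X <= _]cabs0.
- apply: continuous_in_subspaceT => p /set_mem pA.
  apply: continuous_comp; first exact: cphi.
  exact: cv.
- exists (phi c); first exact: set_mem cA'.
  move=> z zr; have e : phi (complex.Re z, complex.Im z) = z by case: (z).
  by have := cmax (complex.Re z, complex.Im z); rewrite /= e; apply; rewrite inE /A;
    rewrite /preimage /=; move: zr; case: (z).
Qed.

Lemma bounded_on_disc h r : 0 <= r -> (forall z, cabs z <= r -> jet2 h z) ->
  exists M, forall z, cabs z <= r -> cabs (h z) <= M.
Proof.
move=> r0 hj.
have [z zr|z0 _ hz0] := @EVT_max_disc (fun w => cabs (h w)) r r0.
  exact: cabs_continuous (jet2_continuous (hj _ zr)).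
by exists (cabs (h z0)).
Qed.

(** This is |z - c|^2 >= 0. The lower bound is affine in z over the reals, so values of a function
    can be averaged before the real part is estimated. *)
Lemma sqr_cabs_ge c z : cabs z ^+ 2 >= 2 * complex.Re (c^* * z) - cabs c ^+ 2.
Proof.
rewrite !sqr_cabs; case: c z => p q [s t] /=.
rewrite -subr_ge0 (_ : _ - _ = (p - s) ^+ 2 + (q - t) ^+ 2); last by ring.
by rewrite addr_ge0 ?sqr_ge0.
Qed.

(* |h|^2 + e |z|^2 has no interior maximum: averaging over z + i^j t kills the
   first three terms of the jet of h, while the average of |z|^2 grows by t^2. *)
Lemma maximum_modulus h r M : 0 <= r -> (forall z, cabs z <= r -> jet2 h z) ->
  (forall z, cabs z = r -> cabs (h z) <= M) ->
  forall z, cabs z <= r -> cabs (h z) <= M.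
Proof.
move=> r0 hj hM z zr.
have M0 : 0 <= M.
  by apply: le_trans (hM r%:C _); rewrite ?cabs_ge0// cabsR ger0_norm.
rewrite -(ler_pXn2r (n := 2))// ?nnegrE ?cabs_ge0//.
apply/ler_addgt0Pr => e' e'0.
(* With this e the perturbation e |z|^2 stays below e' on the whole disc. *)
have [e e0 er] : exists2 e, 0 < e & e * r ^+ 2 <= e'.
  have r21 : 0 < r ^+ 2 + 1 by rewrite ltr_wpDl ?sqr_ge0.
  exists (e' / (r ^+ 2 + 1)); first by rewrite divr_gt0.
  by rewrite mulrAC ler_pdivrMr// ler_wpM2l ?(ltW e'0)// lerDl.
pose v w := cabs (h w) ^+ 2 + e * cabs w ^+ 2.
have [w wr|z0 z0r z0max] := @EVT_max_disc v r r0.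
  have c1 : cabs (h x) @[x --> w] --> cabs (h w).
    exact: cabs_continuous (jet2_continuous (hj _ wr)).
  have c2 : cabs x @[x --> w] --> cabs w.
    exact: (cabs_continuous (@cvg_id _ (nbhs w))).
  exact: (cvgD (cvgM c1 c1) (cvgMr (cvgM c2 c2))).
apply: (@le_trans _ _ (v z)); first by rewrite /v lerDl mulr_ge0 ?sqr_ge0// ltW.
apply: le_trans (z0max _ zr) _.
move: z0r; rewrite le_eqVlt => /predU1P[z0r|z0r].
  rewrite /v z0r lerD// ?lerXn2r ?nnegrE ?cabs_ge0//.
  exact: hM.
exfalso.
have [c0 [c1 [c2 [g [d [L [d0 gL hE]]]]]]] := hj _ (ltW z0r).
have L0 : 0 <= L by apply: le_trans (cabs_ge0 _) (gL 0 _); rewrite cabs0.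
have h0 : h z0 = c0.
  have := hE 0; rewrite cabs0 => /(_ d0); rewrite addr0 => ->.
  by rewrite !mulr0 !expr0n /= mulr0 mul0r !addr0.
(* The three constraints: stay where the jet is valid, stay in the closed disc, and make 2 |c0| L t
   smaller than e. *)
pose t := Num.min (d / 2) (Num.min ((r - cabs z0) / 2) (e / (2 * cabs c0 * L + 1) / 2)).
have K0 : 0 <= 2 * cabs c0 * L by rewrite !mulr_ge0// cabs_ge0.
have t0 : 0 < t.
  rewrite !lt_min; apply/and3P; split; rewrite ?divr_gt0 ?subr_gt0//.
  by rewrite ltr_wpDl.
have td : t < d by rewrite (@le_lt_trans _ _ (d / 2))// ?ge_min ?lexx//; lra.
have tr : cabs z0 + t <= r.
  have : t <= (r - cabs z0) / 2 by rewrite !ge_min lexx orbT.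
  lra.
have te : 2 * cabs c0 * L * t < e.
  have : t <= e / (2 * cabs c0 * L + 1) / 2 by rewrite !ge_min lexx !orbT.
  rewrite -mulrA -invfM ler_pdivlMr ?mulr_gt0// ?ltr_wpDl//.
  have : 0 <= 2 * cabs c0 * L * t by rewrite mulr_ge0 ?(ltW t0).
  lra.
have [I [i2 cI IE]] : exists I : C, [/\ I ^+ 2 = -1, cabs I = 1 & I = 0 +i* 1].
  exists (0 +i* 1); split=> //; first exact: sqr_i.
  by rewrite /cabs /= expr0n expr1n add0r sqrtr1.
pose p k : C := I ^+ k * t%:C.
have p0 : p 0%N = t%:C by rewrite /p expr0 mul1r.
have p1 : p 1%N = I * t%:C by rewrite /p expr1.
have p2 : p 2%N = - t%:C by rewrite /p i2 mulN1r.
have p3 : p 3%N = - (I * t%:C) by rewrite /p exprSr i2 mulN1r mulNr.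
have pt k : cabs (p k) = t.
  rewrite /p cabsM cabsX cabsR gtr0_norm// cI.
  by rewrite expr1n mul1r.
have sum4 (V : nmodType) (F : nat -> V) :
    \sum_(k < 4) F k = F 0%N + (F 1%N + (F 2%N + (F 3%N))).
  by rewrite -(big_mkord xpredT F) /index_iota /= !big_cons big_nil addr0.
have vmax : \sum_(k < 4) v (z0 + p k) <= \sum_(k < 4) v z0.
  apply: ler_sum => k _; apply: z0max; apply: le_trans (ler_cabsD _ _) _.
  by rewrite pt.
have S2 : \sum_(k < 4) cabs (z0 + p k) ^+ 2 = 4 * cabs z0 ^+ 2 + 4 * t ^+ 2.
  rewrite (sum4 _ (fun k => cabs (z0 + p k) ^+ 2)) p0 p1 p2 p3 IE.
  by rewrite !sqr_cabs; case: (z0) => x y /=; ring.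
have S1 : 4 * cabs c0 ^+ 2 - 8 * cabs c0 * L * t ^+ 3 <=
    \sum_(k < 4) cabs (h (z0 + p k)) ^+ 2.
  apply: (@le_trans _ _ (\sum_(k < 4)
      (2 * complex.Re (c0^* * h (z0 + p k)) - cabs c0 ^+ 2))); last first.
    by apply: ler_sum => k _; exact: sqr_cabs_ge.
  rewrite sumrB sumr_const card_ord -mulr_sumr -Re_sum -mulr_sumr.
  (* The cubes of the four directions 1, i, -1, -i are 1, -i, -1, i; these are the weights of the
     remainders. *)
  pose G := g (p 0%N) - I * g (p 1%N) - g (p 2%N) + I * g (p 3%N).
  have -> : \sum_(k < 4) h (z0 + p k) = 4 * c0 + t%:C ^+ 3 * G.
    rewrite (sum4 _ (fun k => h (z0 + p k))) !hE ?pt// /G.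
    rewrite p0 p1 p2 p3; move: (t%:C : C) => T.
    (* The identity holds only modulo I^2 + 1; the explicit multiple of I^2 + 1 makes it polynomial
       in an indeterminate I, hence within reach of [ring]. *)
    transitivity (4 * c0 + T ^+ 3 * (g T - I * g (I * T) - g (- T) +
      I * g (- (I * T))) + (I ^+ 2 + 1) * (2 * c2 * T ^+ 2 +
      T ^+ 3 * I * g (I * T) - T ^+ 3 * I * g (- (I * T)))).
      by ring.
    by rewrite i2 addNr mul0r addr0.
  have GL : cabs G <= 4 * L.
    have ig w : cabs w < d -> cabs (I * g w) <= L.
      move=> xd; by rewrite cabsM cI mul1r gL.
    rewrite (_ : 4 * L = L + L + L + L); last by ring.
    apply: le_trans (ler_cabsD _ _) _; rewrite lerD ?ig ?pt//.
    apply: le_trans (ler_cabsB _ _) _; rewrite lerD ?gL ?pt//.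
    by apply: le_trans (ler_cabsB _ _) _; rewrite lerD ?gL ?ig ?pt.
  rewrite mulrDr.
  have -> : complex.Re (c0^* * (4 * c0) + c0^* * (t%:C ^+ 3 * G)) =
      4 * cabs c0 ^+ 2 + complex.Re (c0^* * (t%:C ^+ 3 * G)).
    have -> : c0^* * (4 * c0) = (4 * cabs c0 ^+ 2)%:C.
      rewrite mulrCA rmorphM /= real_complexR; congr (_ * _).
      rewrite sqr_cabs; case: (c0) => x y; apply/eqP.
      by rewrite eq_complex /=; apply/andP; split; apply/eqP; ring.
    by case: (_ * _ : C).
  have cc : cabs (c0^* : C) = cabs c0.
    by case: (c0) => x y; rewrite /cabs /= sqrrN.
  have : `|complex.Re (c0^* * (t%:C ^+ 3 * G))| <= cabs c0 * (t ^+ 3 * (4 * L)).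
    apply: le_trans (ler_Re_cabs _) _.
    rewrite (cabsM (c0^*)) cc (cabsM (t%:C ^+ 3)) (cabsX t%:C) cabsR gtr0_norm// ler_wpM2l ?cabs_ge0//.
    by rewrite ler_wpM2l// exprn_ge0 ?(ltW t0).
  rewrite ler_norml => /andP[hh _]; rewrite -mulr_natl.
  lra.
(* On average over the four points, e |z|^2 gains e t^2 while |h|^2 loses at most 2 |c0| L t^3,
   which is less by the choice of t. *)
move: vmax; rewrite /v big_split /= -mulr_sumr S2 sumr_const card_ord h0 -mulr_natl.
have : 2 * cabs c0 * L * t * t ^+ 2 < e * t ^+ 2 by rewrite ltr_pM2r ?exprn_gt0.
move: S1; rewrite (exprSr t 2) => S1 H1 H2; lra.
Qed.

End maximum_principle.

Section taylor.
Context {R : realType}.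
Local Notation C := (cplx R).
Implicit Types (z w u : C) (x y r d : R) (a : nat -> C) (f h : C -> C).

(** X^n - 1 splits and, in characteristic 0, is separable; n distinct roots of unity must include a
    primitive one. *)
Lemma primitive_root_exists (F : numClosedFieldType) n : (0 < n)%N ->
  exists w : F, n.-primitive_root w.
Proof.
move=> n0; pose p : {poly F} := 'X^n - 1.
have [s Dp] := closed_field_poly_normal p.
rewrite (monicP _) ?monicXnsubC // scale1r in Dp.
have sn1 : all n.-unity_root s by apply/allP=> z; rewrite -root_prod_XsubC -Dp.
have sz_s : (n < (size s).+1)%N by rewrite -(size_prod_XsubC s id) -Dp size_XnsubC.
have [|z] := hasP (cyclic.has_prim_root n0 sn1 _ sz_s); last by exists z.
rewrite -separable.separable_prod_XsubC -Dp.
by rewrite cyclotomic.separable_Xn_sub_1 // pnatr_eq0 -lt0n.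
Qed.

Lemma cabs_root1 w n : (0 < n)%N -> w ^+ n = 1 -> cabs w = 1.
Proof.
move=> n0 wn; apply/eqP; rewrite -(@pexpr_eq1 _ _ n) ?cabs_ge0// -cabsX wn.
by rewrite cabs1.
Qed.

Lemma sum_primitive_root w n m : n.-primitive_root w ->
  \sum_(j < n) (w ^+ j) ^+ m = if (n %| m)%N then n%:R else 0.
Proof.
move=> pw; have n0 := prim_order_gt0 pw.
under eq_bigr do rewrite -exprM mulnC exprM.
rewrite (prim_order_dvd pw); case: eqVneq => [->|wm].
  under eq_bigr do rewrite expr1n.
  by rewrite sumr_const card_ord.
apply/eqP; rewrite -(mulrI_eq0 _ (_ : GRing.lreg (w ^+ m - 1))); last first.
  by apply/lregP; rewrite subr_eq0.
by rewrite -subrX1 exprAC (prim_expr_order pw) expr1n subrr.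
Qed.

Lemma analytic_local f z0 : analytic_on_disc f -> disc z0 ->
  exists a d, 0 < d /\
    forall u, cabs u < d -> power_series a u @ \oo --> f (z0 + u).
Proof.
move=> fa /fa[a /nbhs_cabsP[d d0 hd]]; exists a, d; split=> // u ud.
by have := hd (z0 + u); rewrite addrAC subrr add0r; apply.
Qed.

Lemma analytic_jet2 f z : analytic_on_disc f -> disc z -> jet2 f z.
Proof. by move=> fa /(analytic_local fa)[a [d [d0]]]; exact: jet2_power_series. Qed.

(* The average of w^(-n j) f(w^j z) over the N-th roots of unity w^j only keeps
   the coefficients of index n mod N, so that dividing it by z^n gives a function
   with value a_n at 0, to which the maximum principle applies. *)
Lemma cauchy_estimate_local f a d r M n :
  (forall z, cabs z <= r -> jet2 f z) -> 0 < d ->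
  (forall u, cabs u < d -> power_series a u @ \oo --> f u) ->
  0 < r -> (forall z, cabs z = r -> cabs (f z) <= M) ->
  cabs (a n) * r ^+ n <= M.
Proof.
move=> fj d0 af r0 fM.
(* With this N, w^(4 j) = w^(-n j), and k = n is the only k < n + 3 for which 4 + k is a multiple of
   N. *)
pose N := (n + 4)%N.
have N0 : (0 < N)%N by rewrite /N addn4.
have NR0 : N%:R != 0 :> C by rewrite pnatr_eq0 -lt0n.
have [w pw] := @primitive_root_exists C N N0.
have cw j : cabs (w ^+ j) = 1.
  by rewrite cabsX (cabs_root1 N0 (prim_expr_order pw)) expr1n.
pose S z := \sum_(j < N) (w ^+ j) ^+ 4 * f (w ^+ j * z).
pose Q z := if z == 0 then a n else N%:R^-1 * S z * (z ^+ n)^-1.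
suff : forall z, cabs z <= r -> cabs (Q z) <= M / r ^+ n.
  move=> /(_ 0); rewrite cabs0 => /(_ (ltW r0)).
  by rewrite /Q eqxx ler_pdivlMr ?exprn_gt0.
apply: maximum_modulus; first exact: ltW.
  move=> z zr; have [->|z0] := eqVneq z 0.
    have af0 u : cabs u < d -> power_series a u @ \oo --> f (0 + u).
      by rewrite add0r; exact: af.
    (* Expanding to order n + 3 leaves u^3 after the division by u^n, so the jet of [Q] at 0 is the
       constant a_n. *)
    have [g [e [L [e0 gL fE]]]] := power_series_remainder (n + 3) d0 af0.
    exists (a n), 0, 0, (fun u => N%:R^-1 * \sum_(j < N) ((w ^+ j) ^+ (n + 7) * g (w ^+ j * u))), e, L.
    split=> // u ue.
      rewrite cabsM cabsV cabs_nat mulrC ler_pdivrMr ?ltr0n//.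
      apply: le_trans (ler_cabs_sum _ _ _) _.
      apply: (@le_trans _ _ (\sum_(j < N) L)).
        apply: ler_sum => j _; rewrite cabsM cabsX cw expr1n mul1r.
        by apply: gL; rewrite cabsM cw mul1r.
      by rewrite sumr_const card_ord mulr_natr.
    rewrite !mul0r !addr0 add0r /Q; have [->|u0] := eqVneq u 0.
      by rewrite expr0n mul0r addr0.
    have SE : S u = u ^+ n * (N%:R * a n + u ^+ 3 *
        \sum_(j < N) ((w ^+ j) ^+ (n + 7) * g (w ^+ j * u))).
      rewrite /S.
      under eq_bigr => j _.
        have := fE (w ^+ j * u); rewrite add0r cabsM cw mul1r => ->//.
        rewrite mulrDr mulr_sumr.
        over.
      rewrite big_split /= mulrDr; congr (_ + _); last first.
        rewrite [in RHS]mulrA -exprD mulr_sumr; apply: eq_bigr => j _.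
        rewrite exprMn (_ : (n + 7 = 4 + (n + 3))%N); last by lia.
        by rewrite !exprD; ring.
      rewrite exchange_big /=.
      have -> : u ^+ n * (N%:R * a n) = \sum_(k < n + 3) if k == n :> nat then u ^+ n * (N%:R * a n) else 0.
        rewrite -big_mkcond /= (big_pred1 (Ordinal (_ : (n < n + 3)%N)))//.
        by rewrite addn3 ltnS -addn2 leq_addr.
      apply: eq_bigr => k _.
      under eq_bigr => j _.
        rewrite exprMn (_ : _ * _ = (a k * u ^+ k) * (w ^+ j) ^+ (4 + k)); last first.
          by rewrite exprD; ring.
        over.
      rewrite -mulr_sumr (sum_primitive_root _ pw).
      have -> : (N %| 4 + k)%N = (k == n :> nat).
        apply/idP/eqP => [|->]; last by rewrite /N addnC.
        move=> /dvdnP[q qE]; have kn := ltn_ord k.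
        have : (q = 1)%N.
          by move: qE kn; rewrite /N; case: q => [|[|q]] //; lia.
        by move=> q1; move: qE; rewrite q1 /N; lia.
      by case: eqVneq => [->|_]; [ring|rewrite mulr0].
    rewrite SE mulrCA mulrAC divff ?expf_neq0// mul1r mulrDr mulKf//.
    by rewrite mulrCA.
  apply: (@jet2_near _ _ (fun z => N%:R^-1 * S z * (z ^+ n)^-1) z (cabs z)).
  - exact: cabs_gt0.
  - move=> u uz; rewrite /Q ifF//; apply/eqP => zu.
    by move: uz; rewrite -(addr0_eq zu) cabsN ltxx.
  - apply: jet2M; last first.
      rewrite (_ : (fun _ => _) = fun z => (z^-1) ^+ n).
        by apply: jet2X; exact: jet2V.
      by apply/funext => x; rewrite exprVn.
    apply: jet2M; first exact: jet2_cst.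
    apply: jet2_sum => j; apply: jet2M; first exact: jet2_cst.
    by apply: jet2_rot; [exact: cw|apply: fj; rewrite cabsM cw mul1r].
move=> z zr; rewrite /Q ifF; last by apply/eqP => z0; move: r0; rewrite -zr z0 cabs0 ltxx.
rewrite cabsM cabsV cabsX zr ler_wpM2r ?invr_ge0 ?exprn_ge0 ?(ltW r0)//.
rewrite cabsM cabsV cabs_nat mulrC ler_pdivrMr ?ltr0n//.
apply: le_trans (ler_cabs_sum _ _ _) _.
apply: (@le_trans _ _ (\sum_(j < N) M)).
  apply: ler_sum => j _; rewrite cabsM cabsX cw expr1n mul1r.
  by apply: fM; rewrite cabsM cw mul1r.
by rewrite sumr_const card_ord mulr_natr.
Qed.

End taylor.

(** * Taylor series on the whole disc *)

Section taylor_global.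
Context {R : realType}.
Local Notation C := (cplx R).
Implicit Types (z w u : C) (x y r d : R) (a : nat -> C) (f h : C -> C).

(** With S_n the partial sums, (f - S_n)/w^n has a removable singularity at 0 and is at most (M +
    A)/s^n on |w| = s, where M bounds f and A the partial sums. The maximum principle gives |f(z) -
    S_n(z)| <= (M + A)(|z|/s)^n. *)
Lemma taylor_expansion f a d : (forall z, disc z -> jet2 f z) -> 0 < d ->
  (forall u, cabs u < d -> power_series a u @ \oo --> f u) ->
  forall z, disc z -> power_series a z @ \oo --> f z.
Proof.
move=> fj d0 af z z1.
have [->|zN0] := eqVneq z 0; first by apply: af; rewrite cabs0.
have c0 := cabs_gt0 zN0; rewrite /disc /= in z1.
pose r := (cabs z + 1) / 2; pose s := (cabs z + r) / 2.
have r1 : r < 1 by rewrite /r; lra.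
have zs : cabs z < s by rewrite /s /r; lra.
have sr : s < r by rewrite /s /r; lra.
have s0 : 0 < s by exact: lt_trans zs.
have r0 : 0 < r by exact: lt_trans sr.
have fjr w : cabs w <= r -> jet2 f w.
  by move=> wr; apply: fj; rewrite /disc /= (le_lt_trans wr).
have [M fM] := bounded_on_disc (ltW r0) fjr.
have aM n : cabs (a n) * r ^+ n <= M.
  apply: (cauchy_estimate_local n fjr d0 af r0) => w wr.
  by apply: fM; rewrite wr.
have cm : cvgn (majorant a s) by exact: cvgn_majorant (ltW s0) sr aM.
pose A := limn (majorant a s).
have T_ n w : cabs w <= s -> cabs (power_series a w n) <= A.
  move=> ws; apply: le_trans (ler_cabs_sum _ _ _) _.
  apply: (@le_trans _ _ (majorant a s n)).
    apply: ler_sum => k _; rewrite cabsM cabsX ler_wpM2l ?cabs_ge0//.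
    by rewrite lerXn2r ?nnegrE ?cabs_ge0 ?(ltW s0).
  apply: nondecreasing_cvgn_le => //; apply/nondecreasing_seqP => k.
  rewrite /majorant /series /= big_nat_recr //= lerDl mulr_ge0 ?cabs_ge0//.
  by rewrite exprn_ge0 ?(ltW s0).
have key n : cabs (power_series a z n - f z) <= (M + A) * (cabs z / s) ^+ n.
  pose Q w := if w == 0 then a n else (f w - power_series a w n) * (w ^+ n)^-1.
  suff /(_ z (ltW zs)) : forall w, cabs w <= s -> cabs (Q w) <= (M + A) / s ^+ n.
    rewrite /Q ifN// cabsM cabsV cabsX ler_pdivrMr ?exprn_gt0// cabs_distC.
    by rewrite (expr_div_n (cabs z)) mulrAC !mulrA.
  apply: maximum_modulus; first exact: ltW.
    move=> w ws; have [->|w0] := eqVneq w 0.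
      have af0 u : cabs u < d -> power_series a u @ \oo --> f (0 + u).
        by rewrite add0r; exact: af.
      have [g [e [L [e0 gL fE]]]] := power_series_remainder (n + 3) d0 af0.
      exists (a n), (a n.+1), (a n.+2), g, e, L; split=> // u ue.
      rewrite add0r /Q; have [->|u0] := eqVneq u 0.
        by rewrite !expr0n /= !mulr0 mul0r !addr0.
      have := fE _ ue; rewrite add0r => ->.
      rewrite /power_series /series /= -(big_mkord xpredT (fun k => a k * u ^+ k)).
      rewrite (@big_cat_nat _ _ _ n) ?leq_addr//=.
      rewrite [\sum_(n <= i < n + 3) _](_ : _ = u ^+ n * (a n + a n.+1 * u + a n.+2 * u ^+ 2)).
        rewrite [X in X * _](_ : _ = u ^+ n * (a n + a n.+1 * u + a n.+2 * u ^+ 2 +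
            u ^+ 3 * g u)); last by rewrite exprD; ring.
        by rewrite mulrAC divff ?expf_neq0// mul1r.
      have big_ltn3 (F : nat -> C) :
          \sum_(n <= i < n + 3) F i = F n + F n.+1 + F n.+2.
        rewrite addn3 big_nat_recr ?leq_addr ?leqW//= big_nat_recr ?leqW//=.
        by rewrite big_nat1.
      by rewrite big_ltn3 !(exprS u); ring.
    apply: (@jet2_near _ _ (fun w => (f w + (- 1) * power_series a w n) * (w^-1 ^+ n)) w (cabs w)).
    - exact: cabs_gt0.
    - move=> u uw; rewrite /Q ifF ?exprVn ?mulN1r//; apply/eqP => wu.
      by move: uw; rewrite -(addr0_eq wu) cabsN ltxx.
    - apply: jet2M; last by apply: jet2X; exact: jet2V.
      apply: jet2D; first by apply: fjr; rewrite (le_trans ws)// ltW.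
      apply: jet2M; first exact: jet2_cst.
      apply: jet2_sum => k; apply: jet2M; first exact: jet2_cst.
      exact: jet2X (jet2_id _).
  move=> w ws; rewrite /Q ifF; last first.
    by apply/eqP => w0; move: s0; rewrite -ws w0 cabs0 ltxx.
  rewrite cabsM cabsV cabsX ws ler_wpM2r ?invr_ge0 ?exprn_ge0 ?(ltW s0)//.
  apply: le_trans (ler_cabsB _ _) _; apply: lerD; first by rewrite fM// ws ltW.
  by apply: T_; rewrite ws.
apply/cvg_cabsP; apply: (@squeeze_cvgr _ _ _ _ (fun=> 0) (geometric (M + A) (cabs z / s))).
- by near=> n; rewrite cabs_ge0 key.
- exact: cvg_cst.
- have q0 : 0 <= cabs z / s by apply: divr_ge0; [exact: cabs_ge0|exact: ltW].
  by apply: cvg_geometric; rewrite ger0_norm// ltr_pdivrMr// mul1r.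
Unshelve. all: by end_near. Qed.

Lemma disc0 : disc (0 : C).
Proof. by rewrite /disc /mkset cabs0. Qed.

(** A local expansion at 0 extends to the disc, so the [xget] in [coefs] does select an
    expansion. *)
Lemma coefsP f : analytic_on_disc f ->
  forall z, disc z -> power_series (coefs f) z @ \oo --> f z.
Proof.
move=> fa.
have [a [d [d0 af]]] := analytic_local fa disc0.
have fj z : disc z -> jet2 f z by exact: analytic_jet2.
have afz u : cabs u < d -> power_series a u @ \oo --> f u.
  by move/af; rewrite add0r.
by rewrite /coefs; case: xgetP => [b _|/(_ a)[]] //; exact: taylor_expansion afz.
Qed.

(** Cauchy's estimate on the circle of radius 1/2 for the zero function, which is the sum of the
    series with coefficients a - b. *)
Lemma power_series_unique a b f :
  (forall z, disc z -> power_series a z @ \oo --> f z) ->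
  (forall z, disc z -> power_series b z @ \oo --> f z) -> a = b.
Proof.
move=> af bf; apply/funext => n; apply/eqP; rewrite -subr_eq0; apply/eqP/cabs0_eq0.
pose c k := a k - b k.
have cf z : disc z -> power_series c z @ \oo --> (0 : C).
  move=> z1; rewrite -(subrr (f z)) (_ : power_series c z =
    power_series a z \- power_series b z); first exact: cvgB (af _ z1) (bf _ z1).
  apply/funext => k; rewrite /power_series /series /= -sumrB.
  by apply: eq_bigr => i _; rewrite mulrBl.
have h0 : cabs (c n) * 2^-1 ^+ n <= 0.
  apply: (@cauchy_estimate_local _ (fun=> 0) c 1 2^-1) => //.
  - by move=> z _; exact: jet2_cst.
  - by move=> z _; rewrite cabs0.
apply/eqP; rewrite eq_le cabs_ge0 andbT.
by rewrite -(pmulr_lle0 _ (_ : 0 < 2^-1 ^+ n :> R)).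
Qed.

Lemma coefs_unique a f : (forall z, disc z -> power_series a z @ \oo --> f z) ->
  coefs f = a.
Proof.
move=> af; rewrite /coefs; case: xgetP => [b _ bf|/(_ a)[]] //.
exact: power_series_unique bf af.
Qed.

Lemma cauchy_estimate f r M n : analytic_on_disc f -> 0 < r < 1 ->
  (forall z, cabs z = r -> cabs (f z) <= M) -> cabs (coefs f n) * r ^+ n <= M.
Proof.
move=> fa /andP[r0 r1] fM.
apply: (@cauchy_estimate_local _ f (coefs f) 1 r M n) => // [z zr|z z1].
  by apply: analytic_jet2 => //; rewrite /disc /= (le_lt_trans zr).
exact: coefsP.
Qed.

End taylor_global.

(** * Derivatives of power series and growth of Bloch functions *)

Section quadratic_derivative.

(** Stated over an arbitrary numeric field because it serves both the complex derivative of a power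
    series and the real derivative along a ray. *)
Lemma is_derive_quadratic (K : numFieldType) (f : K -> K) (x c d k : K) :
  0 < d -> 0 <= k ->
  (forall u, `|u| < d -> `|f (x + u) - f x - c * u| <= k * `|u| ^+ 2) ->
  is_derive x 1 f c.
Proof.
move=> d0 k0 fd.
suff fc : (fun h => h^-1 *: ((f \o shift x) (h *: 1) - f x)) @ 0^' --> c.
  apply: DeriveDef; first by apply/cvg_ex; exists c.
  by rewrite /derive; exact: (cvg_lim (@norm_hausdorff _ K)).
apply/cvgrPdist_lt => e e0; near=> h.
have h0 : h != 0 by near: h; exact: nbhs_dnbhs_neq.
have hd : `|h| < d by near: h; apply: dnbhs0_lt.
have he : `|h| < e / (k + 1).
  by near: h; apply: dnbhs0_lt; rewrite divr_gt0// ltr_wpDl.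
rewrite distrC /= [h *: 1]mulr1.
rewrite (_ : _ - c = h^-1 * (f (x + h) - f x - c * h)); last first.
  by rewrite mulrBr [h^-1 * (c * _)]mulrC mulfK// [x + h]addrC.
rewrite normrM normfV ltr_pdivrMl ?normr_gt0//.
apply: le_lt_trans (fd _ hd) _.
rewrite expr2 mulrCA ltr_pM2l ?normr_gt0//.
rewrite ltr_pdivlMr ?ltr_wpDl// in he.
by apply: le_lt_trans he; rewrite mulrC ler_wpM2l// lerDl.
Unshelve. all: by end_near. Qed.

End quadratic_derivative.

Section derivative_of_power_series.
Context {R : realType}.
Local Notation C := (cplx R).
Implicit Types (z w u : C) (x y r d : R) (a : nat -> C) (f h : C -> C).

Lemma discE z : disc z = (cabs z < 1) :> Prop.
Proof. by []. Qed.

(** Absolute convergence at every radius below 1: the form of convergence on the disc that passes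
    easily to derivatives and recentred series. *)
Definition disc_majorized a := forall r, 0 <= r < 1 -> cvgn (majorant a r).

Definition deriv_coef a n : C := a n.+1 *+ n.+1.

Lemma disc_majorizedP a : (forall z, disc z -> cvgn (power_series a z)) ->
  disc_majorized a.
Proof.
move=> ca r /andP[r0 r1].
have s0 : 0 <= (r + 1) / 2 by rewrite divr_ge0// addr_ge0.
have [|B aB] := @bounded_terms _ a ((r + 1) / 2)%:C.
  by apply: ca; rewrite discE cabsR ger0_norm//; lra.
rewrite cabsR ger0_norm// in aB.
by apply: cvgn_majorant aB => //; lra.
Qed.

Lemma disc_majorized_bounded a r : disc_majorized a -> 0 <= r < 1 ->
  exists B, forall n, cabs (a n) * r ^+ n <= B.
Proof.
move=> am /[dup] /andP[r0 _] /am cm.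
have rr : cabs (r%:C : C) <= r by rewrite cabsR ger0_norm.
have [cr _] := PS_dominated rr cm.
have [|B aB] := @bounded_terms _ a (r%:C); first by apply/cvg_ex; eexists; exact: cr.
by exists B => n; have := aB n; rewrite cabsR ger0_norm.
Qed.

Lemma PS_cvg a z : disc_majorized a -> disc z ->
  power_series a z @ \oo --> PS a z.
Proof.
move=> am z1; have [] := @PS_dominated _ a z (cabs z) (lexx _) _ => //.
by apply: am; rewrite cabs_ge0.
Qed.

Lemma PS_le a z : disc_majorized a -> disc z ->
  cabs (PS a z) <= limn (majorant a (cabs z)).
Proof.
move=> am z1; have [] := @PS_dominated _ a z (cabs z) (lexx _) _ => //.
by apply: am; rewrite cabs_ge0.
Qed.

Lemma PS0 a : PS a 0 = a 0%N.
Proof.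
apply: cvgC_lim; rewrite -cvg_shiftS (_ : [sequence _]_n = fun=> a 0%N).
  exact: cvg_cst.
apply/funext => n; rewrite /= /power_series /series /= big_nat_recl//= expr0 mulr1.
by rewrite big1 ?addr0// => k _; rewrite exprS mul0r mulr0.
Qed.

(** Two terms of the binomial expansion of (r + d)^(n+1). The factor n + 1 of a differentiated
    coefficient is paid for by enlarging the radius from r to r + d. *)
Lemma bernoulli_exprD r d n : 0 <= r -> 0 <= d ->
  n.+1%:R * r ^+ n * d <= (r + d) ^+ n.+1.
Proof.
move=> r0 d0; suff : r ^+ n.+1 + n.+1%:R * r ^+ n * d <= (r + d) ^+ n.+1.
  by apply: le_trans; rewrite lerDr exprn_ge0.
elim: n => [|n IH]; first by rewrite !expr1 expr0 mulr1 mul1r.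
rewrite [leRHS]exprS; apply: le_trans (ler_wpM2l (addr_ge0 r0 d0) IH).
rewrite -subr_ge0 (_ : _ - _ = n.+1%:R * r ^+ n * d ^+ 2).
  by rewrite !mulr_ge0 ?exprn_ge0.
by rewrite -[n.+2%:R]natr1 !exprS; ring.
Qed.

Lemma disc_majorized_deriv a : disc_majorized a -> disc_majorized (deriv_coef a).
Proof.
move=> am r /andP[r0 r1].
(* Room for two enlargements of the radius inside the disc: one absorbs the factor n + 1, the other
   is used by Abel's lemma. *)
pose d := (1 - r) / 3; have d0 : 0 < d by rewrite /d; lra.
have s0 : 0 <= r + d by rewrite addr_ge0// ltW.
have [|B aB] := @disc_majorized_bounded a (r + d + d) am.
  by apply/andP; split; rewrite /d; lra.
apply: (@cvgn_majorant _ _ _ (r + d) (d^-1 * B)) => // [|n].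
  by rewrite ltrDl.
rewrite /deriv_coef -mulr_natr cabsM cabs_nat ler_pdivlMl//.
apply: le_trans (aB n.+1); rewrite -mulrA mulrCA ler_wpM2l ?cabs_ge0//.
by rewrite mulrC bernoulli_exprD// ltW.
Qed.

Lemma deriv_coef_lim a z : disc_majorized a -> disc z ->
  recentered_coef a z 1 = PS (deriv_coef a) z.
Proof.
move=> am z1; apply: cvgC_lim; rewrite -cvg_shiftS.
rewrite [X in X @ \oo --> _](_ : _ = power_series (deriv_coef a) z).
  exact: PS_cvg (disc_majorized_deriv am) z1.
apply/funext => n; rewrite /= /series /power_series /= big_nat_recl//=.
rewrite bin1 mulr0n mulr0 add0r; apply: eq_bigr => k _.
by rewrite bin1 subn1 /= /deriv_coef mulrnAr mulrnAl.
Qed.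

Lemma PS_recenter_disc a z d : disc_majorized a -> 0 < d -> cabs z + d < 1 ->
  exists2 A, 0 <= A & forall K u, cabs u <= d ->
   cabs (PS a (z + u) - \sum_(k < K) recentered_coef a z k * u ^+ k)
   <= (cabs u / d) ^+ K * A.
Proof.
move=> am d0 zd; have cm : cvgn (majorant a (cabs z + d)).
  by apply: am; rewrite zd addr_ge0 ?cabs_ge0// ltW.
exists (limn (majorant a (cabs z + d))); last first.
  by move=> K u ud; exact: PS_recenter.
have zz : cabs z <= cabs z + d by rewrite lerDl ltW.
by have [_] := PS_dominated zz cm; apply: le_trans; exact: cabs_ge0.
Qed.

Lemma analytic_PS a f : disc_majorized a -> (forall z, disc z -> f z = PS a z) ->
  analytic_on_disc f.
Proof.
move=> am fE z z1; rewrite discE in z1.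
pose d := (1 - cabs z) / 2; have d0 : 0 < d by rewrite /d; lra.
have [|A A0 hA] := PS_recenter_disc (z := z) am d0; first by rewrite /d; lra.
exists (recentered_coef a z); apply/nbhs_cabsP; exists d => // w wd.
have [w1 ww] : disc w /\ w = z + (w - z).
  split; last by rewrite subrKC.
  rewrite discE -(subrK z w) (le_lt_trans (ler_cabsD _ _))//.
  by rewrite /d in wd; lra.
rewrite fE// [in PS _ _]ww; move: (w - z) wd => u ud.
apply/cvg_cabsP.
apply: (@squeeze_cvgr _ _ _ _ (fun=> 0) (geometric A (cabs u / d))).
- near=> n; rewrite cabs_ge0 cabs_distC /power_series /series /= big_mkord.
  by rewrite [leRHS]mulrC; apply: hA; rewrite ltW.
- exact: cvg_cst.
- have q0 : 0 <= cabs u / d by apply: divr_ge0; [exact: cabs_ge0|exact: ltW].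
  by apply: cvg_geometric; rewrite ger0_norm// ltr_pdivrMr// mul1r.
Unshelve. all: by end_near. Qed.

Lemma PS_quadratic a f z : disc_majorized a ->
  (forall w, disc w -> f w = PS a w) -> disc z ->
  exists d k, [/\ 0 < d, 0 <= k & forall u, cabs u < d ->
    disc (z + u) /\
    cabs (f (z + u) - f z - PS (deriv_coef a) z * u) <= k * cabs u ^+ 2].
Proof.
move=> am fE z1; have z1' := z1; rewrite discE in z1'.
pose d := (1 - cabs z) / 2; have d0 : 0 < d by rewrite /d; lra.
have [|A A0 hA] := PS_recenter_disc (z := z) am d0; first by rewrite /d; lra.
exists d, (A / d ^+ 2); split=> //; first by rewrite divr_ge0// exprn_ge0// ltW.
move=> u ud.
have zu1 : disc (z + u).
  by rewrite discE (le_lt_trans (ler_cabsD _ _))//; rewrite /d in ud; lra.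
split=> //.
have rc0 : recentered_coef a z 0 = f z.
  have := hA 1%N 0; rewrite cabs0 addr0 big_ord1 expr0 mulr1 mul0r expr1 mul0r.
  move=> /(_ (ltW d0)) h; apply/esym/eqP; rewrite -subr_eq0 fE//; apply/eqP/cabs0_eq0.
  by apply/eqP; rewrite eq_le h cabs_ge0.
have := hA 2%N u (ltW ud).
rewrite !big_ord_recl big_ord0 /= expr0 mulr1 expr1 addr0 rc0 -fE//.
rewrite deriv_coef_lim// opprD addrA (expr_div_n (cabs u)).
by rewrite [X in _ <= X -> _]mulrC [X in _ <= X -> _]mulrA [X in _ <= X -> _]mulrAC.
Qed.

Lemma is_derive_PS a f z : disc_majorized a ->
  (forall w, disc w -> f w = PS a w) -> disc z ->
  is_derive z 1 f (PS (deriv_coef a) z).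
Proof.
move=> am fE /(PS_quadratic am fE)[d [k [d0 k0 fq]]].
apply: (@is_derive_quadratic C f z _ d%:C k%:C); rewrite ?ltcR ?ler0c//.
move=> u; rewrite normC_cabs ltcR => /fq[_].
by rewrite !normC_cabs -rmorphXn /= -rmorphM /= lecR.
Qed.

Lemma derive1_PS a f z : disc_majorized a ->
  (forall w, disc w -> f w = PS a w) -> disc z ->
  derive1 f z = PS (deriv_coef a) z.
Proof.
by move=> am fE z1; rewrite derive1E; have [_] := is_derive_PS am fE z1.
Qed.

Lemma coefs_majorized f : analytic_on_disc f -> disc_majorized (coefs f).
Proof.
move=> fa; apply: disc_majorizedP => z z1; apply/cvg_ex; exists (f z).
exact: coefsP.
Qed.

Lemma coefs_PS f z : analytic_on_disc f -> disc z -> f z = PS (coefs f) z.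
Proof. by move=> fa z1; apply/esym/cvgC_lim/coefsP. Qed.

End derivative_of_power_series.

Section growth.
Context {R : realType}.
Local Notation C := (cplx R).
Implicit Types (z w u : C) (x y r d s p : R) (a : nat -> C) (f h : C -> C).

Lemma is_derive_powR_onem p s : s < 1 ->
  is_derive s 1 (fun t => (1 - t) `^ p) (- (p * (1 - s) `^ (p - 1))).
Proof.
move=> s1.
have s0 : 1 - s \in `]0, +oo[%R by rewrite in_itv /= andbT subr_gt0.
have d1 : is_derive (1 - s) 1 (fun t : R => t `^ p) (p * (1 - s) `^ (p - 1)).
  have := derivableP (@derivable_powR R 1 p _ s0).
  by rewrite -derive1E powR_derive1.
have d2 : is_derive s 1 (fun t => 1 - t) (-1).
  have := is_deriveB (is_derive_cst (1 : R) s 1) (is_derive_id s 1).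
  by rewrite sub0r.
by have := @is_derive1_comp _ (fun t : R => t `^ p) (fun t => 1 - t) s _ _ d1 d2; rewrite mulrN1.
Qed.

Lemma ler_is_derive (g dg : R -> R) x y : x <= y ->
  (forall s, x <= s <= y -> is_derive s 1 g (dg s)) ->
  (forall s, x <= s <= y -> 0 <= dg s) -> g x <= g y.
Proof.
rewrite le_eqVlt => /predU1P[<-//|xy] gd dg0.
have [s||s] := @MVT _ g dg x y xy.
- by rewrite in_itv /= => /andP[xs sy]; apply: gd; rewrite !ltW.
- apply: derivable_within_continuous => s; rewrite in_itv /= => sxy.
  by have [] := gd _ sxy.
- rewrite in_itv /= => /andP[xs sy] e; rewrite -subr_ge0 e mulr_ge0//.
    by apply: dg0; rewrite !ltW.
  by rewrite subr_ge0 ltW.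
Qed.

(** Brings the complex derivative down to one real variable, where the mean value theorem is
    available. *)
Lemma is_derive_ray a f v w s : disc_majorized a ->
  (forall z, disc z -> f z = PS a z) -> cabs w = 1 -> disc (s%:C * w) ->
  is_derive s 1 (fun t => complex.Re (v * f (t%:C * w)))
    (complex.Re (v * (PS (deriv_coef a) (s%:C * w) * w))).
Proof.
move=> am fE w1 /(PS_quadratic am fE)[d [k [d0 k0 fq]]].
apply: (@is_derive_quadratic R _ s _ d (cabs v * k)) => //.
  by rewrite mulr_ge0// cabs_ge0.
move=> h hd; have hw : cabs (h%:C * w) = `|h| by rewrite cabsM w1 mulr1 cabsR.
have [|_ fh] := fq (h%:C * w); first by rewrite hw.
have ReB (z1 z2 : C) : complex.Re z1 - complex.Re z2 = complex.Re (z1 - z2).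
  by case: z1; case: z2.
have ReR (z1 : C) t : complex.Re z1 * t = complex.Re (z1 * t%:C).
  by case: z1 => ? ? /=; rewrite mulr0 subr0.
rewrite ReR !ReB; apply: le_trans (ler_Re_cabs _) _.
rewrite (_ : _ - _ = v * (f (s%:C * w + h%:C * w) - f (s%:C * w) -
    PS (deriv_coef a) (s%:C * w) * (h%:C * w))); last first.
  by rewrite rmorphD /= mulrDl; ring.
by rewrite cabsM -mulrA ler_wpM2l ?cabs_ge0// -hw.
Qed.

(** On a ray |f'(s w)| <= S (1 - s)^(-b), as 1 - s^2 >= 1 - s, and S/(b - 1) (1 - s)^(1-b) is a
    primitive of the right-hand side. Instead of integrating, the proof shows that [g], the
    primitive minus Re (v f), is nondecreasing. *)
Lemma bloch_growth f b S z : analytic_on_disc f -> 1 < b -> 0 <= S ->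
  (forall w, disc w -> (1 - cabs w ^+ 2) `^ b * cabs (derive1 f w) <= S) ->
  disc z -> cabs (f z) <= cabs (f 0) + S / (b - 1) * (1 - cabs z) `^ (1 - b).
Proof.
move=> fa b1 S0 fS z1; have z1' : cabs z < 1 by [].
have am := coefs_majorized fa.
have fE w : disc w -> f w = PS (coefs f) w by exact: coefs_PS.
have [->|zN0] := eqVneq z 0.
  by rewrite lerDl mulr_ge0 ?powR_ge0// divr_ge0// subr_ge0 ltW.
have c0 := cabs_gt0 zN0.
pose w := (cabs z)^-1%:C * z.
have w1 : cabs w = 1.
  by rewrite cabsM cabsR ger0_norm ?invr_ge0 ?cabs_ge0// mulVf// gt_eqF.
have zw : z = (cabs z)%:C * w.
  by rewrite /w mulrA -rmorphM /= mulfV ?gt_eqF// mul1r.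
have [v v1 vE] := cabs_Re_phase (f z - f 0).
have dw s : 0 <= s <= cabs z -> disc (s%:C * w).
  move=> /andP[s0 sz]; rewrite discE cabsM w1 mulr1 cabsR ger0_norm//.
  exact: le_lt_trans z1'.
pose g t := S / (b - 1) * (1 - t) `^ (1 - b) - complex.Re (v * f (t%:C * w)).
have : g 0 <= g (cabs z).
  apply: (@ler_is_derive _ (fun s => S * (1 - s) `^ (- b) -
      complex.Re (v * (PS (deriv_coef (coefs f)) (s%:C * w) * w)))).
  - exact: ltW.
  - move=> s sz; have h2 := is_derive_ray v am fE w1 (dw _ sz).
    have s1 : s < 1 by case/andP: sz => _ /le_lt_trans; apply.
    have h1 : is_derive s 1 (fun t => S / (b - 1) * (1 - t) `^ (1 - b))
        (S * (1 - s) `^ (- b)).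
      apply: is_derive_eq (is_deriveZ (S / (b - 1)) (is_derive_powR_onem (1 - b) s1)) _.
      rewrite /GRing.scale /= -mulNr opprB mulrA divfK.
        by congr (_ * _ `^ _); ring.
      by rewrite subr_eq0 gt_eqF.
    exact: is_deriveB h1 h2.
  - move=> s sz; rewrite subr_ge0; apply: le_trans (ler_norm _) _.
    apply: le_trans (ler_Re_cabs _) _; rewrite cabsM v1 mul1r cabsM w1 mulr1.
    rewrite -(derive1_PS am fE (dw _ sz)).
    have := fS _ (dw _ sz); rewrite cabsM w1 mulr1 cabsR.
    case/andP: sz => s0 sz; rewrite ger0_norm//.
    have s1 : s < 1 by exact: le_lt_trans z1'.
    have s2 : 0 < 1 - s ^+ 2 by rewrite subr_gt0 exprn_ilt1.
    rewrite mulrC -ler_pdivlMr ?powR_gt0// => h; apply: le_trans h _.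
    rewrite ler_wpM2l// powRN lef_pV2 ?posrE ?powR_gt0 ?s2 ?subr_gt0//.
    apply: ge0_ler_powR; rewrite ?nnegrE ?(ltW s2) ?subr_ge0 ?(ltW s1)//.
      by rewrite (le_trans _ (ltW b1)).
    by rewrite lerD2l lerN2 expr2 ler_piMr// ltW.
rewrite /g -zw subr0 powR1 mulr1 mul0r => h.
have E : cabs (f z - f 0) = complex.Re (v * f z) - complex.Re (v * f 0).
  rewrite -vE mulrBr; by case: (v * f z); case: (v * f 0).
have Sb : 0 <= S / (b - 1) by rewrite divr_ge0// subr_ge0 ltW.
by have := ler_cabs_dist (f z) (f 0); rewrite E; lra.
Qed.

End growth.

(** * Negative binomial series *)

Section binomial_series.
Context {R : realType}.
Local Notation C := (cplx R).
Implicit Types (x y r d s a : R).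

(* The coefficient of x^n in (1 - x)^(-a). *)
Definition negbin a n : R := \prod_(j < n) ((a + j%:R) / j.+1%:R).

Lemma negbin0 a : negbin a 0 = 1.
Proof. by rewrite /negbin big_ord0. Qed.

Lemma negbinS a n : negbin a n.+1 = negbin a n * ((a + n%:R) / n.+1%:R).
Proof. by rewrite /negbin big_ord_recr. Qed.

Lemma negbin_gt0 a n : 0 < a -> 0 < negbin a n.
Proof.
by move=> a0; apply: prodr_gt0 => j _; rewrite divr_gt0// ltr_wpDr.
Qed.

Lemma negbin_succ a n : a * negbin (a + 1) n = negbin a n * (a + n%:R).
Proof.
elim: n => [|n IH]; first by rewrite !negbin0 addr0 mulr1 mul1r.
rewrite !negbinS mulrA IH -natr1; have : n%:R + 1 != 0 :> R by rewrite natr1 pnatr_eq0.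
by move=> ?; field.
Qed.

(** Coefficient form of the rule that (1 - x)^(-a) has derivative a (1 - x)^(-a-1). *)
Lemma negbin_deriv a n : n.+1%:R * negbin a n.+1 = a * negbin (a + 1) n.
Proof.
rewrite negbin_succ negbinS mulrCA; congr (_ * _).
by rewrite mulrC divfK// pnatr_eq0.
Qed.

(** Coefficient form of (1 - x) (1 - x)^(-a-1) = (1 - x)^(-a). *)
Lemma negbin_diff a n : a != 0 ->
  negbin (a + 1) n.+1 - negbin (a + 1) n = negbin a n.+1.
Proof.
move=> a0; rewrite negbinS -[RHS](mulfK (_ : n.+1%:R != 0)) ?pnatr_eq0//.
rewrite [_ * n.+1%:R]mulrC negbin_deriv -natr1.
have : n%:R + 1 != 0 :> R by rewrite natr1 pnatr_eq0.
by move=> ?; field.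
Qed.

Definition cnegbin a n : C := (negbin a n)%:C.

Lemma cnegbin_majorized a : 0 < a -> disc_majorized (cnegbin a).
Proof.
move=> a0 r /andP[r0 r1].
pose s := (r + 1) / 2; have s1 : s < 1 by rewrite /s; lra.
have s0 : 0 <= s by rewrite /s; lra.
(* From this index on the ratio s (a + n)/(n + 1) of consecutive terms is at most 1, so the terms up
   to N bound all the others. *)
pose N := `|Num.ceil (a * s / (1 - s))|%N.
pose B := \sum_(k < N.+1) negbin a k * s ^+ k.
have cE n : cabs (cnegbin a n) = negbin a n.
  by rewrite cabsR ger0_norm// ltW// negbin_gt0.
have t0 n : 0 <= negbin a n * s ^+ n by rewrite mulr_ge0 ?exprn_ge0// ltW// negbin_gt0.
apply: (@cvgn_majorant _ _ _ s B) => //; first by rewrite /s; lra.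
elim=> [|n IH]; rewrite cE.
  by rewrite /B big_ord_recl lerDl sumr_ge0.
have [nN|Nn] := ltnP n N.
  by rewrite /B (bigD1 (Ordinal (_ : (n.+1 < N.+1)%N)))//= lerDl sumr_ge0.
apply: le_trans IH; rewrite cE negbinS exprSr mulrACA ler_piMr//.
rewrite mulrAC ler_pdivrMr ?ltr0n// mul1r -natr1.
have : a * s / (1 - s) <= n%:R.
  apply: le_trans (ceil_ge _) _; apply: (@le_trans _ _ N%:R); last by rewrite ler_nat.
  by rewrite -[N%:R]/((N : int)%:~R) ler_int /N abszE ler_norm.
rewrite ler_pdivrMr ?subr_gt0// => h; lra.
Qed.

Lemma binomial_series_aux a s : 0 < a -> 0 <= s < 1 ->
  (1 - s%:C) * PS (cnegbin (a + 1)) s%:C = PS (cnegbin a) s%:C.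
Proof.
move=> a0 /andP[s0 s1]; have a10 : 0 < a + 1 by rewrite addr_gt0.
have ds : disc (s%:C : C) by rewrite discE cabsR ger0_norm.
have c1 := PS_cvg (cnegbin_majorized a10) ds.
have c0 := PS_cvg (cnegbin_majorized a0) ds.
apply/esym/cvgC_lim.
have tl : (fun n => cnegbin (a + 1) n * s%:C ^+ n) @ \oo --> (0 : C).
  by apply: cvg_series_cvg_0; apply/cvg_ex; eexists; exact: c1.
(* The added term is the boundary term of the summation by parts; it makes [g] equal to the partial
   sums for exponent a, and it tends to 0. *)
pose g n : C := (1 - s%:C) * power_series (cnegbin (a + 1)) s%:C n.+1 +
  s%:C * (cnegbin (a + 1) n * s%:C ^+ n).
have : g @ \oo --> ((1 - s%:C) * PS (cnegbin (a + 1)) s%:C + s%:C * 0 : C).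
  apply: cvgD; last exact: cvgMr.
  by apply: cvgMr; have := c1; rewrite -cvg_shiftS.
rewrite mulr0 addr0 -[X in _ -> X]cvg_shiftS.
suff -> : g = (fun n => power_series (cnegbin a) s%:C n.+1) by [].
apply/funext => n /=; apply/esym; rewrite /g /power_series /series /=.
elim: n => [|n IH].
  by rewrite !big_nat1 /cnegbin !negbin0 !expr0; ring.
rewrite big_nat_recr//= IH [X in _ = _ * X + _]big_nat_recr//=.
rewrite /cnegbin -(negbin_diff _ (lt0r_neq0 a0)) rmorphB /= exprS; ring.
Qed.

(** Let B be the sum for exponent a and B_1 the one for a + 1. Then B' = a B_1 and B = (1 - s) B_1,
    so (1 - s)^a B(s) has derivative 0 and keeps its value 1 at s = 0. *)
Lemma binomial_series a x : 0 < a -> 0 <= x < 1 ->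
  series (fun n => negbin a n * x ^+ n) @ \oo --> (1 - x) `^ (- a).
Proof.
move=> a0 /andP[x0 x1]; have a10 : 0 < a + 1 by rewrite addr_gt0.
have ds s : 0 <= s < 1 -> disc (s%:C : C).
  by move=> /andP[s0 s1]; rewrite discE cabsR ger0_norm.
have cP : series (fun n => negbin a n * x ^+ n) @ \oo -->
    complex.Re (PS (cnegbin a) x%:C).
  have := PS_cvg (cnegbin_majorized a0) (ds x _); rewrite x0 x1 => /(_ isT)/cvg_ReP.
  rewrite (_ : (fun n => _) = series (fun n => negbin a n * x ^+ n))//.
  apply/funext => n; rewrite /power_series /series /= Re_sum; apply: eq_bigr => k _.
  by rewrite /cnegbin -real_complexX Re_realM.
suff <- : complex.Re (PS (cnegbin a) x%:C) = (1 - x) `^ (- a) by [].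
pose B s := complex.Re (1 * PS (cnegbin a) (s%:C * 1)).
pose F s := (1 - s) `^ a * B s.
have dF s : 0 <= s < 1 -> is_derive s 1 F 0.
  move=> s01; have /andP[s0 s1] := s01.
  have dB : is_derive s 1 B (a * complex.Re (PS (cnegbin (a + 1)) s%:C)).
    have ds1 : disc (s%:C * 1 : C) by rewrite mulr1; exact: ds.
    apply: is_derive_eq (is_derive_ray 1 (cnegbin_majorized a0) (fun z _ => erefl)
      (cabs1 (R := R)) ds1) _.
    rewrite mul1r !mulr1 (_ : PS _ _ = a%:C * PS (cnegbin (a + 1)) s%:C).
      by rewrite Re_realM.
    apply: cvgC_lim; rewrite (_ : power_series _ _ =
        fun n => a%:C * power_series (cnegbin (a + 1)) s%:C n).
      by apply: cvgMr; exact: PS_cvg (cnegbin_majorized a10) (ds _ s01).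
    apply/funext => n; rewrite /power_series /series /= mulr_sumr; apply: eq_bigr => k _.
    rewrite /deriv_coef /cnegbin mulrA -real_complexM -negbin_deriv real_complexM.
    by rewrite real_complexR mulr_natl.
  apply: is_derive_eq (is_deriveM (is_derive_powR_onem a s1) dB) _.
  have -> : B s = (1 - s) * complex.Re (PS (cnegbin (a + 1)) s%:C).
    rewrite /B mul1r mulr1 -binomial_series_aux//.
    by case: (PS _ _) => ? ? /=; rewrite oppr0 addr0 mul0r subr0.
  rewrite /GRing.scale /=.
  have -> : (1 - s) `^ a = (1 - s) * (1 - s) `^ (a - 1).
    by rewrite mulr_powRB1// subr_ge0 ltW.
  ring.
have F01 : F 0 = F x.
  have ds01 s : 0 <= s <= x -> 0 <= s < 1.
    by move=> /andP[-> /= h]; exact: le_lt_trans x1.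
  apply: le_anti; apply/andP; split.
    by apply: (@ler_is_derive R F (fun=> 0)) => // s /ds01/dF.
  rewrite -[F x]opprK -[F 0]opprK lerN2.
  apply: (@ler_is_derive R (- F) (fun=> 0)) => // s /ds01/dF h.
  by have := is_deriveN h; rewrite oppr0.
have B0 : B 0 = 1.
  rewrite /B mul1r mul0r.
  by rewrite PS0 /cnegbin negbin0.
move: F01; rewrite /F B0 subr0 powR1 mulr1 /B mul1r mulr1 powRN => /(congr1 (fun t => ((1 - x) `^ a)^-1 * t)).
by rewrite mulr1 mulKf// gt_eqF// powR_gt0// subr_gt0.
Qed.

End binomial_series.

(** * Dyadic decomposition of the interval *)

Section dyadic.
Context {R : realType}.
Variable mu : {measure set (measurableTypeR R) -> \bar R}.
Implicit Types (s t b M : R).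

Definition dyad j : R := 2^-1 ^+ j.

Lemma dyad_gt0 j : 0 < dyad j. Proof. by rewrite exprn_gt0// invr_gt0. Qed.

Lemma dyad_ge0 j : 0 <= dyad j. Proof. exact: ltW (dyad_gt0 j). Qed.

Lemma dyadS j : dyad j.+1 = dyad j / 2.
Proof. by rewrite /dyad exprSr. Qed.

Lemma dyad_le1 j : dyad j <= 1.
Proof. by rewrite exprn_ile1 ?invr_ge0// invf_le1// ler1n. Qed.

Definition dyad_itv j : set (measurableTypeR R) := `[1 - dyad j, 1 - dyad j.+1[.

Lemma dyad_itvE j (t : R) :
  dyad_itv j t = (1 - dyad j <= t < 1 - dyad j.+1) :> Prop.
Proof. by rewrite /dyad_itv /= in_itv. Qed.

Lemma dyad_decr i j : (i <= j)%N -> dyad j <= dyad i.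
Proof.
by move=> ij; rewrite /dyad ler_wiXn2l ?invr_ge0// invf_le1// ler1n.
Qed.

Lemma bigcup_dyad_itv : \bigcup_j dyad_itv j = `[0, 1[%classic :> set (measurableTypeR R).
Proof.
apply/seteqP; split=> [t [j _]|t]; rewrite ?dyad_itvE /= !in_itv /= => /andP[].
  move=> h1 h2; apply/andP; split; first by apply: le_trans h1; rewrite subr_ge0 dyad_le1.
  by apply: lt_trans h2 _; have := dyad_gt0 j.+1; lra.
move=> t0 t1.
have ex : exists j, dyad j.+1 < 1 - t.
  have : (fun j => dyad j) @ \oo --> (0 : R).
    rewrite (_ : (fun _ => _) = geometric 1 2^-1); last first.
      by apply/funext => j; rewrite /= mul1r.
    by apply: cvg_geometric; rewrite ger0_norm ?invr_ge0// invf_lt1// ltr1n.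
  move/cvgrPdist_lt => /(_ (1 - t)); rewrite subr_gt0 => /(_ t1)[N _ hN].
  exists N; have := hN N.+1 (leqnSn N) => /=.
  by rewrite sub0r normrN ger0_norm// ltW// dyad_gt0.
case: (ex_minnP ex) => j hj jmin; exists j => //; rewrite dyad_itvE; apply/andP; split; last lra.
case: j hj jmin => [|j] hj jmin; first by rewrite /dyad expr0; lra.
have [h|h] := ltP (dyad j.+1) (1 - t); last lra.
by have := jmin j h; rewrite ltnn.
Qed.

Lemma trivIset_dyad_itv : trivIset setT dyad_itv.
Proof.
apply/trivIsetP => i j _ _ ij; apply/seteqP; split => // t [].
wlog : i j ij / (i < j)%N => [h|{}ij].
  move: ij; rewrite neq_ltn => /orP[ij|ji].
    by apply: h => //; rewrite neq_ltn ij.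
  by move=> a1 a2; apply: (h j i) => //; rewrite neq_ltn ji.
rewrite !dyad_itvE => /andP[_ h1] /andP[h2 _].
by have := dyad_decr ij; lra.
Qed.

(** The mass of a dyadic piece is bounded by that of the whole tail from its left end, since tails
    are what a Carleson condition controls. The domain [D] is free so that the same lemma serves [0,
    1) and [t0, 1). *)
Lemma dyadic_integral (D : set (measurableTypeR R)) (phi : R -> R) (w c : nat -> R)
    (B : R) : measurable D -> D `<=` `[0, 1[ -> measurable_fun D phi ->
  (forall t, D t -> 0 <= phi t) ->
  (forall j t, D t -> dyad_itv j t -> phi t <= w j) ->
  (forall j, 0 <= w j) -> (forall j, 0 <= c j) ->
  (forall j, mu (D `&` `[(1 - dyad j)%R, 1%R[) <= (c j)%:E)%E ->
  (forall N, \sum_(j < N) w j * c j <= B) ->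
  (\int[mu]_(t in D) (phi t)%:E <= B%:E)%E.
Proof.
move=> mD D01 mphi phi0 phiw w0 c0 muc hB.
have mI j : measurable (dyad_itv j `&` D).
  by apply: measurableI => //; exact: measurable_itv.
have -> : D = \bigcup_j (dyad_itv j `&` D).
  by rewrite -setI_bigcupl bigcup_dyad_itv setIidr.
have DE : \bigcup_j (dyad_itv j `&` D) = D.
  by rewrite -setI_bigcupl bigcup_dyad_itv setIidr.
rewrite ge0_integral_bigcup//=; last 3 first.
- by rewrite DE; exact/measurable_EFinP.
- by rewrite DE => t Dt; rewrite lee_fin phi0.
- by apply: trivIset_setIr; exact: trivIset_dyad_itv.
have step j : (\int[mu]_(t in dyad_itv j `&` D) (phi t)%:E <= (w j * c j)%:E)%E.
  apply: (@le_trans _ _ (\int[mu]_(t in dyad_itv j `&` D) (cst (w j)%:E) t)%E).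
    apply: ge0_le_integral => //.
    - by move=> t [_ Dt]; rewrite lee_fin phi0.
    - by apply/measurable_EFinP; apply: measurable_funS mphi.
    - by move=> t [It Dt]; rewrite lee_fin phiw.
  rewrite integral_cst// EFinM lee_pmul// ?lee_fin//.
  apply: le_trans (muc j); apply: le_measure; rewrite ?inE//.
    by apply: measurableI => //; exact: measurable_itv.
  move=> t [It Dt]; split=> //=; move: It; rewrite dyad_itvE /= in_itv /= => /andP[-> h] /=.
  by apply: lt_trans h _; have := dyad_gt0 j.+1; lra.
apply: lime_le.
  by apply: is_cvg_nneseries => j _ _; apply: integral_ge0 => t [_ Dt]; rewrite lee_fin phi0.
apply: nearW => N; rewrite big_mkord; apply: (@le_trans _ _ (\sum_(j < N) (w j * c j)%:E)%E).
  by apply: lee_sum => j _; exact: step.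
by rewrite sumEFin lee_fin.
Qed.

(** Comparison with int_0^1 (1 - s) s^n ds = 1/((n+1)(n+2)), handled through the primitive [G]. From
    1 - 2^-(j+1) to 1 - 2^-(j+2), an interval of length 2^-j/4, the integrand is at least (2^-j/4)
    (1 - 2^-(j+1))^n; hence the factor 16. The interval is the one after the j-th piece because the
    summand takes t^n at the right end of that piece. *)
Lemma expr_onem_sum_le n N :
  \sum_(j < N) dyad j ^+ 2 * (1 - dyad j.+1) ^+ n <= 16 / (n.+1%:R * n.+2%:R).
Proof.
have dX m s : is_derive s 1 (fun t : R => t ^+ m) (m%:R * s ^+ m.-1).
  have := derivableP (@exprn_derivable R m s 1).
  by rewrite -derive1E exp_derive1.
pose G s : R := n.+1%:R^-1 * s ^+ n.+1 - n.+2%:R^-1 * s ^+ n.+2.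
have dG s : is_derive s 1 G ((1 - s) * s ^+ n).
  apply: is_derive_eq (is_deriveB (is_deriveZ n.+1%:R^-1 (dX n.+1 s))
    (is_deriveZ n.+2%:R^-1 (dX n.+2 s))) _.
  rewrite /GRing.scale /= !mulKf ?pnatr_eq0// exprS; ring.
have Gab x y : 0 <= x -> x <= y -> y <= 1 -> (y - x) * (1 - y) * x ^+ n <= G y - G x.
  move=> x0 xy y1.
  pose g t := G t - ((1 - y) * x ^+ n) * t.
  suff : g x <= g y by rewrite /g; lra.
  apply: (@ler_is_derive _ g (fun t => (1 - t) * t ^+ n - (1 - y) * x ^+ n)) => // t xty.
    apply: is_derive_eq (is_deriveB (dG t) (is_deriveZ ((1 - y) * x ^+ n) (is_derive_id t (1 : R)))) _.
    by rewrite /GRing.scale /= mulr1.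
  case/andP: xty => xt ty; rewrite subr_ge0 ler_pM ?exprn_ge0 ?subr_ge0//.
    by rewrite lerD2l lerN2.
  by rewrite lerXn2r ?nnegrE ?(le_trans x0).
have d01 j : 0 <= 1 - dyad j by rewrite subr_ge0 dyad_le1.
have d1 j : 1 - dyad j <= 1 by rewrite gerBl ltW// dyad_gt0.
have G1 s : 0 <= s -> s <= 1 -> G s <= (n.+1%:R * n.+2%:R)^-1.
  move=> s0 s1; have -> : (n.+1%:R * n.+2%:R)^-1 = G 1.
    rewrite /G !expr1n !mulr1 -[n.+2%:R]natr1; have : n.+1%:R + 1 != 0 :> R by rewrite natr1 pnatr_eq0.
    by have : n.+1%:R != 0 :> R by []; move=> ? ?; field; apply/andP.
  rewrite -subr_ge0; apply: le_trans (Gab _ _ s0 s1 (lexx _)).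
  by rewrite subrr mulr0 mul0r.
have G0 s : 0 <= s -> s <= 1 -> 0 <= G s.
  move=> s0 s1; have -> : 0 = G 0 by rewrite /G !expr0n /= !mulr0 subrr.
  rewrite -subr_ge0; apply: le_trans (Gab _ _ (lexx _) s0 s1).
  by rewrite !mulr_ge0 ?subr_ge0// exprn_ge0.
apply: (@le_trans _ _ (16 * (G (1 - dyad N.+1) - G (1 - dyad 1)))); last first.
  rewrite ler_wpM2l// lerBlDr (le_trans (G1 _ (d01 N.+1) (d1 N.+1)))//.
  by rewrite lerDl G0.
elim: N => [|N IH]; first by rewrite big_ord0 subrr mulr0.
rewrite big_ord_recr /=.
have := Gab (1 - dyad N.+1) (1 - dyad N.+2) (d01 _) _ (d1 _).
have -> : 1 - dyad N.+2 - (1 - dyad N.+1) = dyad N / 4 by rewrite !dyadS; field.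
have -> : 1 - (1 - dyad N.+2) = dyad N / 4 by rewrite !dyadS; field.
have -> : 1 - dyad N.+1 <= 1 - dyad N.+2.
  by rewrite lerD2l lerN2 dyad_decr.
move=> /(_ isT).
have -> : dyad N / 4 * (dyad N / 4) * (1 - dyad N.+1) ^+ n =
   (dyad N ^+ 2 * (1 - dyad N.+1) ^+ n) / 16 by field.
by move: IH; lra.
Qed.

End dyadic.

(** * Gamma quotients *)

Section gamma.
Context {R : realType}.
Implicit Types (x p t K : R).

Local Notation gi p := (fun t : R => t `^ p * expR (- t)).
Local Notation eh K := (fun t : R => K * expR (- (t / 2))).

(** Exponentiated form of ln x <= x at x = t/(2 p). *)
Lemma gamma_integrand_le p t : 0 < p -> 0 < t ->
  t `^ p * expR (- t) <= (2 * p) `^ p * expR (- (t / 2)).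
Proof.
move=> p0 t0; have p20 : 0 < 2 * p by rewrite mulr_gt0.
rewrite -ler_pdivlMr ?expR_gt0// -mulrA -expRB.
rewrite (_ : - (t / 2) - - t = t / 2); last by field.
have -> : t = (t / (2 * p)) * (2 * p) by rewrite divfK// gt_eqF.
rewrite powRM ?divr_ge0 ?(ltW t0) ?(ltW p20)// [leLHS]mulrC ler_wpM2l ?powR_ge0//.
rewrite {1}/powR gt_eqF ?divr_gt0// ler_expR.
rewrite (_ : t / (2 * p) * (2 * p) / 2 = p * (t / (2 * p))); last by field; rewrite gt_eqF.
by rewrite ler_pM2l// ltW// ln_sublinear// divr_gt0.
Qed.

Lemma is_derive_exp_half K t : is_derive t 1 (eh K) (- 2^-1 * (K * expR (- (t / 2)))).
Proof.
have d1 : is_derive t 1 (fun t : R => - (t / 2)) (- 2^-1).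
  have := is_deriveZ (- 2^-1 : R) (is_derive_id t (1 : R)).
  rewrite /GRing.scale /= mulr1 (_ : _ \*: id = fun t => - (t / 2))//.
  by apply/funext => s /=; rewrite /GRing.scale /= mulNr mulrC.
have d2 := @is_derive1_comp _ expR (fun t => - (t / 2)) t _ _ (is_derive_expR _) d1.
apply: is_derive_eq (is_deriveZ K d2) _.
by rewrite /GRing.scale /=; ring.
Qed.

Lemma is_derive_gamma_integrand p t : 0 < t ->
  is_derive t 1 (gi p) (p * (t `^ (p - 1) * expR (- t)) - t `^ p * expR (- t)).
Proof.
move=> t0.
have d1 : is_derive t 1 (fun t : R => - t) (-1 : R) by exact: is_deriveNid.
have d2 := @is_derive1_comp _ expR (fun t => - t) t _ _ (is_derive_expR _) d1.
apply: is_derive_eq (is_deriveM (is_derive1_powR p t0) d2) _.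
by rewrite /GRing.scale /=; ring.
Qed.

Lemma exp_half_cvgy K : eh K t @[t --> +oo] --> 0.
Proof.
rewrite -[X in _ --> X](mulr0 K); apply: cvgMr.
apply/cvgrPdist_le => e e0; near=> t.
rewrite sub0r normrN ger0_norm; last exact: expR_ge0.
rewrite expRN -[leRHS]invrK lef_pV2 ?posrE ?expR_gt0 ?invr_gt0//.
have th : (e^-1 - 1) * 2 <= t by near: t; apply: nbhs_pinfty_ge; exact: num_real.
by rewrite (le_trans _ (expR_ge1Dx _))// -lerBlDl ler_pdivlMr.
Unshelve. all: by end_near. Qed.

Lemma gamma_integrand_cvgy p : 0 < p -> gi p t @[t --> +oo] --> 0.
Proof.
move=> p0; apply: (@squeeze_cvgr _ _ _ _ (fun=> 0) (eh ((2 * p) `^ p))).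
- near=> s; have s0 : 0 < s by near: s; apply: nbhs_pinfty_gt; exact: num_real.
  by rewrite mulr_ge0 ?powR_ge0 ?expR_ge0//= gamma_integrand_le.
- exact: cvg_cst.
- exact: exp_half_cvgy.
Unshelve. all: by end_near. Qed.

Lemma exp_half_continuous K : continuous (eh K).
Proof.
move=> t; apply: differentiable_continuous; apply/derivable1_diffP.
by have [] := is_derive_exp_half K t.
Qed.

Lemma gamma_integrand_cvg0 p : 0 < p -> gi p t @[t --> 0^'+] --> gi p 0.
Proof.
move=> p0; apply: cvgM; first by rewrite powR0 ?gt_eqF//; exact: powR_cvg0.
apply: cvg_at_right_filter.
apply: (@continuous_comp _ _ _ (fun t : R => - t) expR); first exact: continuousN.
exact: continuous_expR.
Qed.

Lemma integral_exp_half K : 0 <= K ->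
  (\int[lebesgue_measure]_(t in `[0%R, +oo[) (eh K t)%:E = (2 * K)%:E)%E.
Proof.
move=> K0; rewrite (@ge0_continuous_FTC2y _ (eh K) (eh (- 2 * K)) 0 0).
- by rewrite mul0r oppr0 expR0 mulr1 sub0e -EFinN mulNr opprK.
- by move=> t _; rewrite mulr_ge0 ?expR_ge0.
- exact/continuous_subspaceT/exp_half_continuous.
- exact: exp_half_cvgy.
- by move=> t _; have [] := is_derive_exp_half (- 2 * K) t.
- by apply: cvg_at_right_filter; exact: exp_half_continuous.
- move=> t _; rewrite derive1E; have [_ ->] := is_derive_exp_half (- 2 * K) t.
  by field.
Qed.

Lemma gamma_integrand_measurable p : measurable_fun setT (gi p).
Proof.
apply: measurable_funM; first exact: measurable_powR.
by apply: measurableT_comp => //; exact: measurable_expR.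
Qed.

(** Integration by parts: x t^(x-1) e^(-t) - t^x e^(-t) is the derivative of t^x e^(-t), but it
    changes sign. Adding K e^(-t/2), which dominates t^x e^(-t), gives a nonnegative integrand [f]
    with primitive [F], as the fundamental theorem on a half-line requires. *)
Lemma gamma_integral_succ x : 1 < x ->
  (\int[lebesgue_measure]_(t in `]0%R, +oo[) (gi x t)%:E =
   x%:E * \int[lebesgue_measure]_(t in `]0%R, +oo[) (gi (x - 1) t)%:E)%E.
Proof.
move=> x1; have x0 : 0 < x by exact: lt_trans x1.
have x10 : 0 < x - 1 by rewrite subr_gt0.
have mg p (D : set (measurableTypeR R)) : measurable_fun D (fun t : R => (gi p t)%:E).
  by apply/measurable_EFinP; apply: measurable_funTS; exact: gamma_integrand_measurable.
have me K (D : set (measurableTypeR R)) : measurable_fun D (fun t : R => (eh K t)%:E).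
  apply/measurable_EFinP; apply: measurable_funTS.
  apply: measurable_funM => //; apply: measurableT_comp => //.
  apply: measurableT_comp => //; exact: measurable_funM.
rewrite !integral_itv_obnd_cbnd; [|exact: mg|exact: mg].
pose K := (2 * x) `^ x; have K0 : 0 <= K by exact: powR_ge0.
pose f t := x * gi (x - 1) t - gi x t + eh K t.
pose F t := gi x t - eh (2 * K) t.
have f0 t : 0 <= t -> 0 <= f t.
  rewrite le_eqVlt => /predU1P[<-|t0].
    by rewrite /f !powR0 ?gt_eqF// !mul0r mulr0 subrr add0r mulr_ge0 ?expR_ge0.
  rewrite /f -addrA addr_ge0//.
    by rewrite mulr_ge0 ?mulr_ge0 ?powR_ge0 ?expR_ge0// ltW.
  by rewrite addrC subr_ge0 gamma_integrand_le.
have dF t : 0 < t -> is_derive t 1 F (f t).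
  move=> t0; apply: is_derive_eq (is_deriveB (is_derive_gamma_integrand x t0)
    (is_derive_exp_half (2 * K) t)) _.
  by rewrite /f; field.
have F0 : F t @[t --> 0^'+] --> F 0.
  apply: cvgB; first exact: gamma_integrand_cvg0.
  by apply: cvg_at_right_filter; exact: exp_half_continuous.
have intf : (\int[lebesgue_measure]_(t in `[0%R, +oo[) (f t)%:E = (2 * K)%:E)%E.
  rewrite (@ge0_continuous_FTC2y _ f F 0 0).
  - by rewrite /F powR0 ?gt_eqF// !mul0r oppr0 expR0 mulr1 !sub0r -EFinN opprK add0e.
  - exact: f0.
  - apply/continuous_within_itvcyP; split.
      move=> t; rewrite in_itv /= andbT => t0.
      have c (g : R -> R) d : is_derive t 1 g d -> {for t, continuous g}.
        by move=> [dg _]; apply: differentiable_continuous; exact/derivable1_diffP.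
      apply: cvgD; last exact: exp_half_continuous.
      apply: cvgB; last exact: c (is_derive_gamma_integrand x t0).
      by apply: cvgMr; exact: c (is_derive_gamma_integrand (x - 1) t0).
    apply: cvgD; last by apply: cvg_at_right_filter; exact: exp_half_continuous.
    apply: cvgB; last exact: gamma_integrand_cvg0.
    by apply: cvgMr; exact: gamma_integrand_cvg0.
  - rewrite -[X in _ --> X](subrr 0); apply: cvgB; first exact: gamma_integrand_cvgy.
    exact: exp_half_cvgy.
  - by move=> t /dF[].
  - exact: F0.
  - by move=> t; rewrite in_itv /= andbT => /dF[_ <-]; rewrite derive1E.
(* All four summands are nonnegative, so both sides split; the integrals of [f] and of K e^(-t/2)
   both equal 2 K and cancel. *)
have : (\int[lebesgue_measure]_(t in `[0%R, +oo[) ((f t)%:E + (gi x t)%:E) =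
  \int[lebesgue_measure]_(t in `[0%R, +oo[) (x%:E * (gi (x - 1) t)%:E + (eh K t)%:E))%E.
  apply: eq_integral => t _; rewrite -EFinM -!EFinD; congr EFin.
  by rewrite /f; ring.
have gi0 p t : (0 <= (gi p t)%:E)%E by rewrite lee_fin mulr_ge0 ?powR_ge0 ?expR_ge0.
rewrite !ge0_integralD//; last 5 first.
- by move=> t _; rewrite mule_ge0// lee_fin ltW.
- by apply: measurable_funeM.
- by move=> t _; rewrite lee_fin mulr_ge0 ?expR_ge0.
- by move=> t; rewrite /= in_itv /= andbT => t0; rewrite lee_fin f0.
- apply/measurable_EFinP; apply: measurable_funD; last first.
    by apply/measurable_EFinP; exact: me.
  apply: measurable_funB; last by apply/measurable_EFinP; exact: mg.
  by apply: measurable_funM => //; apply/measurable_EFinP; exact: mg.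
rewrite ge0_integralZl ?lee_fin ?ltW// intf integral_exp_half//.
by rewrite addeC => /(congr1 (fun z => z - (2 * K)%:E)%E); rewrite !addeK.
Qed.

Lemma gamma_integral_fin_num p : 0 < p ->
  (\int[lebesgue_measure]_(t in `]0%R, +oo[) (gi p t)%:E)%E \is a fin_num.
Proof.
move=> p0; pose K := (2 * p) `^ p.
have me (D : set (measurableTypeR R)) : measurable_fun D (fun t : R => (eh K t)%:E).
  apply/measurable_EFinP; apply: measurable_funTS.
  apply: measurable_funM => //; apply: measurableT_comp => //.
  apply: measurableT_comp => //; exact: measurable_funM.
rewrite ge0_fin_numE; last first.
  by apply: integral_ge0 => t _; rewrite lee_fin mulr_ge0 ?powR_ge0 ?expR_ge0.
apply: (@le_lt_trans _ _ (2 * K)%:E); last by rewrite ltry.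
rewrite -(integral_exp_half (powR_ge0 _ _)) -integral_itv_obnd_cbnd; last exact: me.
apply: ge0_le_integral => //.
- by move=> t _; rewrite lee_fin mulr_ge0 ?powR_ge0 ?expR_ge0.
- by apply/measurable_EFinP; apply: measurable_funTS; exact: gamma_integrand_measurable.
- move=> t; rewrite /= in_itv /= andbT => t0.
  by rewrite lee_fin gamma_integrand_le.
Qed.

Lemma Gamma_succ x : 1 < x -> Gamma (x + 1) = x * Gamma x.
Proof.
move=> x1; rewrite /Gamma /Rintegral addrK gamma_integral_succ// fineM//.
by rewrite gamma_integral_fin_num// subr_gt0.
Qed.

Lemma Gamma_gt0 x : 1 < x -> 0 < Gamma x.
Proof.
move=> x1; have p0 : 0 < x - 1 by rewrite subr_gt0.
have fn := gamma_integral_fin_num p0.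
rewrite /Gamma /Rintegral fine_gt0//; apply/andP; split; last first.
  by rewrite ltey_eq fn.
pose D : set (measurableTypeR R) := `[1%R, 2%R].
have mD : measurable D by exact: measurable_itv.
have mg (E : set (measurableTypeR R)) : measurable_fun E (fun t : R => (gi (x - 1) t)%:E).
  by apply/measurable_EFinP; apply: measurable_funTS; exact: gamma_integrand_measurable.
apply: (@lt_le_trans _ _ (\int[lebesgue_measure]_(t in D) (cst (expR (- 2))%:E) t)%E).
  rewrite integral_cst//= /D lebesgue_measure_itv /= lte_fin ltr1n /=.
  by rewrite -EFinD -EFinM lte_fin mulr_gt0 ?expR_gt0//; lra.
apply: (@le_trans _ _ (\int[lebesgue_measure]_(t in D) (gi (x - 1) t)%:E)%E).
  apply: ge0_le_integral => //.
  - by move=> t _; rewrite lee_fin expR_ge0.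
  - move=> t; rewrite /D /= in_itv /= => /andP[t1 t2].
    rewrite lee_fin -[leLHS]mul1r ler_pM ?expR_ge0 ?ler_expR ?lerN2//.
    by have := ler_powR t1 (ltW p0); rewrite powRr0.
apply: ge0_subset_integral => //.
- by move=> t _; rewrite lee_fin mulr_ge0 ?powR_ge0 ?expR_ge0.
- move=> t; rewrite /D /= !in_itv /= andbT => /andP[t1 _].
  exact: lt_le_trans t1.
Qed.

(** Identifies the weights of [hankel_moment] with the coefficients of (1 - z)^(-a), after which
    Gamma disappears. *)
Lemma Gamma_ratio (a : R) n : 1 < a ->
  Gamma (n%:R + a) / (n`!%:R * Gamma a) = negbin a n.
Proof.
move=> a1; have G0 := Gamma_gt0 a1.
elim: n => [|n IH]; first by rewrite negbin0 add0r fact0 mul1r divff// gt_eqF.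
rewrite negbinS -IH -natr1 (_ : n%:R + 1 + a = n%:R + a + 1); last by ring.
rewrite Gamma_succ ?ltr_wpDl// factS natrM -natr1.
have h1 : n%:R + 1 != 0 :> R by rewrite natr1 pnatr_eq0.
have h2 : n`!%:R != 0 :> R by rewrite pnatr_eq0 -lt0n fact_gt0.
have h3 : Gamma a != 0 by rewrite gt_eqF.
by field; rewrite h1 h2 h3.
Qed.

End gamma.

(** * Carleson measures *)

Section carleson_integrals.
Context {R : realType}.
Variable mu : {measure set (measurableTypeR R) -> \bar R}.
Implicit Types (s t b M : R).

(** The Carleson condition near 1 only, with its constant displayed: a vanishing Carleson measure
    satisfies it with any positive constant once t0 is close to 1. *)
Definition tail_carleson t0 s M := forall t, t0 <= t < 1 ->
  (mu `[t, 1%R[ <= (M * (1 - t) `^ s)%:E)%E.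

Lemma ler_powRN (x y p : R) : 0 <= p -> 0 < x -> x <= y -> y `^ (- p) <= x `^ (- p).
Proof.
move=> p0 x0 xy; have y0 := lt_le_trans x0 xy.
rewrite !powRN lef_pV2 ?posrE ?powR_gt0//.
by apply: ge0_ler_powR => //; rewrite nnegrE ltW.
Qed.

Lemma tail_carleson_dyad t0 s M j : 0 <= t0 < 1 -> 0 <= s -> 0 <= M ->
  tail_carleson t0 s M ->
  (mu (`[t0, 1%R[ `&` `[(1 - dyad j)%R, 1%R[) <= (M * dyad j `^ s)%:E)%E.
Proof.
move=> /andP[t00 t01] s0 M0 mM.
pose t := Num.max t0 (1 - dyad j).
have t1 : t < 1 by rewrite gt_max t01 /= ltrBlDr ltrDl dyad_gt0.
rewrite (_ : `[t0, 1[ `&` `[1 - dyad j, 1[ = `[t, 1[%classic); last first.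
  apply/seteqP; split=> x; rewrite /= !in_itv /= ge_max.
    by move=> [/andP[-> ->] /andP[-> _]].
  by move=> /andP[/andP[-> ->] ->].
apply: le_trans (mM t _) _; first by rewrite t1 andbT le_max lexx.
rewrite lee_fin ler_wpM2l// ge0_ler_powR// ?nnegrE ?subr_ge0 ?(ltW t1)//.
  by rewrite ltW// dyad_gt0.
have : 1 - dyad j <= t by rewrite le_max lexx orbT.
lra.
Qed.

Lemma measurable_onem_powR (D : set (measurableTypeR R)) p :
  measurable_fun D (fun t : R => (1 - t) `^ p).
Proof.
apply: measurable_funTS; apply: (measurableT_comp (measurable_powR _)).
exact: measurable_funB.
Qed.

(** On the j-th piece the powers 1 - b and b + 1 of 2^-j multiply to 2^(-2 j), the weight summed by
    [expr_onem_sum_le]. The factor 2^(b-1) comes from taking (1 - t)^(1-b) at the right end of the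
    piece. *)
Lemma carleson_integral t0 b M n : 0 <= t0 < 1 -> 1 < b -> 0 <= M ->
  tail_carleson t0 (b + 1) M ->
  (\int[mu]_(t in `[t0, 1%R[) (t ^+ n * (1 - t) `^ (1 - b))%:E <=
    (M * (2 `^ (b - 1) * 16 / (n.+1%:R * n.+2%:R)))%:E)%E.
Proof.
move=> t001 b1 M0 mM; have /andP[t00 t01] := t001.
apply: (@dyadic_integral _ _ _ _
  (fun j => (1 - dyad j.+1) ^+ n * dyad j.+1 `^ (1 - b))
  (fun j => M * dyad j `^ (b + 1))).
- exact: measurable_itv.
- by move=> t; rewrite /= !in_itv /= => /andP[h ->]; rewrite (le_trans t00).
- apply: measurable_funM; last exact: measurable_onem_powR.
  by apply: measurable_funX.
- move=> t; rewrite /= in_itv /= => /andP[t0t t1].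
  by rewrite mulr_ge0 ?powR_ge0// exprn_ge0// (le_trans t00).
- move=> j t; rewrite /= in_itv /= => /andP[t0t t1].
  rewrite dyad_itvE => /andP[jt tj]; have tge0 := le_trans t00 t0t.
  rewrite ler_pM ?powR_ge0 ?exprn_ge0//.
    by rewrite lerXn2r ?nnegrE ?subr_ge0 ?dyad_le1// ltW.
  have -> : 1 - b = - (b - 1) by rewrite opprB.
  by apply: ler_powRN; rewrite ?dyad_gt0 ?subr_ge0 ?(ltW b1)//; lra.
- by move=> j; rewrite mulr_ge0 ?powR_ge0// exprn_ge0// subr_ge0 dyad_le1.
- by move=> j; rewrite mulr_ge0 ?powR_ge0.
- move=> j; apply: tail_carleson_dyad => //.
  by rewrite addr_ge0// ltW// (lt_trans _ b1).
- move=> N.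
  rewrite (eq_bigr (fun j : 'I_N => M * 2 `^ (b - 1) *
    (dyad j ^+ 2 * (1 - dyad j.+1) ^+ n))); last first.
    move=> j _.
    have -> : dyad j.+1 `^ (1 - b) = dyad j `^ (1 - b) * 2 `^ (b - 1) :> R.
      rewrite dyadS powRM ?invr_ge0 ?dyad_ge0//; congr (_ * _).
      by rewrite -powR_inv1// -powRrM; congr (_ `^ _); ring.
    have -> : dyad j ^+ 2 = dyad j `^ (1 - b) * dyad j `^ (b + 1) :> R.
      rewrite -powRD; last by rewrite (gt_eqF (dyad_gt0 _)) implybT.
      by rewrite -powR_mulrn ?dyad_ge0//; congr (_ `^ _); ring.
    ring.
  rewrite -mulr_sumr -[leLHS]mulrA.
  rewrite ler_wpM2l// -mulrA ler_wpM2l ?powR_ge0//.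
  exact: expr_onem_sum_le.
Qed.

(** The exponent -b is that of the bound for sum_k |a_k| t^k. One factor 2^-j is left on each piece,
    and its geometric series gives the last 2. *)
Lemma carleson_integral_inv b M : 1 < b -> 0 <= M ->
  tail_carleson 0 (b + 1) M ->
  (\int[mu]_(t in `[0%R, 1%R[) ((1 - t) `^ (- b))%:E <= (M * (2 `^ b * 2))%:E)%E.
Proof.
move=> b1 M0 mM; have b0 : 0 <= b by rewrite ltW// (lt_trans _ b1).
apply: (@dyadic_integral _ _ _ _ (fun j => dyad j.+1 `^ (- b))
  (fun j => M * dyad j `^ (b + 1))).
- exact: measurable_itv.
- by [].
- exact: measurable_onem_powR.
- by move=> t _; rewrite powR_ge0.
- move=> j t _; rewrite dyad_itvE => /andP[jt tj].
  by apply: ler_powRN; rewrite ?dyad_gt0//; lra.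
- by move=> j; exact: powR_ge0.
- by move=> j; rewrite mulr_ge0 ?powR_ge0.
- by move=> j; apply: tail_carleson_dyad; rewrite ?lexx ?ltr01 ?addr_ge0.
- move=> N.
  rewrite (eq_bigr (fun j : 'I_N => M * 2 `^ b * dyad j)); last first.
    move=> j _.
    have -> : dyad j.+1 `^ (- b) = dyad j `^ (- b) * 2 `^ b :> R.
      rewrite dyadS powRM ?invr_ge0 ?dyad_ge0//; congr (_ * _).
      by rewrite -powR_inv1// -powRrM; congr (_ `^ _); ring.
    have {3}-> : dyad j = dyad j `^ (- b) * dyad j `^ (b + 1) :> R.
      rewrite -powRD; last by rewrite (gt_eqF (dyad_gt0 _)) implybT.
      by rewrite -[LHS]powRr1 ?dyad_ge0//; congr (_ `^ _); ring.
    ring.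
  rewrite -mulr_sumr -[leLHS]mulrA ler_wpM2l// ler_wpM2l ?powR_ge0//.
  suff -> : \sum_(j < N) dyad j = 2 - 2 * dyad N :> R by rewrite gerBl mulr_ge0// dyad_ge0.
  elim: N => [|N IH]; first by rewrite big_ord0 /dyad expr0 mulr1 subrr.
  by rewrite big_ord_recr /= IH dyadS; field.
Qed.

End carleson_integrals.

(** * Coefficients of Hankel images *)

Section moment_sums.
Context {R : realType}.
Local Notation C := (cplx R).
Variable mu : {measure set (measurableTypeR R) -> \bar R}.
Implicit Types (s t b M : R) (a : nat -> C).

Definition moment m : \bar R := (\int[mu]_(t in `[0%R, 1%R[) (t ^+ m)%:E)%E.

Local Notation I01 := (`[0%R, 1%R[%classic : set (measurableTypeR R)).

Lemma in_I01 t : I01 t -> 0 <= t /\ t < 1.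
Proof. by rewrite /= in_itv /= => /andP. Qed.

Lemma measurable_I01 : measurable I01.
Proof. exact: measurable_itv. Qed.

Lemma measurable_monomial (D : set (measurableTypeR R)) (c : R) m :
  measurable_fun D (fun t : R => (c * t ^+ m)%:E).
Proof.
by apply/measurable_EFinP; apply: measurable_funM => //; exact: measurable_funX.
Qed.

Lemma integral_monomial (c : R) m : 0 <= c ->
  (\int[mu]_(t in I01) (c * t ^+ m)%:E = c%:E * moment m)%E.
Proof.
move=> c0; under eq_integral do rewrite EFinM.
rewrite ge0_integralZl ?lee_fin//.
  by apply/measurable_EFinP; exact: measurable_funX.
by move=> t /in_I01[t0 _]; rewrite lee_fin exprn_ge0.
Qed.

Lemma integral_polynomial (c : nat -> R) n K : (forall k, 0 <= c k) ->
  (\int[mu]_(t in I01) (\sum_(k < K) c k * t ^+ (n + k))%:E =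
   \sum_(k < K) (c k)%:E * moment (n + k))%E.
Proof.
move=> c0; under eq_integral do rewrite -sumEFin.
rewrite ge0_integral_sum//.
- by apply: eq_bigr => k _; exact: integral_monomial.
- by move=> k; exact: measurable_monomial.
- by move=> k t /in_I01[t0 _]; rewrite lee_fin mulr_ge0 ?exprn_ge0.
Qed.

Lemma moment_ge0 m : (0 <= moment m)%E.
Proof.
by apply: integral_ge0 => t /in_I01[t0 _]; rewrite lee_fin exprn_ge0.
Qed.

Lemma le_moment n k : (moment (n + k) <= moment k)%E.
Proof.
apply: ge0_le_integral.
- exact: measurable_I01.
- by move=> t /in_I01[t0 _]; rewrite lee_fin exprn_ge0.
- by apply/measurable_EFinP; exact: measurable_funX.
- by apply/measurable_EFinP; exact: measurable_funX.
- move=> t /in_I01[t0 t1]; rewrite lee_fin exprD ler_piMl ?exprn_ge0//.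
  by rewrite exprn_ile1// ltW.
Qed.

Lemma moment0 : moment 0 = mu I01.
Proof.
rewrite /moment (_ : (fun t : R => _) = cst 1%E); last first.
  by apply/funext => t; rewrite expr0.
by rewrite integral_cst ?mul1e//; exact: measurable_I01.
Qed.

Lemma moment_fin_num k : (mu I01 < +oo)%E -> moment k \is a fin_num.
Proof.
move=> mufin; rewrite ge0_fin_numE ?moment_ge0//.
by have := le_moment k 0; rewrite addn0 => /le_lt_trans; apply; rewrite moment0.
Qed.

Lemma PS_tail_le a t K : disc_majorized a -> I01 t ->
  ((cabs (PS a t%:C - power_series a t%:C K))%:E <=
   \sum_(0 <= k <oo) (cabs (a (K + k)%N) * t ^+ (K + k))%:E)%E.
Proof.
move=> am /in_I01[t0 t1].
have dt : disc (t%:C : C) by rewrite discE cabsR ger0_norm.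
have u0 k : (0 <= (cabs (a (K + k)%N) * t ^+ (K + k))%:E)%E.
  by rewrite lee_fin mulr_ge0 ?cabs_ge0 ?exprn_ge0.
have le N : ((\sum_(0 <= k < N) cabs (a (K + k)%N) * t ^+ (K + k))%:E <=
   \sum_(0 <= k <oo) (cabs (a (K + k)%N) * t ^+ (K + k))%:E)%E.
  by rewrite -sumEFin; apply: nneseries_lim_ge.
move: le; case: (\sum_(0 <= k <oo) _)%E => [r| |]; last 2 first.
- by rewrite leey.
- by move=> /(_ 0%N); rewrite big_geq.
move=> le; rewrite lee_fin.
apply: (@cabs_cvg_le _ (fun n => power_series a t%:C n - power_series a t%:C K)).
  by apply: cvgB; [exact: PS_cvg|exact: cvg_cst].
near=> n; have Kn : (K <= n)%N by near: n; exact: nbhs_infty_ge.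
rewrite /power_series /series /= (big_cat_nat (leq0n K) Kn) /= addrAC subrr add0r.
apply: le_trans (ler_cabs_sum _ _ _) _.
apply: (@le_trans _ _ (\sum_(0 <= k < n - K) cabs (a (K + k)%N) * t ^+ (K + k))).
  rewrite -{1}[K]add0n big_addn le_eqVlt; apply/orP; left; apply/eqP.
  apply: eq_bigr => k _; rewrite cabsM cabsX cabsR ger0_norm//.
  by rewrite addnC.
by have := le (n - K)%N; rewrite lee_fin.
Unshelve. all: by end_near. Qed.

(* The real parts Re (v a_k) have varying signs; adding |a_k| - Re (v a_k) >= 0 on
   both sides keeps every integrand nonnegative. *)
Lemma moment_sum_bound a (F : R -> R) n (W : R) : (mu I01 < +oo)%E ->
  disc_majorized a -> measurable_fun I01 F ->
  (forall t, I01 t -> cabs (PS a t%:C) <= F t) ->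
  cvgn (series (fun k => cabs (a k) * fine (moment k))) ->
  (\int[mu]_(t in I01) (t ^+ n * F t)%:E <= W%:E)%E ->
  exists2 l : C, series (fun k => (fine (moment (n + k)))%:C * a k) @ \oo --> l &
    cabs l <= W.
Proof.
move=> mufin am mF aF cM intF.
have mfin k : moment k \is a fin_num by exact: moment_fin_num.
have m0 k : 0 <= fine (moment k) by rewrite fine_ge0// moment_ge0.
have mm k : fine (moment (n + k)) <= fine (moment k).
  by rewrite fine_le// le_moment.
have [|l sl _] := @series_dominated _ (fun k => (fine (moment (n + k)))%:C * a k)
    (fun k => cabs (a k) * fine (moment k)) _ cM.
  by move=> k; rewrite cabsM cabsR ger0_norm// mulrC ler_wpM2l ?cabs_ge0.
exists l => //.
have [v v1 vl] := cabs_Re_phase l.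
set L := limn (series (fun k => cabs (a k) * fine (moment k))) in cM *.
pose x k := complex.Re (v * a k).
pose y k := cabs (a k) - x k.
have y0 k : 0 <= y k.
  rewrite subr_ge0; apply: le_trans (ler_norm _) _.
  by apply: le_trans (ler_Re_cabs _) _; rewrite cabsM v1 mul1r.
have F0 t : I01 t -> 0 <= F t.
  by move=> It; apply: le_trans (aF _ It); exact: cabs_ge0.
(* The partial sum exceeds W by at most the tail of a convergent series, which vanishes as K grows.
   That tail comes from integrating termwise the remainder of sum_k |a_k| t^k. *)
have key K : \sum_(k < K) x k * fine (moment (n + k)) <=
    W + (L - series (fun k => cabs (a k) * fine (moment k)) K).
  pose tl t := (\sum_(0 <= k <oo) (cabs (a (K + k)%N) * t ^+ (K + k))%:E)%E.
  have tlm : measurable_fun I01 tl.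
    apply: ge0_emeasurable_sum => [k t It _|k _].
      by have [t0 _] := in_I01 It; rewrite lee_fin mulr_ge0 ?cabs_ge0 ?exprn_ge0.
    exact: measurable_monomial.
  have tl0 t : I01 t -> (0 <= tl t)%E.
    move=> /in_I01[t0 _]; apply: nneseries_ge0 => k _ _.
    by rewrite lee_fin mulr_ge0 ?cabs_ge0 ?exprn_ge0.
  have inttl : (\int[mu]_(t in I01) tl t <=
      (L - series (fun k => cabs (a k) * fine (moment k)) K)%:E)%E.
    rewrite integral_nneseries; last 3 first.
    - exact: measurable_I01.
    - by move=> k; exact: measurable_monomial.
    - by move=> k t /in_I01[t0 _]; rewrite lee_fin mulr_ge0 ?cabs_ge0 ?exprn_ge0.
    apply: lime_le.
      apply: is_cvg_nneseries => k _ _; apply: integral_ge0 => t /in_I01[t0 _].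
      by rewrite lee_fin mulr_ge0 ?cabs_ge0 ?exprn_ge0.
    apply: nearW => N.
    under eq_bigr do rewrite integral_monomial ?cabs_ge0// -(fineK (mfin _)) -EFinM.
    rewrite sumEFin lee_fin lerBrDl.
    have -> : series (fun k => cabs (a k) * fine (moment k)) K +
        \sum_(0 <= k < N) cabs (a (K + k)%N) * fine (moment (K + k)) =
        series (fun k => cabs (a k) * fine (moment k)) (K + N).
      rewrite /series /= (big_cat_nat (leq0n K) (leq_addr N K)) /=; congr (_ + _).
      apply/esym; rewrite -{1}[K]add0n big_addn addKn; apply: eq_bigr => k _.
      by rewrite addnC.
    apply: nondecreasing_cvgn_le => //; apply/nondecreasing_seqP => k.
    by rewrite /series /= big_nat_recr //= lerDl mulr_ge0 ?cabs_ge0.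
  have intp (c : nat -> R) : (forall k, 0 <= c k) ->
      (\int[mu]_(t in I01) (\sum_(k < K) c k * t ^+ (n + k))%:E =
      (\sum_(k < K) c k * fine (moment (n + k)))%:E)%E.
    move=> c0; rewrite integral_polynomial// -sumEFin; apply: eq_bigr => k _.
    by rewrite EFinM fineK.
  have psum (c : nat -> R) : measurable_fun I01 (fun t : R => (\sum_(k < K) c k * t ^+ (n + k))%:E).
    apply/measurable_EFinP; apply: measurable_sum => k.
    by apply: measurable_funM => //; exact: measurable_funX.
  have p0 (c : nat -> R) t : (forall k, 0 <= c k) -> I01 t ->
      (0 <= (\sum_(k < K) c k * t ^+ (n + k))%:E)%E.
    move=> c0 /in_I01[t0 _]; rewrite lee_fin sumr_ge0// => k _.
    by rewrite mulr_ge0 ?exprn_ge0.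
  have mtF : measurable_fun I01 (fun t : R => (t ^+ n * F t)%:E).
    by apply/measurable_EFinP; apply: measurable_funM => //; exact: measurable_funX.
  have tF0 t : I01 t -> (0 <= (t ^+ n * F t)%:E)%E.
    by move=> It; have [t0 _] := in_I01 It; rewrite lee_fin mulr_ge0 ?exprn_ge0 ?F0.
  have : (\int[mu]_(t in I01) (\sum_(k < K) cabs (a k) * t ^+ (n + k))%:E <=
     \int[mu]_(t in I01) ((\sum_(k < K) y k * t ^+ (n + k))%:E + ((t ^+ n * F t)%:E + tl t)))%E.
    apply: ge0_le_integral.
    - exact: measurable_I01.
    - by move=> t; apply: (p0 (fun k => cabs (a k))) => k; exact: cabs_ge0.
    - exact: (psum (fun k => cabs (a k))).
    - by apply: emeasurable_funD => //; exact: emeasurable_funD.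
    - move=> t It; have [t0 t1] := in_I01 It.
      have := @PS_tail_le a t K am It; rewrite -/(tl t).
      move=> h; apply: le_trans (leeD2l _ (leeD2l _ h)).
      rewrite -!EFinD lee_fin -lerBlDl -sumrB.
      under eq_bigr => k _ do rewrite -mulrBl opprB addrC subrK exprD mulrCA.
      rewrite -mulr_sumr.
      have -> : \sum_(k < K) x k * t ^+ k = complex.Re (v * power_series a t%:C K).
        rewrite /power_series /series /= big_mkord mulr_sumr Re_sum.
        apply: eq_bigr => k _; rewrite -real_complexX mulrA [_ * _%:C]mulrC Re_realM.
        by rewrite mulrC.
      have tn1 : t ^+ n <= 1 by rewrite exprn_ile1// ltW.
      apply: (@le_trans _ _ (t ^+ n * (F t + cabs (PS a t%:C - power_series a t%:C K)))).
        rewrite ler_wpM2l ?exprn_ge0//; apply: le_trans (ler_norm _) _.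
        apply: le_trans (ler_Re_cabs _) _; rewrite cabsM v1 mul1r.
        have := ler_cabsB (PS a t%:C) (PS a t%:C - power_series a t%:C K).
        rewrite opprB [X in cabs X <= _]addrC subrK => /le_trans; apply.
        by rewrite lerD2r aF.
      by rewrite mulrDr lerD2l ler_piMl ?cabs_ge0.
  rewrite ge0_integralD; last 5 first.
  - exact: measurable_I01.
  - by move=> t; exact: (p0 y).
  - exact: (psum y).
  - by move=> t It; rewrite adde_ge0 ?tF0 ?tl0.
  - exact: emeasurable_funD.
  rewrite ge0_integralD//.
  rewrite (intp y)// (intp (fun k => cabs (a k))); last by move=> k; exact: cabs_ge0.
  move=> h; have := le_trans h (leeD2l _ (leeD intF inttl)).
  rewrite -!EFinD lee_fin -lerBlDl -sumrB.
  by under eq_bigr => k _ do rewrite -mulrBl opprB addrC subrK.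
have e1 : (fun K => \sum_(k < K) x k * fine (moment (n + k))) @ \oo --> cabs l.
  have vs : (fun K => v * series (fun k => (fine (moment (n + k)))%:C * a k) K) @ \oo -->
      v * l by exact: cvgMr.
  rewrite -vl; have := cvg_ReP vs.
  rewrite (_ : (fun K => complex.Re _) = (fun K => \sum_(k < K) x k * fine (moment (n + k))))//.
  apply/funext => K; rewrite /series /= big_mkord mulr_sumr Re_sum; apply: eq_bigr => k _.
  by rewrite mulrCA Re_realM mulrC.
have e2 : (fun K => W + (L - series (fun k => cabs (a k) * fine (moment k)) K)) @ \oo --> W + (L - L).
  by apply: cvgD; [exact: cvg_cst|apply: cvgB; [exact: cvg_cst|exact: cM]].
rewrite subrr addr0 in e2.
by apply: (ler_cvg_to e1 e2); apply: nearW.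
Qed.

End moment_sums.

(** * Comparison with powers of 1 - z *)

Section negbin_majorized.
Context {R : realType}.
Local Notation C := (cplx R).
Implicit Types (p K W alpha : R) (a b : nat -> C).

Lemma PS_negbin_le a K p : 0 < p -> (forall n, cabs (a n) <= K * negbin p n) ->
  disc_majorized a /\
  forall z : C, disc z -> cabs (PS a z) <= K * (1 - cabs z) `^ (- p).
Proof.
move=> p0 aK.
have K0 : 0 <= K.
  by have := aK 0%N; rewrite negbin0 mulr1; apply: le_trans; exact: cabs_ge0.
have cK r : 0 <= r < 1 ->
    series (fun n => K * (negbin p n * r ^+ n)) @ \oo --> K * (1 - r) `^ (- p).
  move=> r01; rewrite (_ : series _ =
      fun N => K * series (fun n => negbin p n * r ^+ n) N).
    by apply: cvgMr; exact: binomial_series.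
  by apply/funext => N; rewrite /series /= mulr_sumr.
have le r : 0 <= r < 1 -> forall n, cabs (a n) * r ^+ n <= K * (negbin p n * r ^+ n).
  by move=> /andP[r0 _] n; rewrite mulrA ler_wpM2r ?exprn_ge0.
have am : disc_majorized a.
  move=> r r01; have /andP[r0 _] := r01.
  apply: (series_le_cvg _ _ (le r r01)).
  - by move=> n; rewrite mulr_ge0 ?cabs_ge0 ?exprn_ge0.
  - by move=> n; rewrite !mulr_ge0 ?exprn_ge0// ltW// negbin_gt0.
  - by apply/cvg_ex; eexists; exact: cK r01.
split=> // z z1; apply: le_trans (PS_le am z1) _.
have z01 : 0 <= cabs z < 1 by rewrite cabs_ge0.
rewrite -(cvg_lim (@norm_hausdorff _ R) (cK _ z01)).
apply: ler_lim; [exact: am|by apply/cvg_ex; eexists; exact: cK z01|].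
by apply: nearW => N; apply: ler_sum => n _; exact: le.
Qed.

(** Differentiation raises the exponent alpha to alpha + 1, and 1/((n+2)(n+3)) lowers it by two: the
    excess (alpha + n)(alpha - 1 + n)/(alpha - 1) over the coefficients for alpha - 1 is at most
    alpha^2 (n+2)(n+3)/(alpha - 1). The power of 2 comes from 1 - |z|^2 <= 2 (1 - |z|). *)
Lemma bloch_norm_hankel_type alpha W b (h : C -> C) : 1 < alpha ->
  (forall n, cabs (b n) <= negbin alpha n * (W / (n.+1%:R * n.+2%:R))) ->
  (forall z, disc z -> h z = PS b z) ->
  analytic_on_disc h /\
  (bloch_norm (alpha - 1) h <=
   (W * (1 + alpha ^+ 2 / (alpha - 1) * 2 `^ (alpha - 1)))%:E)%E.
Proof.
move=> a1 bW hE.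
have a0 : 0 < alpha by exact: lt_trans a1.
have a10 : 0 < alpha - 1 by rewrite subr_gt0.
have W0 : 0 <= W.
  have := bW 0%N; rewrite negbin0 mul1r => /(le_trans (cabs_ge0 _)).
  by rewrite mul1r pmulr_lge0// invr_gt0.
have Wn n : W / (n.+1%:R * n.+2%:R) <= W.
  rewrite ler_piMr// invf_le1; last by rewrite mulr_gt0.
  by rewrite -natrM ler1n.
have [bm _] : disc_majorized b /\
    forall z : C, disc z -> cabs (PS b z) <= W * (1 - cabs z) `^ (- alpha).
  apply: PS_negbin_le => // n; apply: le_trans (bW n) _.
  by rewrite mulrC ler_wpM2r// ltW// negbin_gt0.
have ha := analytic_PS bm hE.
split=> //.
pose K := W * (alpha ^+ 2 / (alpha - 1)).
have [_ db] : disc_majorized (deriv_coef b) /\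
    forall z : C, disc z -> cabs (PS (deriv_coef b) z) <=
      K * (1 - cabs z) `^ (- (alpha - 1)).
  apply: PS_negbin_le => // n.
  rewrite /deriv_coef -mulr_natr cabsM cabs_nat.
  apply: (@le_trans _ _ (n.+1%:R * (negbin alpha n.+1 * (W / (n.+2%:R * n.+3%:R))))).
    by rewrite mulrC ler_wpM2l.
  rewrite mulrA negbin_deriv negbin_succ.
  have -> : negbin alpha n = negbin (alpha - 1) n * (alpha - 1 + n%:R) / (alpha - 1).
    by rewrite -negbin_succ subrK [(alpha - 1) * _]mulrC mulfK// gt_eqF.
  have c0 : 0 < negbin (alpha - 1) n by exact: negbin_gt0.
  rewrite (_ : _ * _ * (W / _) = (W / (alpha - 1) * negbin (alpha - 1) n) *
    ((alpha - 1 + n%:R) * (alpha + n%:R) / (n.+2%:R * n.+3%:R))); last by ring.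
  rewrite (_ : K * _ = (W / (alpha - 1) * negbin (alpha - 1) n) * alpha ^+ 2);
    last by rewrite /K; ring.
  rewrite ler_wpM2l ?mulr_ge0 ?invr_ge0 ?(ltW c0) ?(ltW a10)//.
  rewrite ler_pdivrMr ?mulr_gt0// expr2 mulrACA.
  have n0 : 0 <= n%:R :> R by [].
  have h1 : alpha + n%:R <= alpha * n.+2%:R.
    by rewrite -addn2 natrD; nra.
  have h2 : alpha + n%:R <= alpha * n.+3%:R.
    by rewrite -addn3 natrD; nra.
  by rewrite ler_pM//; lra.
have K0 : 0 <= K by rewrite mulr_ge0// divr_ge0 ?sqr_ge0// ltW.
rewrite /bloch_norm mulrDr mulr1 EFinD leeD//.
  rewrite lee_fin hE ?PS0; last exact: disc0.
  by have := bW 0%N; rewrite negbin0 mul1r => /le_trans; apply.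
apply: ge_ereal_sup => _ [z z1 <-]; rewrite lee_fin mulrA -/K.
rewrite (derive1_PS bm hE z1).
have z1' : cabs z < 1 by [].
have z0 := cabs_ge0 z.
apply: (@le_trans _ _ ((1 - cabs z ^+ 2) `^ (alpha - 1) * (K * (1 - cabs z) `^ (- (alpha - 1))))).
  by rewrite ler_wpM2l ?powR_ge0 ?db.
rewrite mulrCA ler_wpM2l// powRN ler_pdivrMr ?powR_gt0 ?subr_gt0//.
rewrite -powRM ?subr_ge0 ?(ltW z1')//.
apply: ge0_ler_powR; first exact: ltW.
- by rewrite nnegrE subr_ge0 exprn_ile1// ltW.
- by rewrite nnegrE mulr_ge0// subr_ge0 ltW.
- rewrite -subr_ge0 (_ : _ - _ = (1 - cabs z) ^+ 2) ?sqr_ge0//; ring.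
Qed.

End negbin_majorized.

(** * Hankel images of functions of controlled growth *)

Section hankel_coefficients.
Context {R : realType}.
Local Notation C := (cplx R).
Variable mu : {measure set (measurableTypeR R) -> \bar R}.
Implicit Types (f : C -> C) (b alpha M : R).

Local Notation I01 := (`[0%R, 1%R[%classic : set (measurableTypeR R)).

Lemma hankel_momentE alpha n k : 1 < alpha ->
  hankel_moment mu alpha n k = ((negbin alpha n)%:E * moment mu (n + k))%E.
Proof.
move=> a1; rewrite /hankel_moment Gamma_ratio// integral_monomial//.
by rewrite ltW// negbin_gt0// (lt_trans _ a1).
Qed.

Lemma tail_carleson_fin s M : tail_carleson mu 0 s M -> (mu I01 < +oo)%E.
Proof.
move=> mM; apply: le_lt_trans (mM 0 _) _; last by rewrite ltry.
by rewrite lexx ltr01.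
Qed.

(** Cauchy's estimate on the circle of radius r = (1 + t)/2, summed as a geometric series of ratio
    t/r; 1 - t/r >= 1 - r because t <= r^2. Summing moduli costs one power of 1 - t compared with f
    itself. *)
Lemma coef_sum_le f b D t K : analytic_on_disc f -> 1 < b -> 0 <= D -> 0 <= t < 1 ->
  (forall z, disc z -> cabs (f z) <= D * (1 - cabs z) `^ (1 - b)) ->
  \sum_(k < K) cabs (coefs f k) * t ^+ k <= D * 2 `^ b * (1 - t) `^ (- b).
Proof.
move=> fa b1 D0 /andP[t0 t1] fD.
pose r := (1 + t) / 2.
have r0 : 0 < r by rewrite /r; lra.
have r1 : r < 1 by rewrite /r; lra.
have r1' : 0 < 1 - r by rewrite subr_gt0.
have rt : r - t = 1 - r by rewrite /r; field.
have q0 : 0 <= t / r by apply: divr_ge0 => //; exact: ltW.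
apply: (@le_trans _ _ (\sum_(k < K) D * (1 - r) `^ (1 - b) * (t / r) ^+ k)).
  apply: ler_sum => k _; rewrite (expr_div_n t r) mulrA ler_pdivlMr ?exprn_gt0//.
  rewrite mulrAC ler_wpM2r ?exprn_ge0//.
  apply: cauchy_estimate => //; first by rewrite r0.
  by move=> z zr; rewrite -zr fD// discE zr.
rewrite -mulr_sumr.
apply: (@le_trans _ _ (D * (1 - r) `^ (1 - b) * (1 - r)^-1)).
  rewrite ler_wpM2l ?mulr_ge0 ?powR_ge0//.
  rewrite -[leRHS]mul1r ler_pdivlMr//.
  apply: (@le_trans _ _ ((\sum_(k < K) (t / r) ^+ k) * (1 - t / r))).
    rewrite ler_wpM2l//; first by apply: sumr_ge0 => k _; exact: exprn_ge0.
    rewrite lerD2l lerN2 ler_pdivrMr// -subr_ge0.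
    have -> : r * r - t = ((1 - t) / 2) ^+ 2 by rewrite /r; field.
    exact: sqr_ge0.
  rewrite mulrC -[1 - _]opprB mulNr -subrX1 opprB gerBl exprn_ge0//.
rewrite -mulrA -mulrA ler_wpM2l// -(powR_inv1 (ltW r1')) -powRD; last first.
  by rewrite (gt_eqF r1') implybT.
have -> : 1 - b + -1 = - b by ring.
have -> : 1 - r = (1 - t) / 2 by rewrite /r; field.
rewrite powRM ?subr_ge0 ?(ltW t1)// mulrC -powR_inv1// -powRrM mulN1r opprK.
exact: lexx.
Qed.

(** Each growth bound of f is paired with a Carleson constant: D0, valid below t0, with M, and D1,
    used beyond t0, with e. Boundedness is the case t0 = 0, D0 = 0; compactness applies it to a
    difference f_n - g, with D0 and e both small. *)
Lemma hankel_main f alpha b t0 M e D0 D1 :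
  1 < alpha -> 1 < b -> 0 <= t0 < 1 -> 0 <= M -> 0 <= e -> 0 <= D0 -> 0 <= D1 ->
  tail_carleson mu 0 (b + 1) M -> tail_carleson mu t0 (b + 1) e ->
  analytic_on_disc f ->
  (forall z, disc z -> cabs (f z) <= D1 * (1 - cabs z) `^ (1 - b)) ->
  (forall t, 0 <= t < t0 -> cabs (f t%:C) <= D0 * (1 - t) `^ (1 - b)) ->
  [/\ hankel_defined mu alpha f, analytic_on_disc (hankel mu alpha f),
    (forall z, disc z -> hankel mu alpha f z = PS (hankel_coef mu alpha f) z) &
   (bloch_norm (alpha - 1) (hankel mu alpha f) <=
    ((D0 * M + D1 * e) * (2 `^ (b - 1) * 16) *
    (1 + alpha ^+ 2 / (alpha - 1) * 2 `^ (alpha - 1)))%:E)%E].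
Proof.
move=> a1 b1 t001 M0 e0 D00 D10 mM me fa fD1 fD0.
have /andP[t00 t01] := t001.
have mufin := tail_carleson_fin mM.
have am := coefs_majorized fa.
have mfin k : moment mu k \is a fin_num by exact: moment_fin_num.
(* Absolute convergence, without which the sum over k and the integral could not be exchanged:
   [coef_sum_le] is integrated against [mu]. *)
have cM : cvgn (series (fun k => cabs (coefs f k) * fine (moment mu k))).
  apply: nondecreasing_is_cvgn.
    apply/nondecreasing_seqP => k; rewrite /series /= big_nat_recr//= lerDl.
    by rewrite mulr_ge0 ?cabs_ge0// fine_ge0// moment_ge0.
  exists (D1 * 2 `^ b * (M * (2 `^ b * 2))) => _ [K _ <-].
  rewrite -lee_fin /series /= big_mkord -sumEFin.
  have -> : (\sum_(k < K) (cabs (coefs f k) * fine (moment mu k))%:E =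
      \int[mu]_(t in I01) (\sum_(k < K) cabs (coefs f k) * t ^+ (0 + k))%:E)%E.
    rewrite (@integral_polynomial R mu (fun k => cabs (coefs f k))).
      by apply: eq_bigr => k _; rewrite EFinM fineK.
    by move=> k; exact: cabs_ge0.
  rewrite EFinM; apply: le_trans (lee_wpmul2l _ (carleson_integral_inv b1 M0 mM)); last first.
    by rewrite lee_fin mulr_ge0 ?powR_ge0.
  rewrite -ge0_integralZl ?lee_fin ?mulr_ge0 ?powR_ge0//; last 2 first.
  - by apply/measurable_EFinP; exact: measurable_onem_powR.
  - by move=> t _; rewrite lee_fin powR_ge0.
  apply: ge0_le_integral => //.
  - move=> t /in_I01[tge0 _]; rewrite lee_fin sumr_ge0// => k _.
    by rewrite mulr_ge0 ?cabs_ge0 ?exprn_ge0.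
  - apply/measurable_EFinP; apply: measurable_sum => k.
    by apply: measurable_funM => //; exact: measurable_funX.
  - apply/measurable_EFinP; apply: measurable_funM => //.
    exact: measurable_onem_powR.
  - move=> t /in_I01[tge0 tlt1]; rewrite -EFinM lee_fin.
    by apply: coef_sum_le => //; rewrite tge0.
pose g (t : R) := (1 - t) `^ (1 - b).
(* The D0 term is not cut off at t0, so that its integral is the full one, bounded with M; only the
   D1 term is restricted to [t0, 1). *)
pose F t := D0 * g t + (if t0 <= t then D1 * g t else 0).
have mg (D : set (measurableTypeR R)) : measurable_fun D g by exact: measurable_onem_powR.
have mF2 (D : set (measurableTypeR R)) : measurable_fun D (fun t : R => if t0 <= t then D1 * g t else 0).
  apply: measurable_funTS; apply: measurable_fun_ifT => //.
    exact: measurable_fun_ler.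
  exact: measurable_funM.
have mF (D : set (measurableTypeR R)) : measurable_fun D F.
  by apply: measurable_funD => //; exact: measurable_funM.
have g0 t : 0 <= g t by exact: powR_ge0.
have aF t : I01 t -> cabs (PS (coefs f) t%:C) <= F t.
  move=> /in_I01[tge0 tlt1].
  have dt : disc (t%:C : C) by rewrite discE cabsR ger0_norm.
  rewrite -coefs_PS// /F; have [ht|ht] := leP t0 t.
    apply: (@le_trans _ _ (D1 * g t)); last by rewrite lerDr mulr_ge0.
    by have := fD1 _ dt; rewrite cabsR ger0_norm.
  by rewrite addr0 fD0// tge0.
have intF n : (\int[mu]_(t in I01) (t ^+ n * F t)%:E <=
   ((D0 * M + D1 * e) * (2 `^ (b - 1) * 16) / (n.+1%:R * n.+2%:R))%:E)%E.
  have -> : ((D0 * M + D1 * e) * (2 `^ (b - 1) * 16) / (n.+1%:R * n.+2%:R))%:E =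
     (D0%:E * (M * (2 `^ (b - 1) * 16 / (n.+1%:R * n.+2%:R)))%:E +
      D1%:E * (e * (2 `^ (b - 1) * 16 / (n.+1%:R * n.+2%:R)))%:E)%E.
    by rewrite -!EFinM -EFinD; congr EFin; ring.
  have mtg (D : set (measurableTypeR R)) : measurable_fun D (fun t : R => (t ^+ n * g t)%:E).
    by apply/measurable_EFinP; apply: measurable_funM => //; exact: measurable_funX.
  have tg0 t : I01 t -> (0 <= (t ^+ n * g t)%:E)%E.
    by move=> /in_I01[tge0 _]; rewrite lee_fin mulr_ge0 ?exprn_ge0.
  under eq_integral do rewrite /F mulrDr EFinD.
  rewrite ge0_integralD//; last 4 first.
  - by move=> t It; rewrite mulrCA EFinM mule_ge0 ?tg0.
  - apply/measurable_EFinP; apply: measurable_funM; first exact: measurable_funX.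
    exact: measurable_funM.
  - move=> t /in_I01[tge0 _]; rewrite lee_fin mulr_ge0 ?exprn_ge0//.
    by case: ifP => // _; rewrite mulr_ge0.
  - by apply/measurable_EFinP; apply: measurable_funM => //; exact: measurable_funX.
  apply: leeD.
    under eq_integral do rewrite mulrCA EFinM.
    rewrite ge0_integralZl ?lee_fin//.
    rewrite lee_wpmul2l ?lee_fin//.
    by apply: carleson_integral => //; rewrite lexx ltr01.
  pose E : set (measurableTypeR R) := `[t0, 1%R[.
  have EI : E = I01 `&` E.
    apply/seteqP; split=> t; rewrite /E /= !in_itv /=; last by case.
    by move=> /andP[h1 h2]; split; rewrite h2 ?h1 ?(le_trans t00 h1).
  apply: le_trans (lee_wpmul2l _ (carleson_integral n t001 b1 e0 me)); last first.
    by rewrite lee_fin.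
  rewrite -/E -ge0_integralZl ?lee_fin//; last 2 first.
  - exact: measurable_itv.
  - by move=> t; rewrite EI => -[/tg0].
  rewrite EI integral_mkcondr le_eqVlt; apply/orP; left; apply/eqP.
  apply: eq_integral => t /set_mem/in_I01[tge0 tlt1].
  rewrite patchE; have [ht|ht] := leP t0 t.
    by rewrite mem_set ?/E /= ?in_itv /= ?ht ?tlt1// -EFinM mulrCA.
  rewrite mulr0 memNset//; rewrite /E /= in_itv /=; move=> /andP[h _].
  by move: ht; rewrite ltNge h.
have c0 n : 0 < negbin alpha n by rewrite negbin_gt0// (lt_trans _ a1).
have row n : exists2 l : C, series (hankel_row mu alpha f n) @ \oo --> l &
   cabs l <= negbin alpha n *
     ((D0 * M + D1 * e) * (2 `^ (b - 1) * 16) / (n.+1%:R * n.+2%:R)).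
  have [l sl lW] := moment_sum_bound mufin am (mF _) aF cM (intF n).
  exists ((negbin alpha n)%:C * l); last first.
    by rewrite cabsM cabsR gtr0_norm// ler_wpM2l// ltW.
  rewrite (_ : series _ = fun K => (negbin alpha n)%:C *
      series (fun k => (fine (moment mu (n + k)))%:C * coefs f k) K).
    exact: cvgMr.
  apply/funext => K; rewrite /series /= mulr_sumr; apply: eq_bigr => k _.
  rewrite /hankel_row hankel_momentE// fineM// real_complexM mulrA//.
have bW n : cabs (hankel_coef mu alpha f n) <= negbin alpha n *
     ((D0 * M + D1 * e) * (2 `^ (b - 1) * 16) / (n.+1%:R * n.+2%:R)).
  by have [l sl lW] := row n; rewrite /hankel_coef (cvgC_lim sl).
have hE z : disc z -> hankel mu alpha f z = PS (hankel_coef mu alpha f) z by [].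
have [ha hN] := bloch_norm_hankel_type a1 bW hE.
split=> //; split=> //.
- by move=> n k; rewrite hankel_momentE// fin_numM.
- by move=> n; have [l sl _] := row n; apply/cvg_ex; exists l.
- move=> z z1; apply/cvg_ex; eexists; apply: (PS_cvg _ z1).
  have [] := @PS_negbin_le _ (hankel_coef mu alpha f)
    ((D0 * M + D1 * e) * (2 `^ (b - 1) * 16)) alpha => //.
    exact: lt_trans a1.
  move=> n; apply: le_trans (bW n) _; rewrite mulrC ler_wpM2r ?(ltW (c0 n))//.
  rewrite ler_piMr ?mulr_ge0 ?addr_ge0 ?mulr_ge0 ?powR_ge0// invf_le1 ?mulr_gt0//.
  by rewrite -natrM ler1n.
Qed.

End hankel_coefficients.

(** * Bloch norms and boundedness of the operator *)

Section bloch_space.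
Context {R : realType}.
Local Notation C := (cplx R).
Implicit Types (f : C -> C) (b : R).

Lemma bloch_seminorm_ubound b f z : disc z ->
  (((1 - cabs z ^+ 2) `^ b * cabs (derive1 f z))%:E <= bloch_seminorm b f)%E.
Proof. by move=> z1; apply: ereal_sup_ubound; exists z. Qed.

Lemma bloch_seminorm_ge0 b f : (0 <= bloch_seminorm b f)%E.
Proof.
apply: le_trans (bloch_seminorm_ubound b f disc0).
by rewrite lee_fin mulr_ge0 ?powR_ge0 ?cabs_ge0.
Qed.

Lemma bloch_seminorm_le b f (S : R) :
  (forall z, disc z -> (1 - cabs z ^+ 2) `^ b * cabs (derive1 f z) <= S) ->
  (bloch_seminorm b f <= S%:E)%E.
Proof. by move=> fS; apply: ge_ereal_sup => _ [z z1 <-]; rewrite lee_fin fS. Qed.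

Lemma blochP b f : bloch b f -> exists S : R, [/\ 0 <= S,
  bloch_norm b f = (cabs (f 0) + S)%:E &
  forall z, disc z -> (1 - cabs z ^+ 2) `^ b * cabs (derive1 f z) <= S].
Proof.
move=> [fa fb]; have s0 := bloch_seminorm_ge0 b f.
have sfin : bloch_seminorm b f \is a fin_num by rewrite ge0_fin_numE.
exists (fine (bloch_seminorm b f)); split; first exact: fine_ge0.
  by rewrite EFinD fineK.
by move=> z z1; rewrite -lee_fin fineK// bloch_seminorm_ubound.
Qed.

(** The value at 0 is absorbed because (1 - |z|)^(1-b) >= 1. *)
Lemma bloch_growth_norm b f (N : R) z : 1 < b -> bloch b f ->
  (bloch_norm b f <= N%:E)%E -> disc z ->
  cabs (f z) <= N * (1 + (b - 1)^-1) * (1 - cabs z) `^ (1 - b).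
Proof.
move=> b1 fb; have [S [S0 -> fS]] := blochP fb; rewrite lee_fin => SN z1.
have z1' : cabs z < 1 by [].
have b10 : 0 < b - 1 by rewrite subr_gt0.
apply: le_trans (bloch_growth fb.1 b1 S0 fS z1) _.
have p1 : 1 <= (1 - cabs z) `^ (1 - b).
  have := @ler_powRN R (1 - cabs z) 1 (b - 1); rewrite powR1 opprB; apply.
  - exact: ltW.
  - by rewrite subr_gt0.
  - by rewrite gerBl cabs_ge0.
rewrite mulrDr mulr1 mulrDl; apply: lerD.
  apply: (@le_trans _ _ N); first by apply: le_trans SN; rewrite lerDl.
  rewrite ler_peMr//; apply: le_trans SN; by rewrite addr_ge0// cabs_ge0.
rewrite ler_wpM2r ?powR_ge0// ler_wpM2r ?invr_ge0 ?(ltW b10)//.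
by apply: le_trans SN; rewrite lerDr cabs_ge0.
Qed.

Lemma bloch_of_norm b f (N : R) : analytic_on_disc f ->
  (bloch_norm b f <= N%:E)%E -> bloch b f.
Proof.
move=> fa fN; split=> //; apply: (@le_lt_trans _ _ N%:E); last by rewrite ltry.
by apply: le_trans fN; rewrite /bloch_norm leeDr// lee_fin cabs_ge0.
Qed.

End bloch_space.

Section carleson_sufficient.
Context {R : realType}.
Local Notation C := (cplx R).
Variable mu : {measure set (measurableTypeR R) -> \bar R}.
Implicit Types (f : C -> C) (alpha b : R).

(** The constants of [bloch_growth_norm], [carleson_integral] and [bloch_norm_hankel_type], in this
    order. *)
Definition hankel_const alpha b : R := (1 + (b - 1)^-1) * (2 `^ (b - 1) * 16) *
  (1 + alpha ^+ 2 / (alpha - 1) * 2 `^ (alpha - 1)).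

Lemma carleson_hankel f alpha b M (N : R) : 1 < alpha -> 1 < b -> 0 <= M ->
  tail_carleson mu 0 (b + 1) M -> bloch b f -> (bloch_norm b f <= N%:E)%E ->
  [/\ hankel_defined mu alpha f, analytic_on_disc (hankel mu alpha f),
    (forall z, disc z -> hankel mu alpha f z = PS (hankel_coef mu alpha f) z) &
   (bloch_norm (alpha - 1) (hankel mu alpha f) <=
     (hankel_const alpha b * M * N)%:E)%E].
Proof.
move=> a1 b1 M0 mM fb fN.
have [S [S0 E _]] := blochP fb.
have N0 : 0 <= N.
  by rewrite -lee_fin; apply: le_trans fN; rewrite E lee_fin addr_ge0 ?cabs_ge0.
have D10 : 0 <= N * (1 + (b - 1)^-1).
  by rewrite mulr_ge0 ?addr_ge0 ?invr_ge0 ?subr_ge0 ?(ltW b1).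
have t01 : 0 <= (0 : R) < 1 by rewrite lexx ltr01.
have [||hd ha hE hN] := @hankel_main R mu f alpha b 0 M M 0 (N * (1 + (b - 1)^-1))
  a1 b1 t01 M0 M0 (lexx _) D10 mM mM fb.1.
- by move=> z z1; exact: bloch_growth_norm.
- by move=> t /andP[h1 h2]; move: (le_lt_trans h1 h2); rewrite ltxx.
split=> //; apply: le_trans hN _; rewrite lee_fin mul0r add0r /hankel_const.
by rewrite le_eqVlt; apply/orP; left; apply/eqP; ring.
Qed.

Lemma carleson_tail s : carleson mu s <-> exists2 M, 0 < M & tail_carleson mu 0 s M.
Proof. by split=> -[M M0 mM]; exists M. Qed.

Lemma carleson_bounded alpha b : 1 < alpha -> 1 < b -> carleson mu (b + 1) ->
  hankel_bounded mu alpha b (alpha - 1).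
Proof.
move=> a1 b1 /carleson_tail[M M0 mM]; split=> [f fb|].
  have [S [S0 E _]] := blochP fb.
  have [|hd ha _ hN] := carleson_hankel a1 b1 (ltW M0) mM fb (N := cabs (f 0) + S).
    by rewrite E.
  exact: conj hd (bloch_of_norm ha hN).
exists (hankel_const alpha b * M) => f fb.
have [S [S0 E _]] := blochP fb.
have [|hd ha _ hN] := carleson_hankel a1 b1 (ltW M0) mM fb (N := cabs (f 0) + S).
  by rewrite E.
by rewrite E -EFinM.
Qed.

End carleson_sufficient.

(** * Necessity of the Carleson condition *)

Section test_functions.
Context {R : realType}.
Local Notation C := (cplx R).
Variable mu : {measure set (measurableTypeR R) -> \bar R}.
Implicit Types (alpha a b : R).

Local Notation I01 := (`[0%R, 1%R[%classic : set (measurableTypeR R)).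

(* The Taylor coefficients of (1 - a^2) / (1 - a z)^b. *)
Definition test_coef a b k : C := ((1 - a ^+ 2) * (negbin b k * a ^+ k))%:C.

Definition test_fun a b : C -> C := PS (test_coef a b).

Lemma onem_sqr_ge0 a : 0 <= a < 1 -> 0 < 1 - a ^+ 2.
Proof. by move=> /andP[a0 a1]; rewrite subr_gt0 exprn_ilt1. Qed.

Lemma test_coef_ge0 a b k : 0 <= a < 1 -> 0 < b ->
  0 <= (1 - a ^+ 2) * (negbin b k * a ^+ k).
Proof.
move=> a01 b0; have /andP[a0 _] := a01.
by rewrite !mulr_ge0 ?exprn_ge0 ?(ltW (onem_sqr_ge0 a01))// ltW// negbin_gt0.
Qed.

Lemma test_coef_majorized a b : 0 <= a < 1 -> 0 < b ->
  disc_majorized (test_coef a b).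
Proof.
move=> a01 b0; have /andP[a0 a1] := a01.
have [] := @PS_negbin_le _ (test_coef a b) 1 b b0 => // n.
rewrite cabsR ger0_norm ?test_coef_ge0// mul1r mulrCA ler_piMr ?(ltW (negbin_gt0 _ _))//.
by rewrite mulr_ile1 ?exprn_ge0 ?(ltW (onem_sqr_ge0 a01)) ?exprn_ile1 ?(ltW a1)// gerBl exprn_ge0.
Qed.

Lemma test_fun_analytic a b : 0 <= a < 1 -> 0 < b -> analytic_on_disc (test_fun a b).
Proof. by move=> a01 b0; apply: analytic_PS (test_coef_majorized a01 b0) _. Qed.

Lemma coefs_test_fun a b : 0 <= a < 1 -> 0 < b ->
  coefs (test_fun a b) = test_coef a b.
Proof.
move=> a01 b0; apply: coefs_unique => z z1.
exact: PS_cvg (test_coef_majorized a01 b0) z1.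
Qed.

(** The 1 bounds the value 1 - a^2 at 0. In the seminorm, 2^b bounds ((1 - |z|^2)/(1 - a |z|))^b,
    and 2 b bounds (1 - a^2) a b/(1 - a |z|). *)
Definition test_norm b : R := 1 + 2 `^ b * (b * 2).

Lemma bloch_norm_test_fun a b : 0 <= a < 1 -> 0 < b ->
  (bloch_norm b (test_fun a b) <= (test_norm b)%:E)%E.
Proof.
move=> a01 b0; have /andP[a0 a1] := a01; have q0 := onem_sqr_ge0 a01.
have tm := test_coef_majorized a01 b0.
rewrite /bloch_norm /test_norm EFinD leeD//.
  rewrite lee_fin /test_fun PS0 cabsR ger0_norm ?test_coef_ge0// negbin0 mul1r mulr1.
  by rewrite gerBl sqr_ge0.
apply: bloch_seminorm_le => z z1.
have z1' : cabs z < 1 by [].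
have z0 := cabs_ge0 z.
have az0 : 0 <= a * cabs z by rewrite mulr_ge0.
have azz : a * cabs z <= cabs z by rewrite ler_piMl// ltW.
have aza : a * cabs z <= a by rewrite ler_piMr// ltW.
have az1 : a * cabs z < 1 by exact: le_lt_trans z1'.
have b10 : 0 < b + 1 by rewrite addr_gt0.
rewrite (derive1_PS tm (fun _ _ => erefl) z1).
have dle : cabs (PS (deriv_coef (test_coef a b)) z) <=
    (1 - a ^+ 2) * (a * b) * (1 - a * cabs z) `^ (- (b + 1)).
  apply: le_trans (PS_le (disc_majorized_deriv tm) z1) _.
  have mE : majorant (deriv_coef (test_coef a b)) (cabs z) @ \oo -->
      (1 - a ^+ 2) * (a * b) * (1 - a * cabs z) `^ (- (b + 1)).
    rewrite (_ : majorant _ _ = fun N => (1 - a ^+ 2) * (a * b) *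
        series (fun n => negbin (b + 1) n * (a * cabs z) ^+ n) N).
      by apply: cvgMr; apply: binomial_series; rewrite ?az0.
    apply/funext => N; rewrite /majorant /series /= mulr_sumr; apply: eq_bigr => n _.
    rewrite /deriv_coef -mulr_natr cabsM cabs_nat cabsR ger0_norm ?test_coef_ge0//.
    rewrite exprMn; have := negbin_deriv b n.
    rewrite (_ : (1 - a ^+ 2) * (negbin b n.+1 * a ^+ n.+1) * n.+1%:R =
      (1 - a ^+ 2) * a ^+ n.+1 * (n.+1%:R * negbin b n.+1)); last by ring.
    by move=> ->; rewrite (exprS a n); ring.
  by rewrite (cvg_lim (@norm_hausdorff _ R) mE).
apply: (@le_trans _ _ ((1 - cabs z ^+ 2) `^ b *
    ((1 - a ^+ 2) * (a * b) * (1 - a * cabs z) `^ (- (b + 1))))).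
  by rewrite ler_wpM2l ?powR_ge0.
have w0 : 0 < 1 - a * cabs z by rewrite subr_gt0.
have -> : (1 - a * cabs z) `^ (- (b + 1)) = ((1 - a * cabs z) `^ b)^-1 * (1 - a * cabs z)^-1.
  rewrite -powRN -powR_inv1 ?(ltW w0)// -powRD ?(gt_eqF w0) ?implybT//.
  by congr (_ `^ _); ring.
have P1 : (1 - cabs z ^+ 2) `^ b * ((1 - a * cabs z) `^ b)^-1 <= 2 `^ b.
  rewrite ler_pdivrMr ?powR_gt0// -powRM ?(ltW w0)//.
  apply: ge0_ler_powR; first exact: ltW.
  - by rewrite nnegrE subr_ge0 exprn_ile1// ltW.
  - by rewrite nnegrE mulr_ge0// ltW.
  - have -> : 1 - cabs z ^+ 2 = (1 - cabs z) * (1 + cabs z) by ring.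
    rewrite [leLHS]mulrC; apply: ler_pM.
    + exact: addr_ge0.
    + by rewrite subr_ge0 ltW.
    + by move: z1'; lra.
    + by rewrite lerD2l lerN2.
have P2 : (1 - a ^+ 2) * (a * b) * (1 - a * cabs z)^-1 <= b * 2.
  rewrite ler_pdivrMr//.
  have -> : (1 - a ^+ 2) * (a * b) = b * (a * (1 + a)) * (1 - a) by ring.
  apply: ler_pM; rewrite ?subr_ge0 ?(ltW a1)//.
  - by rewrite !mulr_ge0 ?addr_ge0// ltW.
  - rewrite ler_wpM2l ?(ltW b0)//; nra.
  - by rewrite lerD2l lerN2.
rewrite [leLHS](_ : _ = ((1 - cabs z ^+ 2) `^ b * ((1 - a * cabs z) `^ b)^-1) *
  ((1 - a ^+ 2) * (a * b) * (1 - a * cabs z)^-1)); last by ring.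
rewrite ler_pM//; first by rewrite mulr_ge0 ?powR_ge0 ?invr_ge0 ?powR_ge0.
by rewrite !mulr_ge0 ?invr_ge0 ?(ltW q0) ?(ltW b0) ?(ltW w0).
Qed.

Lemma bloch_test_fun a b : 0 <= a < 1 -> 0 < b -> bloch b (test_fun a b).
Proof.
move=> a01 b0; exact: bloch_of_norm (test_fun_analytic a01 b0)
  (bloch_norm_test_fun a01 b0).
Qed.

Lemma moment_lower a m : 0 <= a < 1 ->
  ((a ^+ m)%:E * mu `[a, 1%R[ <= moment mu m)%E.
Proof.
move=> /andP[a0 a1].
pose E : set (measurableTypeR R) := `[a, 1%R[.
have mE : measurable E by exact: measurable_itv.
have mt (D : set (measurableTypeR R)) : measurable_fun D (fun t : R => (t ^+ m)%:E).
  by apply/measurable_EFinP; exact: measurable_funX.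
apply: (@le_trans _ _ (\int[mu]_(t in E) (t ^+ m)%:E)%E).
  rewrite -integral_cst//; apply: ge0_le_integral => //.
  - by move=> t _; rewrite lee_fin exprn_ge0.
  - move=> t; rewrite /E /= in_itv /= => /andP[h1 h2]; rewrite lee_fin.
    by rewrite lerXn2r ?nnegrE ?(le_trans a0).
apply: ge0_subset_integral => //.
- by move=> t /in_I01[t0 _]; rewrite lee_fin exprn_ge0.
- move=> t; rewrite /E /= !in_itv /= => /andP[h1 h2].
  by rewrite h2 (le_trans a0 h1).
Qed.

(** The entry with n = k = 0 is the total mass of [mu] on [0, 1). *)
Lemma hankel_defined_fin alpha f : 1 < alpha -> hankel_defined mu alpha f ->
  (mu I01 < +oo)%E.
Proof.
move=> a1 [/(_ 0%N 0%N) + _ _ _].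
rewrite hankel_momentE// negbin0 mul1e moment0 ge0_fin_numE//.
Qed.

Lemma hankel_defined_PS alpha f : hankel_defined mu alpha f ->
  disc_majorized (hankel_coef mu alpha f) /\
  forall z, disc z -> hankel mu alpha f z = PS (hankel_coef mu alpha f) z.
Proof. by move=> [_ _ hc _]; split=> //; exact: disc_majorizedP. Qed.

Lemma test_hankel_coef_cvg alpha a b n : 1 < alpha -> 0 <= a < 1 -> 0 < b ->
  hankel_defined mu alpha (test_fun a b) ->
  series (fun k => negbin alpha n * fine (moment mu (n + k)) *
    ((1 - a ^+ 2) * (negbin b k * a ^+ k))) @ \oo -->
  complex.Re (hankel_coef mu alpha (test_fun a b) n).
Proof.
move=> al1 a01 b0 hd; have mufin := hankel_defined_fin al1 hd.
have [_ hc _ _] := hd.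
have := cvg_ReP (hc n); rewrite (_ : (fun k => complex.Re _) = series
  (fun k => negbin alpha n * fine (moment mu (n + k)) *
    ((1 - a ^+ 2) * (negbin b k * a ^+ k))))//.
apply/funext => K; rewrite /series /= Re_sum; apply: eq_bigr => k _.
rewrite /hankel_row hankel_momentE// fineM//; last exact: moment_fin_num.
by rewrite Re_realM coefs_test_fun.
Qed.

(** Every term is nonnegative, so m_{n+k} may be replaced by a^(n+k) mu([a, 1)). The sums over k and
    over n become binomial series at a^2, and the powers of 1 - a^2 add up to 1 - b - (alpha + 1) +
    (alpha - 1) = -(b + 1). The factor a alpha comes from the derivative. *)
Lemma test_hankel_lower alpha a b : 1 < alpha -> 0 <= a < 1 -> 0 < b ->
  hankel_defined mu alpha (test_fun a b) ->
  a * alpha * fine (mu `[a, 1%R[) * (1 - a ^+ 2) `^ (- (b + 1)) <=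
  (1 - cabs (a%:C : C) ^+ 2) `^ (alpha - 1) *
    cabs (derive1 (hankel mu alpha (test_fun a b)) a%:C).
Proof.
move=> al1 a01 b0 hd; have /andP[a0 a1] := a01; have q0 := onem_sqr_ge0 a01.
have al0 : 0 < alpha by exact: lt_trans al1.
have mufin := hankel_defined_fin al1 hd.
have [hm hE] := hankel_defined_PS hd.
have da : disc (a%:C : C) by rewrite discE cabsR ger0_norm.
set H := hankel_coef mu alpha (test_fun a b) in hm hE *.
set m := fine (mu `[a, 1%R[).
have mufin' : mu `[a, 1%R[ \is a fin_num.
  rewrite ge0_fin_numE//; apply: le_lt_trans mufin; apply: le_measure;
    rewrite ?inE; try exact: measurable_itv.
  by move=> t; rewrite /= !in_itv /= => /andP[h1 ->]; rewrite (le_trans a0 h1).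
have m0 : 0 <= m by rewrite fine_ge0.
have ml k : a ^+ k * m <= fine (moment mu k).
  rewrite -lee_fin fineK; last exact: moment_fin_num.
  by rewrite EFinM fineK// moment_lower.
have a201 : 0 <= a ^+ 2 < 1 by rewrite sqr_ge0 exprn_ilt1.
have Hn n : negbin alpha n * a ^+ n * (m * ((1 - a ^+ 2) * (1 - a ^+ 2) `^ (- b))) <=
    complex.Re (H n).
  have c1 : series (fun k => negbin alpha n * a ^+ n * m * (1 - a ^+ 2) *
      (negbin b k * (a ^+ 2) ^+ k)) @ \oo -->
      negbin alpha n * a ^+ n * (m * ((1 - a ^+ 2) * (1 - a ^+ 2) `^ (- b))).
    rewrite (_ : series _ = fun N => negbin alpha n * a ^+ n * m * (1 - a ^+ 2) *
        series (fun k => negbin b k * (a ^+ 2) ^+ k) N).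
      rewrite !mulrA; apply: cvgMr; exact: binomial_series.
    by apply/funext => N; rewrite /series /= mulr_sumr.
  have c2 := test_hankel_coef_cvg (n := n) al1 a01 b0 hd.
  rewrite -/H in c2.
  apply: (ler_cvg_to c1 c2).
  apply: nearW => N; apply: ler_sum => k _.
  rewrite (_ : _ * _ * m * _ * _ = (negbin alpha n * ((1 - a ^+ 2) * (negbin b k * a ^+ k))) *
    (a ^+ (n + k) * m)); last by rewrite exprD -exprM mulnC exprM expr2; ring.
  rewrite [leRHS]mulrAC ler_wpM2l//.
  by rewrite mulr_ge0 ?test_coef_ge0// ltW// negbin_gt0.
have dl : a * alpha * (m * ((1 - a ^+ 2) * (1 - a ^+ 2) `^ (- b))) *
    (1 - a ^+ 2) `^ (- (alpha + 1)) <=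
    cabs (derive1 (hankel mu alpha (test_fun a b)) a%:C).
  apply: le_trans (ler_Re_cabs _); apply: le_trans (ler_norm _).
  rewrite (derive1_PS hm hE da).
  have c2 := cvg_ReP (PS_cvg (disc_majorized_deriv hm) da).
  set w := m * _ in Hn *.
  have c1 : series (fun n => a * alpha * w * (negbin (alpha + 1) n * (a ^+ 2) ^+ n)) @ \oo -->
      a * alpha * w * (1 - a ^+ 2) `^ (- (alpha + 1)).
    rewrite (_ : series _ = fun N => a * alpha * w *
        series (fun k => negbin (alpha + 1) k * (a ^+ 2) ^+ k) N).
      by apply: cvgMr; apply: binomial_series => //; rewrite addr_gt0.
    by apply/funext => N; rewrite /series /= mulr_sumr.
  apply: (ler_cvg_to c1 c2); apply: nearW => N.
  rewrite /power_series /series /= Re_sum; apply: ler_sum => n _.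
  rewrite -real_complexX [X in complex.Re X]mulrC Re_realM /deriv_coef.
  have -> : complex.Re (H n.+1 *+ n.+1) = n.+1%:R * complex.Re (H n.+1).
    rewrite -Re_realM real_complexR mulr_natl//.
  rewrite (_ : a * alpha * w * _ = a ^+ n * (n.+1%:R * negbin alpha n.+1 * a ^+ n.+1 * w)); last first.
    by rewrite negbin_deriv exprAC expr2 (exprS a n); ring.
  rewrite ler_wpM2l ?exprn_ge0// -!mulrA ler_wpM2l//.
  by have := Hn n.+1; rewrite -/w !mulrA.
apply: le_trans (ler_wpM2l (powR_ge0 _ _) dl).
rewrite cabsR ger0_norm// le_eqVlt; apply/orP; left; apply/eqP.
have E1 : (1 - a ^+ 2) * (1 - a ^+ 2) `^ (- b) = (1 - a ^+ 2) `^ (1 - b).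
  by rewrite powRB ?(gt_eqF q0) ?implybT// powRr1 ?(ltW q0)// powRN.
rewrite E1 (_ : (1 - a ^+ 2) `^ (- (b + 1)) = (1 - a ^+ 2) `^ (alpha - 1) *
  ((1 - a ^+ 2) `^ (1 - b) * (1 - a ^+ 2) `^ (- (alpha + 1)))); first by ring.
rewrite -!powRD ?(gt_eqF q0) ?implybT//; congr (_ `^ _); ring.
Qed.

Lemma carleson_of_test_bound alpha b (Q : R) : 1 < alpha -> 1 < b ->
  (forall a, 0 <= a < 1 -> hankel_defined mu alpha (test_fun a b) /\
    (bloch_norm (alpha - 1) (hankel mu alpha (test_fun a b)) <= Q%:E)%E) ->
  carleson mu (b + 1).
Proof.
move=> al1 b1 hQ.
have b0 : 0 < b by exact: lt_trans b1.
have al0 : 0 < alpha by exact: lt_trans al1.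
have z01 : 0 <= (0 : R) < 1 by rewrite lexx ltr01.
have [hd0 hN0] := hQ 0 z01.
have mufin := hankel_defined_fin al1 hd0.
set m0 := fine (mu I01).
have Q0 : 0 <= Q.
  rewrite -lee_fin; apply: le_trans hN0.
  by rewrite adde_ge0 ?lee_fin ?cabs_ge0// bloch_seminorm_ge0.
have m00 : 0 <= m0 by rewrite fine_ge0.
have p2 : 0 < 2 `^ (b + 1) :> R by rewrite powR_gt0.
(* The first term is for a > 1/2, where a alpha >= 1/2 and 1 - a^2 <= 2 (1 - a). The second is for a
   <= 1/2, where the lower bound degenerates but 2 (1 - a) >= 1 and the total mass m0 suffices. The
   1 ensures positivity. *)
exists (2 * Q * 2 `^ (b + 1) + m0 * 2 `^ (b + 1) + 1).
  by rewrite ltr_wpDl// addr_ge0 ?mulr_ge0// ltW.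
move=> a a01; have /andP[a0 a1] := a01.
have mufin' : mu `[a, 1%R[ \is a fin_num.
  rewrite ge0_fin_numE//; apply: le_lt_trans mufin; apply: le_measure;
    rewrite ?inE; try exact: measurable_itv.
  by move=> t; rewrite /= !in_itv /= => /andP[h1 ->]; rewrite (le_trans a0 h1).
have mle : fine (mu `[a, 1%R[) <= m0.
  rewrite fine_le// ?ge0_fin_numE//; apply: le_measure;
    rewrite ?inE; try exact: measurable_itv.
  by move=> t; rewrite /= !in_itv /= => /andP[h1 ->]; rewrite (le_trans a0 h1).
rewrite -(fineK mufin') lee_fin !mulrDl mul1r.
have pa : 0 <= (1 - a) `^ (b + 1) by exact: powR_ge0.
have t0 : 0 <= 2 * Q * 2 `^ (b + 1) * (1 - a) `^ (b + 1).
  by rewrite !mulr_ge0// ltW.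
have t1 : 0 <= m0 * 2 `^ (b + 1) * (1 - a) `^ (b + 1).
  by rewrite !mulr_ge0// ltW.
have b10 : 0 <= b + 1 by rewrite addr_ge0// ltW.
have [ha|ha] := leP a 2^-1.
  have : m0 <= m0 * 2 `^ (b + 1) * (1 - a) `^ (b + 1).
    rewrite -mulrA ler_peMr// -powRM ?subr_ge0 ?(ltW a1)//.
    apply: (@le_trans _ _ (1 `^ (b + 1))); first by rewrite powR1.
    apply: ge0_ler_powR => //.
    - by rewrite nnegrE.
    - by rewrite nnegrE mulr_ge0// subr_ge0 ltW.
    - by lra.
  by lra.
have [hd hN] := hQ a a01.
have q0 := onem_sqr_ge0 a01.
have da : disc (a%:C : C) by rewrite discE cabsR ger0_norm.
have := test_hankel_lower al1 a01 b0 hd.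
have hS : (1 - cabs (a%:C : C) ^+ 2) `^ (alpha - 1) *
    cabs (derive1 (hankel mu alpha (test_fun a b)) a%:C) <= Q.
  rewrite -lee_fin; apply: le_trans (bloch_seminorm_ubound _ _ da) _.
  by apply: le_trans hN; rewrite /bloch_norm leeDr// lee_fin cabs_ge0.
move=> /le_trans/(_ hS); rewrite powRN ler_pdivrMr ?powR_gt0// => h.
have h2 : (1 - a ^+ 2) `^ (b + 1) <= 2 `^ (b + 1) * (1 - a) `^ (b + 1).
  rewrite -powRM ?subr_ge0 ?(ltW a1)//; apply: ge0_ler_powR => //.
  - by rewrite nnegrE ltW.
  - by rewrite nnegrE mulr_ge0// subr_ge0 ltW.
  - nra.
have h3 := le_trans h (ler_wpM2l Q0 h2).
have f0 : 0 <= fine (mu `[a, 1%R[) by rewrite fine_ge0.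
have h4 : fine (mu `[a, 1%R[) <= 2 * (a * alpha * fine (mu `[a, 1%R[)).
  rewrite mulrA ler_peMl// mulrA.
  by apply: (@le_trans _ _ (1 * 1)); [rewrite mulr1|apply: ler_pM => //; lra].
lra.
Qed.

Lemma bounded_carleson alpha b : 1 < alpha -> 1 < b ->
  hankel_bounded mu alpha b (alpha - 1) -> carleson mu (b + 1).
Proof.
move=> al1 b1 [hm [M hM]]; have b0 : 0 < b by exact: lt_trans b1.
apply: (@carleson_of_test_bound alpha b (`|M| * test_norm b) al1 b1) => a a01.
have fb := bloch_test_fun a01 b0.
split; first by have [] := hm _ fb.
apply: le_trans (hM _ fb) _.
rewrite EFinM; have [S [S0 E _]] := blochP fb.
have := bloch_norm_test_fun a01 b0; rewrite E lee_fin => h.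
rewrite -EFinM lee_fin; apply: (@le_trans _ _ (`|M| * (cabs (test_fun a b 0) + S))).
  by rewrite ler_wpM2r ?ler_norm// addr_ge0 ?cabs_ge0.
by rewrite ler_wpM2l.
Qed.

End test_functions.

(** * From compactness to the vanishing condition *)

Section nonneg_limits.
Context {R : realType}.

Lemma cvge0P (T : Type) (F : set_system T) {FF : Filter F} (u : T -> \bar R) :
  (\forall x \near F, (0 <= u x)%E) ->
  (u x @[x --> F] --> 0%E) <->
  (forall e : R, 0 < e -> \forall x \near F, (u x <= e%:E)%E).
Proof.
move=> u0; split=> [/fine_cvgP[ufin u1] e e0|ule].
  move/cvgrPdist_le : u1 => /(_ _ e0) u1; near=> x.
  have xfin : u x \is a fin_num by near: x.
  rewrite -(fineK xfin) lee_fin; apply: le_trans (ler_norm _) _.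
  by rewrite -normrN -sub0r; near: x.
have fin : \forall x \near F, u x \is a fin_num.
  have := ule 1 ltr01; near_simpl; apply: filterS2 u0 => x u0 u1.
  by rewrite ge0_fin_numE// (le_lt_trans u1)// ltry.
apply/fine_cvgP; split=> //; apply/cvgrPdist_le => e e0; near=> x.
have xfin : u x \is a fin_num by near: x.
have x0 : (0 <= u x)%E by near: x.
rewrite sub0r normrN /= ger0_norm ?fine_ge0// -lee_fin fineK//.
by near: x; exact: ule.
Unshelve. all: by end_near. Qed.

Lemma increasing_nat_ge (phi : nat -> nat) n : increasing_seq phi -> (n <= phi n)%N.
Proof.
move=> ip; elim: n => // n IH; apply: leq_ltn_trans IH _.
have := ip n.+1 n; rewrite leEnat => e.
by rewrite ltnNge e ltnn.
Qed.

End nonneg_limits.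

Section bloch_difference.
Context {R : realType}.
Local Notation C := (cplx R).
Implicit Types (f g : C -> C) (gam b : R).

Lemma derive1_analyticB f g z : analytic_on_disc f -> analytic_on_disc g -> disc z ->
  derive1 (fun w => f w - g w) z = derive1 f z - derive1 g z.
Proof.
move=> fa ga z1.
have df := is_derive_PS (coefs_majorized fa) (fun w => coefs_PS fa) z1.
have dg := is_derive_PS (coefs_majorized ga) (fun w => coefs_PS ga) z1.
have [_ dfg] := is_deriveB df dg.
have [_ ef] := df; have [_ eg] := dg.
by rewrite !derive1E ef eg -dfg.
Qed.

Lemma bloch_normD f g gam : analytic_on_disc f -> analytic_on_disc g ->
  (bloch_norm gam f <=
   bloch_norm gam (fun w => (f w - g w)%R) + bloch_norm gam g)%E.
Proof.
move=> fa ga; rewrite /bloch_norm addeACA; apply: leeD.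
  by rewrite -EFinD lee_fin -{1}(subrK (g 0) (f 0)) ler_cabsD.
apply: ge_ereal_sup => _ [z z1 <-].
apply: le_trans (leeD (bloch_seminorm_ubound _ _ z1) (bloch_seminorm_ubound _ _ z1)).
rewrite -EFinD lee_fin -mulrDr ler_wpM2l ?powR_ge0// derive1_analyticB//.
by rewrite -{1}(subrK (derive1 g z) (derive1 f z)) ler_cabsD.
Qed.

Lemma bloch_norm_ge0 gam f : (0 <= bloch_norm gam f)%E.
Proof. by rewrite adde_ge0 ?lee_fin ?cabs_ge0// bloch_seminorm_ge0. Qed.

Lemma bloch_norm_derivB f g gam (e : R) z : analytic_on_disc f -> analytic_on_disc g ->
  (bloch_norm gam (fun w => (f w - g w)%R) <= e%:E)%E -> disc z ->
  (1 - cabs z ^+ 2) `^ gam * cabs (derive1 f z - derive1 g z) <= e.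
Proof.
move=> fa ga h z1; rewrite -derive1_analyticB// -lee_fin.
apply: le_trans (bloch_seminorm_ubound _ _ z1) _.
by apply: le_trans h; rewrite /bloch_norm leeDr// lee_fin cabs_ge0.
Qed.

End bloch_difference.

Section compact_necessary.
Context {R : realType}.
Local Notation C := (cplx R).
Variable mu : {measure set (measurableTypeR R) -> \bar R}.
Implicit Types (alpha a b : R).
Local Notation I01 := (`[0%R, 1%R[%classic : set (measurableTypeR R)).

(** Boundedness is not part of [hankel_compact]. If the images of the test functions were unbounded,
    some would have norms above n for every n, and these have no norm-convergent subsequence. *)
Lemma compact_carleson alpha b : 1 < alpha -> 1 < b ->
  hankel_compact mu alpha b (alpha - 1) -> carleson mu (b + 1).
Proof.
move=> al1 b1 [hm hc]; have b0 : 0 < b by exact: lt_trans b1.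
have [[Q hQ]|nQ] := pselect (exists Q : R, forall a, 0 <= a < 1 ->
  (bloch_norm (alpha - 1) (hankel mu alpha (test_fun a b)) <= Q%:E)%E).
  apply: (@carleson_of_test_bound _ mu alpha b Q al1 b1) => a a01; split; last exact: hQ.
  by have [] := hm _ (bloch_test_fun a01 b0).
exfalso.
have /choice[a ha] : forall n : nat, exists a : R, 0 <= a < 1 /\
    (n%:R%:E < bloch_norm (alpha - 1) (hankel mu alpha (test_fun a b)))%E.
  move=> n; apply: contrapT => nex; apply: nQ; exists n%:R => a a01.
  by rewrite leNgt; apply/negP => h; apply: nex; exists a.
have [|phi [g [ip gb hlim]]] := hc (fun n => test_fun (a n) b) (test_norm b).
  by move=> n; have [a01 _] := ha n; split; [exact: bloch_test_fun|exact: bloch_norm_test_fun].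
have [S [_ gE _]] := blochP gb.
have {}hlim : forall eta : R, 0 < eta -> \forall n \near \oo,
    (bloch_norm (alpha - 1) (fun z => hankel mu alpha (test_fun (a (phi n)) b) z - g z)%R
      <= eta%:E)%E.
  by apply/cvge0P => //; apply: nearW => n; exact: bloch_norm_ge0.
have [N _ hN] := hlim 1 ltr01.
pose B := 1 + (cabs (g 0) + S).
(* m lies past the index where the images are within 1 of g, and above the resulting bound B of
   their norms; since phi m >= m, the norm at m exceeds m >= B. *)
pose m := maxn N `|Num.ceil B|%N.
have Nm : (N <= m)%N by exact: leq_maxl.
have [a01 ham] := ha (phi m).
have [_ [hana _]] := hm _ (bloch_test_fun a01 b0).
have := bloch_normD (alpha - 1) hana gb.1.
move=> /le_trans/(_ (leeD2r _ (hN m Nm))); rewrite gE -EFinD => hle.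
have := lt_le_trans ham hle; rewrite lte_fin ltNge => /negP; apply.
apply: (@le_trans _ _ (m%:R : R)); last by rewrite ler_nat increasing_nat_ge.
apply: le_trans (ceil_ge _) _.
rewrite -/B; apply: (@le_trans _ _ (`|Num.ceil B|%N%:R)); last first.
  by rewrite ler_nat leq_maxr.
by rewrite natr_absz ler_int ler_norm.
Qed.

(** Partial sums of the series of (1 - t)^(-b), integrated against [mu]. *)
Lemma negbin_moment_sum b M K : 1 < b -> 0 <= M -> tail_carleson mu 0 (b + 1) M ->
  \sum_(k < K) negbin b k * fine (moment mu k) <= M * (2 `^ b * 2).
Proof.
move=> b1 M0 mM; have b0 : 0 < b by exact: lt_trans b1.
have mufin := tail_carleson_fin mM.
have nb0 k : 0 <= negbin b k by rewrite ltW// negbin_gt0.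
rewrite -lee_fin -sumEFin.
have -> : (\sum_(k < K) (negbin b k * fine (moment mu k))%:E =
    \int[mu]_(t in I01) (\sum_(k < K) negbin b k * t ^+ (0 + k))%:E)%E.
  rewrite (@integral_polynomial R mu (negbin b))//.
  by apply: eq_bigr => k _; rewrite EFinM fineK// moment_fin_num.
apply: le_trans (carleson_integral_inv b1 M0 mM).
apply: ge0_le_integral => //.
- move=> t /in_I01[tge0 _]; rewrite lee_fin sumr_ge0// => k _.
  by rewrite mulr_ge0 ?exprn_ge0.
- apply/measurable_EFinP; apply: measurable_sum => k.
  by apply: measurable_funM => //; exact: measurable_funX.
- by apply/measurable_EFinP; exact: measurable_onem_powR.
- move=> t /in_I01[t0 t1]; rewrite lee_fin.
  have cb := @binomial_series R b t b0 (_ : is_true (0 <= t < 1)).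
  have {}cb : series (fun n => negbin b n * t ^+ n) @ \oo --> (1 - t) `^ (- b).
    by apply: cb; rewrite t0.
  rewrite -(cvg_lim (@norm_hausdorff _ R) cb) -(big_mkord xpredT (fun k => negbin b k * t ^+ k)).
  apply: nondecreasing_cvgn_le; last by apply/cvg_ex; eexists; exact: cb.
  apply/nondecreasing_seqP => k.
  by rewrite /series /= big_nat_recr//= lerDl mulr_ge0 ?exprn_ge0.
Qed.

(** The factor 1 - a^2 is the point: at a fixed z the derivative tends to 0 as a tends to 1. It
    survives because a^k is bounded by 1 and m_{n+k} by m_k, which leaves a sum independent of a. *)
Lemma test_hankel_deriv_le alpha a b M z : 1 < alpha -> 1 < b -> 0 <= M ->
  tail_carleson mu 0 (b + 1) M -> 0 <= a < 1 ->
  hankel_defined mu alpha (test_fun a b) -> disc z ->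
  cabs (derive1 (hankel mu alpha (test_fun a b)) z) <=
  (1 - a ^+ 2) * (M * (2 `^ b * 2) * alpha * (1 - cabs z) `^ (- (alpha + 1))).
Proof.
move=> al1 b1 M0 mM a01 hd z1; have b0 : 0 < b by exact: lt_trans b1.
have /andP[a0 a1] := a01; have q0 := onem_sqr_ge0 a01.
have al0 : 0 < alpha by exact: lt_trans al1.
have [hm hE] := hankel_defined_PS hd.
have mufin := tail_carleson_fin mM.
have cge n : 0 <= negbin alpha n by rewrite ltW// negbin_gt0.
have m0 k : 0 <= fine (moment mu k) by rewrite fine_ge0// moment_ge0.
have Hn n : cabs (hankel_coef mu alpha (test_fun a b) n) <=
    (1 - a ^+ 2) * (M * (2 `^ b * 2)) * negbin alpha n.
  have [_ /(_ n) hc _ _] := hd.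
  apply: (cabs_cvg_le hc); apply: nearW => K.
  apply: le_trans (ler_cabs_sum _ _ _) _; rewrite big_mkord.
  apply: (@le_trans _ _ (\sum_(k < K) (1 - a ^+ 2) * negbin alpha n *
      (negbin b k * fine (moment mu k)))).
    apply: ler_sum => k _; rewrite /hankel_row hankel_momentE// fineM ?moment_fin_num//=.
    rewrite cabsM coefs_test_fun// !cabsR !ger0_norm ?test_coef_ge0 ?mulr_ge0//.
    have bk : 0 <= negbin b k by rewrite ltW// negbin_gt0.
    rewrite [leLHS](_ : _ = (1 - a ^+ 2) * negbin alpha n * (negbin b k *
      (fine (moment mu (n + k)) * a ^+ k))); last by ring.
    rewrite ler_wpM2l ?mulr_ge0 ?(ltW q0)// ler_wpM2l//.
    apply: (@le_trans _ _ (fine (moment mu (n + k)))).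
      by rewrite ler_piMr// exprn_ile1// ltW.
    by rewrite fine_le ?moment_fin_num// le_moment.
  rewrite -mulr_sumr -[leLHS]mulrA -[leRHS]mulrA ler_wpM2l ?(ltW q0)//.
  by rewrite [leLHS]mulrC ler_wpM2r//; exact: negbin_moment_sum.
rewrite (derive1_PS hm hE z1).
have al10 : 0 < alpha + 1 by rewrite addr_gt0.
have [|_ /(_ z z1)] := @PS_negbin_le _ (deriv_coef (hankel_coef mu alpha (test_fun a b)))
  ((1 - a ^+ 2) * (M * (2 `^ b * 2)) * alpha) (alpha + 1) al10.
  move=> n; rewrite /deriv_coef -[X in cabs X]mulr_natr cabsM cabs_nat [leLHS]mulrC.
  apply: le_trans (ler_wpM2l _ (Hn n.+1)) _ => //.
  by rewrite mulrCA negbin_deriv mulrA.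
by rewrite -!mulrA.
Qed.

Lemma compact_vanishing alpha b : 1 < alpha -> 1 < b ->
  hankel_compact mu alpha b (alpha - 1) -> vanishing_carleson mu (b + 1).
Proof.
move=> al1 b1 hcomp; have b0 : 0 < b by exact: lt_trans b1.
have al0 : 0 < alpha by exact: lt_trans al1.
have b10 : 0 <= b + 1 by rewrite addr_ge0// ltW.
have hC := compact_carleson al1 b1 hcomp.
have [M M0 mM] := (carleson_tail mu (b + 1)).1 hC.
have mufin := tail_carleson_fin mM.
have [hm hc] := hcomp.
split=> //; apply/cvge0P.
  by apply: nearW => t; rewrite mule_ge0// lee_fin invr_ge0 powR_ge0.
move=> e e0; apply: contrapT => ne.
(* Points tending to 1 where the Carleson quotient stays above e; they are kept above 1/2 so that
   the factor a alpha of the lower bound is at least alpha/2. *)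
have /choice[a ha] : forall n : nat, exists a : R, [/\ 2^-1 < a < 1,
    1 - a < n.+1%:R^-1 & (e%:E < mu `[a, 1%R[ * ((1 - a) `^ (b + 1))^-1%:E)%E].
  move=> n; apply: contrapT => nex; apply: ne; near=> t.
  rewrite leNgt; apply/negP => et; apply: nex; exists t; split => //.
    apply/andP; split; near: t; first by apply: nbhs_left_gt; rewrite invf_lt1// ltr1n.
    exact: nbhs_left_lt.
  by near: t; apply: nbhs_left_ltBl; rewrite invr_gt0.
have a01 n : 0 <= a n < 1.
  by have [/andP[h ->] _ _] := ha n; rewrite andbT ltW// (lt_trans _ h)// invr_gt0.
have [|phi [g [ip gb hlim]]] := hc (fun n => test_fun (a n) b) (test_norm b).
  by move=> n; split; [exact: bloch_test_fun|exact: bloch_norm_test_fun].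
have {}hlim : forall eta : R, 0 < eta -> \forall n \near \oo,
    (bloch_norm (alpha - 1) (fun z => hankel mu alpha (test_fun (a (phi n)) b) z - g z)%R
      <= eta%:E)%E.
  by apply/cvge0P => //; apply: nearW => n; exact: bloch_norm_ge0.
have hd n : hankel_defined mu alpha (test_fun (a n) b).
  by have [] := hm _ (bloch_test_fun (a01 n) b0).
have hana n : analytic_on_disc (hankel mu alpha (test_fun (a n) b)).
  by have [_ []] := hm _ (bloch_test_fun (a01 n) b0).
have g'0 z : disc z -> derive1 g z = 0.
  move=> z1; apply: cabs0_eq0; apply/eqP; rewrite eq_le cabs_ge0 andbT.
  have z1' : cabs z < 1 by [].
  have w0 : 0 < (1 - cabs z ^+ 2) `^ (alpha - 1).
    by rewrite powR_gt0// subr_gt0 exprn_ilt1// cabs_ge0.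
  rewrite -(pmulr_rle0 _ w0); apply/ler_addgt0Pr => eta eta0; rewrite add0r.
  pose K := (1 - cabs z ^+ 2) `^ (alpha - 1) *
    (M * (2 `^ b * 2) * alpha * (1 - cabs z) `^ (- (alpha + 1))).
  have K0 : 0 <= K by rewrite !mulr_ge0 ?powR_ge0// ltW.
  have eta20 : 0 < eta / 2 by rewrite divr_gt0.
  near \oo => n.
  have h1 : (bloch_norm (alpha - 1) (fun z =>
      hankel mu alpha (test_fun (a (phi n)) b) z - g z)%R <= (eta / 2)%:E)%E.
    by near: n; exact: hlim.
  have := bloch_norm_derivB (hana _) gb.1 h1 z1.
  have := test_hankel_deriv_le al1 b1 (ltW M0) mM (a01 (phi n)) (hd _) z1.
  move=> /(ler_wpM2l (ltW w0)); rewrite mulrCA -/K => h2 h3.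
  have h4 : (1 - a (phi n) ^+ 2) * K <= eta / 2.
    have [/andP[ha1 ha2] ha3 _] := ha (phi n).
    apply: (@le_trans _ _ (2 * (n.+1%:R^-1) * K)).
      rewrite ler_wpM2r//.
      have : (phi n).+1%:R^-1 <= n.+1%:R^-1 :> R.
        by rewrite lef_pV2 ?posrE// ler_nat ltnS increasing_nat_ge.
      move=> h; have h' : 1 - a (phi n) ^+ 2 <= 2 * (1 - a (phi n)) by nra.
      by apply: le_trans h' _; rewrite ler_wpM2l// (le_trans (ltW ha3)).
    rewrite mulrAC ler_pdivrMr//.
    have : 2 * K / (eta / 2) <= n%:R.
      by near: n; exact: nbhs_infty_ger.
    rewrite ler_pdivrMr// -[n.+1%:R]natr1 => h; lra.
  move: (derive1 (hankel mu alpha (test_fun (a (phi n)) b)) z) (derive1 g z) h2 h3.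
  move=> u v h2 h3.
  have := ler_cabsD (v - u) u; rewrite subrK (cabs_distC v u) => h5.
  apply: le_trans (ler_wpM2l (ltW w0) h5) _; rewrite mulrDr [leRHS]splitr.
  by apply: lerD => //; exact: le_trans h2 h4.
(* If a > 1/2 and mu([a, 1)) > e (1 - a)^(b+1), then [test_hankel_lower] is at least c, because 1 -
   a^2 <= 2 (1 - a). Convergence to g, whose derivative is 0, bounds the same quantity by c/2. *)
pose c := alpha * e / 2 / 2 `^ (b + 1).
have p2 : 0 < 2 `^ (b + 1) :> R by rewrite powR_gt0.
have c0 : 0 < c by rewrite !divr_gt0// mulr_gt0.
have c20 : 0 < c / 2 by rewrite divr_gt0.
near \oo => n.
have h1 : (bloch_norm (alpha - 1) (fun z =>
    hankel mu alpha (test_fun (a (phi n)) b) z - g z)%R <= (c / 2)%:E)%E.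
  by near: n; exact: hlim.
move: h1 (hd (phi n)) (hana (phi n)) (ha (phi n)) (a01 (phi n)).
move: (a (phi n)) => t h1 hdt hat [/andP[t2 t1] _ et] t01.
have dt : disc (t%:C : C) by rewrite discE cabsR ger0_norm//; case/andP: t01.
have := bloch_norm_derivB hat gb.1 h1 dt; rewrite (g'0 _ dt) subr0.
have := test_hankel_lower al1 t01 b0 hdt => h2 h3.
have := le_trans h2 h3.
have q0 := onem_sqr_ge0 t01.
have t10 : 0 < 1 - t by rewrite subr_gt0.
have mufin' : mu `[t, 1%R[ \is a fin_num.
  rewrite ge0_fin_numE//; apply: le_lt_trans mufin; apply: le_measure;
    rewrite ?inE; try exact: measurable_itv.
  move=> s; rewrite /= !in_itv /= => /andP[s1 ->]; rewrite andbT.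
  by apply: le_trans s1; case/andP: t01.
move: et; rewrite -(fineK mufin') -EFinM lte_fin.
set m := fine _.
rewrite ltr_pdivlMr ?powR_gt0// => et.
apply/negP; rewrite -ltNge; apply: (@lt_le_trans _ _ c).
  by rewrite ltr_pdivrMr// mulr_natr mulr2n ltrDl.
rewrite powRN ler_pdivlMr ?powR_gt0//.
have h5 : (1 - t ^+ 2) `^ (b + 1) <= 2 `^ (b + 1) * (1 - t) `^ (b + 1).
  rewrite -powRM ?(ltW t10)//; apply: ge0_ler_powR => //.
  - by rewrite nnegrE ltW.
  - by rewrite nnegrE mulr_ge0// ltW.
  - nra.
apply: (le_trans (ler_wpM2l (ltW c0) h5)).
rewrite /c mulrA divfK ?gt_eqF//.
have m0 : 0 <= m by rewrite fine_ge0.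
apply: (@le_trans _ _ (alpha / 2 * m)).
  rewrite (_ : alpha * e / 2 * _ = alpha / 2 * (e * (1 - t) `^ (b + 1))); last by ring.
  by rewrite ler_wpM2l ?(ltW et)// divr_ge0// ltW.
by rewrite ler_wpM2r// [leRHS]mulrC ler_wpM2l ?(ltW al0)// ltW.
Unshelve. all: by end_near. Qed.

End compact_necessary.

(** * Compactness from the vanishing Carleson condition *)

Section ultrafilter_limits.
Context {R : realType}.
Local Notation C := (cplx R).
Variable U : set_system nat.
Context {UU : UltraFilter U}.

(** The image of an ultrafilter is an ultrafilter, hence converges in the compact [-B, B]. A single
    ultrafilter serves all Taylor coefficients at once, in place of a diagonal extraction. *)
Lemma ultra_bounded_cvg (u : nat -> R) (B : R) : (forall n, `|u n| <= B) ->
  exists l : R, forall e : R, 0 < e -> U [set n | `|u n - l| < e].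
Proof.
move=> uB.
have PU : ProperFilter U by exact: ultra_proper.
have UF : UltraFilter (u @ U).
  split=> [|G PG sG]; first exact: fmap_proper_filter.
  apply/seteqP; split=> // A GA.
  have [//|UnA] := in_ultra_setVsetC (u @^-1` A) UU.
  have GnA : G (~` A) by exact: sG.
  have G0 : G set0 by rewrite -(setICr A); exact: filterI.
  by have := @filter_not_empty _ G PG G0.
have cB := @segment_compact R (- B) B.
move: cB; rewrite compact_ultra => /(_ _ UF) [].
  have h : U [set n | `[- B, B]%classic (u n)].
    by apply: filterE => n; rewrite /= in_itv /= -ler_norml; exact: uB.
  exact: h.
move=> l [_ ul]; exists l => e e0.
move/cvgrPdist_lt : ul => /(_ _ e0); rewrite near_simpl.
by apply: filterS => n; rewrite distrC.
Qed.

Lemma ultra_bounded_cvgC (u : nat -> C) (B : R) : (forall n, cabs (u n) <= B) ->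
  exists l : C, forall e : R, 0 < e -> U [set n | cabs (u n - l) < e].
Proof.
move=> uB; have PU : ProperFilter U by exact: ultra_proper.
have [|x xl] := @ultra_bounded_cvg (fun n => complex.Re (u n)) B.
  by move=> n; apply: le_trans (uB n); exact: ler_Re_cabs.
have [|y yl] := @ultra_bounded_cvg (fun n => complex.Im (u n)) B.
  by move=> n; apply: le_trans (uB n); exact: ler_Im_cabs.
exists (x +i* y) => e e0.
have e20 : 0 < e / 2 by rewrite divr_gt0.
apply: filterS (filterI (xl _ e20) (yl _ e20)) => n [/= h1 h2].
apply: le_lt_trans (ler_cabs_ReIm _) _.
by move: h1 h2; case: (u n) => s t /=; lra.
Qed.

(** Dominated convergence along [U]: the bound at radius s makes the tails at r geometrically small
    uniformly in n, and the head has finitely many terms, each small on a set of [U]. *)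
Lemma ultra_majorant_small (c : nat -> nat -> C) (r s B : R) : 0 <= r -> r < s ->
  (forall n k, cabs (c n k) * s ^+ k <= B) ->
  (forall k e, 0 < e -> U [set n | cabs (c n k) < e]) ->
  forall e, 0 < e -> U [set n | limn (majorant (c n) r) <= e].
Proof.
move=> r0 rs cB c0 e e0; have PU : ProperFilter U by exact: ultra_proper.
have s0 : 0 < s by exact: le_lt_trans rs.
have B0 : 0 <= B by apply: le_trans (cB 0%N 0%N); rewrite mulr_ge0 ?cabs_ge0.
pose q := r / s.
have q0 : 0 <= q by apply: divr_ge0 => //; exact: ltW.
have q1 : q < 1 by rewrite /q ltr_pdivrMr// mul1r.
have qn k n : cabs (c n k) * r ^+ k <= B * q ^+ k.
  rewrite /q (expr_div_n r s) mulrA ler_pdivlMr ?exprn_gt0//.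
  by rewrite mulrAC ler_wpM2r ?exprn_ge0.
have cm n : cvgn (majorant (c n) r) by exact: cvgn_majorant r0 rs (cB n).
have e20 : 0 < e / 2 by rewrite divr_gt0.
have [K hK] : exists K, B * q ^+ K / (1 - q) <= e / 2.
  have : geometric (B / (1 - q)) q @ \oo --> (0 : R).
    by apply: cvg_geometric; rewrite ger0_norm.
  move/cvgrPdist_le => /(_ _ e20)[K _ /(_ K (leqnn K))] /=.
  rewrite sub0r normrN ger0_norm.
    by exists K; rewrite mulrAC.
  by rewrite mulr_ge0 ?exprn_ge0// divr_ge0// subr_ge0 ltW.
have fin : forall m, U [set n | \sum_(k < m) cabs (c n k) * r ^+ k <= e / 2].
  move=> m.
  suff : forall m eta, 0 < eta -> U [set n | \sum_(k < m) cabs (c n k) * r ^+ k <= eta].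
    exact.
  elim=> [|{}m IH] eta eta0.
    by apply: filterE => n /=; rewrite big_ord0 ltW.
  have eta20 : 0 < eta / 2 by rewrite divr_gt0.
  have p0 : 0 < r ^+ m + 1 by rewrite ltr_wpDl// exprn_ge0.
  apply: filterS (filterI (IH _ eta20) (c0 m _ (divr_gt0 eta20 p0))) => n [/= h1 h2].
  rewrite big_ord_recr /= [leRHS]splitr lerD//.
  rewrite ltr_pdivlMr// in h2; apply: le_trans (ltW h2).
  by rewrite ler_wpM2l ?cabs_ge0// lerDl.
apply: filterS (fin K) => n /= h.
apply: limr_le; first exact: cm.
apply: nearW => N; apply: (@le_trans _ _ (majorant (c n) r (K + N))).
  rewrite /majorant /series /= addnC (big_cat_nat (leq0n N) (leq_addr K N)) /= lerDl.
  by apply: sumr_ge0 => k _; rewrite mulr_ge0 ?cabs_ge0 ?exprn_ge0.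
rewrite /majorant /series /= (big_cat_nat (leq0n K) (leq_addr N K)) /= [leRHS]splitr.
apply: lerD; first by rewrite big_mkord.
apply: le_trans hK; rewrite ler_pdivlMr ?subr_gt0//.
rewrite -{1}[K]add0n big_addn addKn.
apply: (@le_trans _ _ ((\sum_(0 <= k < N) B * q ^+ K * q ^+ k) * (1 - q))).
  rewrite ler_wpM2r ?subr_ge0 ?(ltW q1)//; apply: ler_sum => k _.
  by rewrite -mulrA -exprD [(K + k)%N]addnC.
rewrite -mulr_sumr -mulrA ler_piMr ?mulr_ge0 ?exprn_ge0//.
by rewrite big_mkord mulrC -[1 - q]opprB mulNr -subrX1 opprB gerBl exprn_ge0.
Qed.

End ultrafilter_limits.

Section power_series_difference.
Context {R : realType}.
Local Notation C := (cplx R).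
Implicit Types (f g : C -> C) (a b : nat -> C).

Lemma cvg_PSB a b z : disc_majorized a -> disc_majorized b -> disc z ->
  power_series (fun n => a n - b n) z @ \oo --> PS a z - PS b z.
Proof.
move=> am bm z1.
rewrite (_ : power_series _ z = fun n => power_series a z n - power_series b z n).
  by apply: cvgB; exact: PS_cvg.
apply/funext => n; rewrite /power_series /series /= -sumrB.
by apply: eq_bigr => k _; rewrite mulrBl.
Qed.

Lemma disc_majorizedB a b : disc_majorized a -> disc_majorized b ->
  disc_majorized (fun n => a n - b n).
Proof.
move=> am bm; apply: disc_majorizedP => z z1; apply/cvg_ex; eexists.
exact: cvg_PSB am bm z1.
Qed.

Lemma analyticB f g : analytic_on_disc f -> analytic_on_disc g ->
  analytic_on_disc (fun z => f z - g z).
Proof.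
move=> fa ga; have fm := coefs_majorized fa; have gm := coefs_majorized ga.
apply: (analytic_PS (disc_majorizedB fm gm)) => z z1.
by rewrite (coefs_PS fa z1) (coefs_PS ga z1); apply/esym/cvgC_lim/cvg_PSB.
Qed.

Lemma coefsB f g : analytic_on_disc f -> analytic_on_disc g ->
  coefs (fun z => f z - g z) = fun n => coefs f n - coefs g n.
Proof.
move=> fa ga; apply: coefs_unique => z z1.
rewrite (coefs_PS fa z1) (coefs_PS ga z1).
exact: cvg_PSB (coefs_majorized fa) (coefs_majorized ga) z1.
Qed.

Lemma coefs0 f : analytic_on_disc f -> coefs f 0%N = f 0.
Proof. by move=> fa; rewrite (coefs_PS fa disc0) PS0. Qed.

(** Applied to the image of a difference and the difference of the images, whose agreement is
    established on the disc. *)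
Lemma bloch_norm_eq gam a f g : disc_majorized a ->
  (forall z, disc z -> f z = PS a z) -> (forall z, disc z -> g z = PS a z) ->
  bloch_norm gam f = bloch_norm gam g.
Proof.
move=> am fE gE; rewrite /bloch_norm (fE _ disc0) (gE _ disc0).
have dE z : disc z -> derive1 f z = derive1 g z.
  by move=> z1; exact: etrans (derive1_PS am fE z1) (esym (derive1_PS am gE z1)).
suff -> : bloch_seminorm gam f = bloch_seminorm gam g by [].
apply/eqP; rewrite eq_le; apply/andP; split; apply: ge_ereal_sup => _ [z z1 <-].
  by rewrite dE// bloch_seminorm_ubound.
by rewrite -dE// bloch_seminorm_ubound.
Qed.

End power_series_difference.

Section bloch_compactness.
Context {R : realType}.
Local Notation C := (cplx R).
Variable U : set_system nat.
Context {UU : UltraFilter U}.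
Implicit Types (b r s : R).

Lemma ultra_ex (A : set nat) : U A -> exists n, A n.
Proof.
have PU : ProperFilter U by exact: ultra_proper.
exact: filter_ex.
Qed.

Lemma ultra_limit_le (u : nat -> C) l (B : R) :
  (forall e : R, 0 < e -> U [set n | cabs (u n - l) < e]) ->
  (forall n, cabs (u n) <= B) -> cabs l <= B.
Proof.
move=> ul uB; apply/ler_addgt0Pr => e e0.
have [n /= hn] := ultra_ex (ul e e0).
have := ler_cabsD (l - u n) (u n); rewrite subrK (cabs_distC l).
by move: (uB n) hn; lra.
Qed.

Lemma bloch_coef_bound b f (N : R) k r : 1 < b -> bloch b f ->
  (bloch_norm b f <= N%:E)%E -> 0 < r < 1 ->
  cabs (coefs f k) * r ^+ k <= N * (1 + (b - 1)^-1) * (1 - r) `^ (1 - b) :> R.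
Proof.
move=> b1 fb fN r01; apply: cauchy_estimate => //; first exact: fb.1.
move=> z zr; rewrite -zr; apply: bloch_growth_norm => //.
by rewrite discE zr; case/andP: r01.
Qed.

Lemma deriv_coef_bound (c : nat -> C) r s B n : 0 <= r -> r < s ->
  (forall n, cabs (c n) * s ^+ n <= B) ->
  cabs (deriv_coef c n) * r ^+ n <= B / (s - r).
Proof.
move=> r0 rs cB; rewrite ler_pdivlMr ?subr_gt0//.
rewrite /deriv_coef -[X in cabs X]mulr_natr cabsM cabs_nat.
apply: le_trans (cB n.+1); rewrite -!mulrA ler_wpM2l ?cabs_ge0// mulrA.
have := @bernoulli_exprD R r (s - r) n r0; rewrite [r + _]addrC subrK; apply.
by rewrite subr_ge0 ltW.
Qed.

(** The coefficientwise limits define g, and the derivatives of f_n come within any e of that of g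
    at each point, so the seminorm bound passes to g. The bound is N + N because the value at 0 and
    the seminorm are each bounded by N separately. *)
Lemma ultra_bloch_limit b (f_ : nat -> C -> C) (N : R) : 1 < b ->
  (forall n, bloch b (f_ n) /\ (bloch_norm b (f_ n) <= N%:E)%E) ->
  exists g, [/\ bloch b g, (bloch_norm b g <= (N + N)%:E)%E &
    forall k e, 0 < e -> U [set n | cabs (coefs (f_ n) k - coefs g k) < e]].
Proof.
move=> b1 fN; have PU : ProperFilter U by exact: ultra_proper.
pose D r := N * (1 + (b - 1)^-1) * (1 - r) `^ (1 - b).
have cD n k r : 0 < r < 1 -> cabs (coefs (f_ n) k) * r ^+ k <= D r.
  by move=> r01; have [fb fn] := fN n; exact: bloch_coef_bound.
have /choice[L hL] : forall k, exists l : C, forall e : R, 0 < e ->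
    U [set n | cabs (coefs (f_ n) k - l) < e].
  move=> k; apply: (@ultra_bounded_cvgC R U UU (fun n => coefs (f_ n) k) (D 2^-1 / 2^-1 ^+ k)) => n.
  by rewrite ler_pdivlMr ?exprn_gt0 ?invr_gt0// cD// invr_gt0 ltr0n invf_lt1// ltr1n.
have LD k r : 0 < r < 1 -> cabs (L k) * r ^+ k <= D r.
  move=> r01; have /andP[r0 _] := r01; rewrite -ler_pdivlMr ?exprn_gt0//.
  by apply: (ultra_limit_le (hL k)) => n; rewrite ler_pdivlMr ?exprn_gt0// cD.
have Lm : disc_majorized L.
  move=> r /andP[r0 r1].
  apply: (@cvgn_majorant _ L r ((r + 1) / 2) (D ((r + 1) / 2)) r0); first lra.
  by move=> n; apply: LD; lra.
have ga : analytic_on_disc (PS L) by exact: (analytic_PS Lm).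
have gL : coefs (PS L) = L by apply: coefs_unique => z z1; exact: PS_cvg.
suff gN : (bloch_norm b (PS L) <= (N + N)%:E)%E.
  exists (PS L); split=> //; last by rewrite gL.
  exact: bloch_of_norm ga gN.
rewrite /bloch_norm EFinD; apply: leeD.
  rewrite lee_fin PS0; apply: (ultra_limit_le (hL 0%N)) => n.
  have [fb fn] := fN n; rewrite coefs0; last exact: fb.1.
  have [S [S0 E _]] := blochP fb.
  by rewrite E lee_fin in fn; apply: le_trans fn; rewrite lerDl.
apply: bloch_seminorm_le => z z1; have z1' : cabs z < 1 by [].
have z0 := cabs_ge0 z.
have w1 : (1 - cabs z ^+ 2) `^ b <= 1.
  have := @ge0_ler_powR R b _ (1 - cabs z ^+ 2) 1; rewrite powR1; apply.
  - by rewrite ltW// (lt_trans _ b1).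
  - by rewrite nnegrE subr_ge0 exprn_ile1// ltW.
  - by rewrite nnegrE.
  - by rewrite gerBl sqr_ge0.
apply/ler_addgt0Pr => e e0.
pose c n k := coefs (f_ n) k - L k.
(* |z| < r < s < 1: coefficients are bounded at s, differentiated coefficients at r, and the
   majorant is taken at |z|. *)
pose r := (2 * cabs z + 1) / 3; pose s := (cabs z + 2) / 3.
have r0 : 0 < r by rewrite /r; lra.
have rs : r < s by rewrite /r /s; lra.
have zr : cabs z < r by rewrite /r; lra.
have s01 : 0 < s < 1 by rewrite /s; lra.
have cB n k : cabs (c n k) * s ^+ k <= D s + D s.
  apply: le_trans (ler_wpM2r _ (ler_cabsB _ _)) _.
    by rewrite exprn_ge0// ltW; case/andP: s01.
  by rewrite mulrDl lerD ?cD ?LD.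
have [n /= hn] : exists n, limn (majorant (deriv_coef (c n)) (cabs z)) <= e.
  apply: ultra_ex; apply: (@ultra_majorant_small _ U UU (fun n => deriv_coef (c n))
    (cabs z) r ((D s + D s) / (s - r))) => //.
    by move=> n k; apply: deriv_coef_bound => //; exact: ltW.
  move=> k d d0; have k0 : 0 < k.+1%:R :> R by [].
  apply: filterS (hL k.+1 _ (divr_gt0 d0 k0)) => n /= h.
  rewrite /deriv_coef -[X in cabs X]mulr_natr cabsM cabs_nat -ltr_pdivlMr//.
have [fb fn] := fN n.
have fm := coefs_majorized fb.1.
have cm : disc_majorized (c n) by exact: disc_majorizedB.
have dE : PS (deriv_coef L) z = derive1 (f_ n) z - PS (deriv_coef (c n)) z.
  rewrite (derive1_PS fm (fun w => coefs_PS fb.1) z1).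
  rewrite -(cvgC_lim (cvg_PSB (disc_majorized_deriv fm) (disc_majorized_deriv cm) z1)).
  rewrite /PS; congr (limn (power_series _ z)); apply/funext => k.
  by rewrite /deriv_coef /c mulrnBl opprB addrC subrK.
rewrite (derive1_PS Lm (fun _ _ => erefl) z1) dE.
apply: le_trans (ler_wpM2l (powR_ge0 _ _) (ler_cabsB _ _)) _.
rewrite mulrDr; apply: lerD.
  have [S [S0 E hS]] := blochP fb; apply: le_trans (hS z z1) _.
  by rewrite E lee_fin in fn; apply: le_trans fn; rewrite lerDr cabs_ge0.
apply: le_trans hn; apply: le_trans (PS_le (disc_majorized_deriv cm) z1).
by rewrite ler_piMl ?cabs_ge0.
Qed.

Lemma ultra_bloch_segment b (f_ : nat -> C -> C) g (N : R) t0 e : 1 < b ->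
  (forall n, bloch b (f_ n) /\ (bloch_norm b (f_ n) <= N%:E)%E) ->
  bloch b g -> (bloch_norm b g <= N%:E)%E ->
  (forall k e, 0 < e -> U [set n | cabs (coefs (f_ n) k - coefs g k) < e]) ->
  0 <= t0 < 1 -> 0 < e ->
  U [set n | forall t : R, 0 <= t < t0 -> cabs (f_ n t%:C - g t%:C) <= e].
Proof.
move=> b1 fN gb gN fg /andP[t00 t01] e0; have PU : ProperFilter U by exact: ultra_proper.
pose s := (t0 + 1) / 2; have s01 : 0 < s < 1 by rewrite /s; lra.
have ts : t0 < s by rewrite /s; lra.
pose D := N * (1 + (b - 1)^-1) * (1 - s) `^ (1 - b).
pose c n k := coefs (f_ n) k - coefs g k.
have cB n k : cabs (c n k) * s ^+ k <= D + D.
  apply: le_trans (ler_wpM2r _ (ler_cabsB _ _)) _.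
    by rewrite exprn_ge0// ltW; case/andP: s01.
  have [fb fn] := fN n.
  by rewrite mulrDl lerD//; exact: bloch_coef_bound.
apply: filterS (ultra_majorant_small t00 ts cB fg e0) => n /= hn t /andP[tge0 tlt].
have [fb fn] := fN n.
have t1 : disc (t%:C : C) by rewrite discE cabsR ger0_norm// (lt_trans tlt).
have cm : disc_majorized (c n) by apply: disc_majorizedB; apply: coefs_majorized; [exact: fb.1|exact: gb.1].
have tt0 : cabs (t%:C : C) <= t0 by rewrite cabsR ger0_norm// ltW.
have [|_] := PS_dominated tt0 (_ : cvgn (majorant (c n) t0)).
  by apply: cm; rewrite t00.
move=> /le_trans/(_ hn); rewrite (coefs_PS fb.1 t1) (coefs_PS gb.1 t1).
rewrite -(cvgC_lim (cvg_PSB (coefs_majorized fb.1) (coefs_majorized gb.1) t1)).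
exact.
Qed.

End bloch_compactness.

(** * Norm convergence of the Hankel images *)

Section vanishing_sufficient.
Context {R : realType}.
Local Notation C := (cplx R).
Variable mu : {measure set (measurableTypeR R) -> \bar R}.
Implicit Types (f g : C -> C) (alpha b : R).

Lemma vanishing_tail s (e : R) : vanishing_carleson mu s -> 0 < e ->
  exists2 t0 : R, 0 <= t0 < 1 & tail_carleson mu t0 s e.
Proof.
move=> [/carleson_tail[M M0 mM] hv] e0; have mufin := tail_carleson_fin mM.
have {}hv : \forall t \near 1^'-, (mu `[t, 1%R[ * ((1 - t) `^ s)^-1%:E <= e%:E)%E.
  move: e e0; apply/cvge0P => //; apply: nearW => t.
  by rewrite mule_ge0// lee_fin invr_ge0 powR_ge0.
have [d d0 hd] : exists2 d : R, 0 < d & forall t, 1 - d < t < 1 ->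
    (mu `[t, 1%R[ * ((1 - t) `^ s)^-1%:E <= e%:E)%E.
  have [d /= d0 hd] := hv; exists d => // t /andP[t1 t2].
  by apply: hd => //=; rewrite gtr0_norm ?subr_gt0// ltrBlDr -ltrBlDl.
(* Half of d, because [hd] asks for the strict inequality 1 - d < t. *)
pose t0 := Num.max 0 (1 - d / 2).
exists t0; first by rewrite /t0 le_max lexx gt_max ltr01 gtrBl divr_gt0.
move=> t /andP[]; rewrite /t0 ge_max => /andP[tge0 td] t1.
have mufin' : mu `[t, 1%R[ \is a fin_num.
  rewrite ge0_fin_numE//; apply: le_lt_trans mufin; apply: le_measure;
    rewrite ?inE; try exact: measurable_itv.
  by move=> u; rewrite /= !in_itv /= => /andP[u1 ->]; rewrite andbT (le_trans tge0).
have := hd t; rewrite t1 andbT -(fineK mufin') -EFinM !lee_fin.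
rewrite ler_pdivrMr ?powR_gt0 ?subr_gt0//; apply.
by lra.
Qed.

Lemma hankel_coefB alpha f g n : analytic_on_disc f -> analytic_on_disc g ->
  hankel_defined mu alpha f -> hankel_defined mu alpha g ->
  hankel_coef mu alpha (fun z => f z - g z) n =
  hankel_coef mu alpha f n - hankel_coef mu alpha g n.
Proof.
move=> fa ga [_ /(_ n) fc _ _] [_ /(_ n) gc _ _]; apply: cvgC_lim.
have -> : series (hankel_row mu alpha (fun z => f z - g z) n) =
    fun K => series (hankel_row mu alpha f n) K - series (hankel_row mu alpha g n) K.
  apply/funext => K; rewrite /series /= -sumrB; apply: eq_bigr => k _.
  by rewrite /hankel_row (coefsB fa ga) mulrBr.
have h1 : series (hankel_row mu alpha f n) @ \oo --> hankel_coef mu alpha f n by exact: fc.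
have h2 : series (hankel_row mu alpha g n) @ \oo --> hankel_coef mu alpha g n by exact: gc.
exact: (cvgB h1 h2).
Qed.

Lemma bloch_norm_hankelB gam alpha f g : analytic_on_disc f -> analytic_on_disc g ->
  hankel_defined mu alpha f -> hankel_defined mu alpha g ->
  bloch_norm gam (hankel mu alpha (fun z => f z - g z)) =
  bloch_norm gam (fun z => hankel mu alpha f z - hankel mu alpha g z).
Proof.
move=> fa ga fd gd.
have [fm fE] := hankel_defined_PS fd; have [gm gE] := hankel_defined_PS gd.
have cE : hankel_coef mu alpha (fun z => f z - g z) =
    fun n => hankel_coef mu alpha f n - hankel_coef mu alpha g n.
  by apply/funext => n; exact: hankel_coefB.
apply: (bloch_norm_eq _ (disc_majorizedB fm gm)) => z z1.
  by rewrite /hankel cE.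
by rewrite fE// gE//; apply/esym/cvgC_lim/cvg_PSB.
Qed.

Lemma bloch_growthB b f g (N : R) z : 1 < b -> bloch b f -> bloch b g ->
  (bloch_norm b f <= N%:E)%E -> (bloch_norm b g <= N%:E)%E -> disc z ->
  cabs (f z - g z) <= (N + N) * (1 + (b - 1)^-1) * (1 - cabs z) `^ (1 - b).
Proof.
move=> b1 fb gb fN gN z1; apply: le_trans (ler_cabsB _ _) _.
by rewrite -mulrA mulrDl !mulrA; apply: lerD; exact: bloch_growth_norm.
Qed.

Lemma vanishing_compact alpha b : 1 < alpha -> 1 < b ->
  vanishing_carleson mu (b + 1) -> hankel_compact mu alpha b (alpha - 1).
Proof.
move=> a1 b1 hv; have hm := (carleson_bounded a1 b1 hv.1).1; split=> // f_ N0 fN0.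
have [M M0 mM] := (carleson_tail mu (b + 1)).1 hv.1.
have [U [UU sU]] := ultraFilterLemma (eventually_filter : ProperFilter \oo).
have PU : ProperFilter U by exact: ultra_proper.
have [g [gb gN fg]] := ultra_bloch_limit b1 fN0.
pose N := N0 + N0.
have N00 : 0 <= N0.
  by rewrite -lee_fin; apply: le_trans (fN0 0%N).2; exact: bloch_norm_ge0.
have fN n : bloch b (f_ n) /\ (bloch_norm b (f_ n) <= N%:E)%E.
  have [fb fn] := fN0 n; apply: conj fb (le_trans fn _).
  by rewrite lee_fin lerDl.
pose K := (2 `^ (b - 1) * 16) * (1 + alpha ^+ 2 / (alpha - 1) * 2 `^ (alpha - 1)).
have K0 : 0 <= K.
  rewrite !mulr_ge0 ?powR_ge0 ?addr_ge0//.
  by rewrite mulr_ge0 ?powR_ge0 ?divr_ge0 ?sqr_ge0// subr_ge0 ltW.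
pose D1 := (N + N) * (1 + (b - 1)^-1).
have D10 : 0 <= D1.
  by rewrite mulr_ge0 ?addr_ge0 ?invr_ge0 ?subr_ge0 ?(ltW b1).
have [gd gH] := hm g gb.
have small (d : R) : 0 < d -> U [set n | (bloch_norm (alpha - 1)
    (fun z => hankel mu alpha (f_ n) z - hankel mu alpha g z)%R <= d%:E)%E].
  move=> d0.
  (* With D0 = q/M and e = q/(D1 + 1) both products D0 M and D1 e are at most q, and 2 q K = d K/(K
     + 1) <= d. *)
  pose q := d / 2 / (K + 1).
  have K10 : 0 < K + 1 by rewrite ltr_wpDl.
  have q0 : 0 < q by rewrite !divr_gt0.
  have eta0 : 0 < q / M by rewrite divr_gt0.
  have D110 : 0 < D1 + 1 by rewrite ltr_wpDl.
  have e0 : 0 < q / (D1 + 1) by rewrite divr_gt0.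
  have [t0 t001 me] := vanishing_tail hv e0.
  apply: filterS (ultra_bloch_segment b1 fN gb gN fg t001 eta0) => n /= hn.
  have [fb fn] := fN n; have [fd fH] := hm _ fb.
  have [|t /andP[tge0 tlt]|_ _ _] := @hankel_main R mu (fun z => f_ n z - g z) alpha b t0 M
    (q / (D1 + 1)) (q / M) D1 a1 b1 t001 (ltW M0) (ltW e0) (ltW eta0) D10 mM me
    (analyticB fb.1 gb.1).
  - by move=> z z1; exact: (bloch_growthB b1 fb gb fn gN z1).
  - apply: le_trans (hn t _) _; first by rewrite tge0.
    rewrite ler_peMr ?(ltW eta0)//.
    have /andP[_ t01] := t001; have t1 : t < 1 by exact: lt_trans t01.
    have := @ler_powRN R (1 - t) 1 (b - 1); rewrite powR1 opprB; apply.
    + by rewrite subr_ge0 ltW.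
    + by rewrite subr_gt0.
    + by rewrite gerBl.
  rewrite (bloch_norm_hankelB _ fb.1 gb.1 fd gd) => /le_trans; apply.
  rewrite lee_fin divfK ?gt_eqF// -mulrA -/K.
  apply: (@le_trans _ _ ((q + q) * K)).
    rewrite ler_wpM2r// lerD2l mulrCA ler_piMr ?(ltW q0)//.
    by rewrite ler_pdivrMr// mul1r lerDl.
  rewrite (_ : q + q = d / (K + 1)); last by rewrite /q; field; rewrite gt_eqF.
  by rewrite mulrAC ler_pdivrMr// ler_wpM2l ?(ltW d0)// lerDl.
(* The subsequence is recovered from the ultrafilter: [U] contains all tails, so a good index exists
   beyond any prescribed bound. The pair holds the precision and that bound; feeding back phi m + 1
   makes phi increasing. *)
have /choice[pick hpick] : forall m : nat * nat, exists n : nat, (m.2 <= n)%N /\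
    (bloch_norm (alpha - 1) (fun z => hankel mu alpha (f_ n) z - hankel mu alpha g z)%R
      <= (m.1.+1%:R^-1 : R)%:E)%E.
  move=> m; have m0 : 0 < m.1.+1%:R^-1 :> R by rewrite invr_gt0.
  have tl : U [set n | (m.2 <= n)%N] by apply: sU; exists m.2.
  by have [n [/= n1 n2]] := ultra_ex (filterI tl (small _ m0)); exists n.
pose phi := fix phi m := if m is m'.+1 then pick (m'.+1, (phi m').+1) else pick (0, 0)%N.
have hphi m : (bloch_norm (alpha - 1)
    (fun z => hankel mu alpha (f_ (phi m)) z - hankel mu alpha g z)%R
      <= (m.+1%:R^-1 : R)%:E)%E.
  by case: m => [|m] /=; [have [] := hpick (0, 0)%N|have [] := hpick (m.+1, (phi m).+1)].
exists phi, (hankel mu alpha g); split=> //.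
  by apply/increasing_seqP => m /=; have [] := hpick (m.+1, (phi m).+1).
apply/cvge0P; first by apply: nearW => m; exact: bloch_norm_ge0.
move=> e e0; near=> m; apply: le_trans (hphi m) _; rewrite lee_fin.
rewrite invf_ple ?posrE//; apply: (@le_trans _ _ m%:R); last by rewrite ler_nat.
by near: m; exact: nbhs_infty_ger.
Unshelve. all: by end_near. Qed.

End vanishing_sufficient.

Theorem theorem3p4 (R : realType) (alpha beta : R)
    (mu : {measure set (measurableTypeR R) -> \bar R})
    (halpha : 2 <= alpha) (hbeta : 1 < beta)
    (hmu : mu (~` `[0, 1[) = 0%E) :
  (hankel_bounded mu alpha beta (alpha - 1) <-> carleson mu (beta + 1)) /\
  (hankel_compact mu alpha beta (alpha - 1) <->
     vanishing_carleson mu (beta + 1)).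
Proof.
have a1 : 1 < alpha by apply: lt_le_trans halpha; rewrite ltr1n.
by split; split; [exact: bounded_carleson|exact: carleson_bounded|
  exact: compact_vanishing|exact: vanishing_compact].
Qed.
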